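(* Let $n,l\in\mathbb{N}$, $h>1$, $T=h^{l}$, $0<\alpha<1$, $\mathcal{A}_0,\mathcal{A}_1\in\mathbb{R}^{n\times n}$ and $f\in C([1,T],\mathbb{R}^n)$. The solution $y$ of $$\left({}^{H}D_{1^{+}}^{\alpha}y\right)(t)=\mathcal{A}_0y(t)+\mathcal{A}_1y\left(\frac{t}{h}\right)+f(t),\quad t\in(1,T],$$ with zero initial condition, i.e. $y(t)=0$ for $\frac1h<t\le1$ and $\left({}^{H}I_{1^{+}}^{1-\alpha}y\right)(1^{+})=0$, has the form $$y(t)=\int_{1}^{t}Y_{h,\alpha,\alpha}^{\mathcal{A}_0,\mathcal{A}_1}(t,s)f(s)\frac{ds}{s},\quad 1\le t\le T.$$
   Context: $\Theta$ is the zero matrix and $I$ the identity matrix. For $0<\alpha<1$ and $c>0$ the Hadamard fractional integral and derivative are, for $t>c$, $$({}^{H}I_{c^{+}}^{\alpha}y)(t)=\frac{1}{\Gamma(\alpha)}\int_c^t\left(\ln\frac ts\right)^{\alpha-1}y(s)\frac{ds}{s},\qquad ({}^{H}D_{c^{+}}^{\alpha}y)(t)=\frac{1}{\Gamma(1-\alpha)}\left(t\frac{d}{dt}\right)\int_{c}^{t}\left(\ln\frac{t}{s}\right)^{-\alpha}y(s)\frac{ds}{s},$$ and $({}^{H}I_{c^+}^{1-\alpha}y)(c^+)$ is the limit as $t\to c^+$. For $\alpha,\beta>0$, a square matrix $\mathcal{A}_0$ and $x>0$, put $$e_{\alpha,\beta}(\mathcal{A}_0;x)=x^{\beta-1}\sum_{m=0}^{\infty}\frac{\mathcal{A}_0^{m}x^{\alpha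 m}}{\Gamma(m\alpha+\beta)}.$$ For $s>0$ define recursively $Y_{\alpha,\beta,0}(t,s)=e_{\alpha,\beta}(\mathcal{A}_0;\ln\frac{t}{s})$ for $t>s$, and for $k\ge1$, $t>sh^k$, $$Y_{\alpha,\beta,k}(t,sh^{k})=\int_{sh^{k}}^{t}e_{\alpha,\alpha}\left(\mathcal{A}_{0};\ln\frac{t}{r}\right)\mathcal{A}_{1}\,Y_{\alpha,\beta,k-1}\left(\frac{r}{h},sh^{k-1}\right)\frac{dr}{r}.$$ The delayed Mittag-Leffler type function with logarithm generated by $\mathcal{A}_0,\mathcal{A}_1$ is $$Y_{h,\alpha,\beta}^{\mathcal{A}_0,\mathcal{A}_1}(t,s)=\begin{cases}\Theta,& t<s,\\ I,& t=s,\\ \sum_{j=0}^{k}Y_{\alpha,\beta,j}(t,sh^{j}),& sh^{k}<t\le sh^{k+1},\ k=0,1,2,\dots\end{cases}$$ *)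

(* Defs.v *)
From HB Require Import structures.
From mathcomp Require Import all_boot all_order all_algebra.
From mathcomp Require Import all_classical all_reals all_analysis.
Set Implicit Arguments.
Unset Strict Implicit.
Unset Printing Implicit Defensive.
Import Order.TTheory GRing.Theory Num.Theory.
Import numFieldNormedType.Exports.
Local Open Scope classical_set_scope.
Local Open Scope ring_scope.

(* [Rintegral] is total, with an unspecified value on non-integrable functions;
   [mx_integrable] is stated separately wherever existence of the integral is
   part of the mathematical hypothesis. *)
Definition mx_integrable (R : realType) (p q : nat) (D : set R)
    (F : R -> 'M[R]_(p, q)) : Prop :=
  forall i j, lebesgue_measure.-integrable D (fun x => (F x i j)%:E).

Definition mx_integral (R : realType) (p q : nat) (D : set R)
    (F : R -> 'M[R]_(p, q)) : 'M[R]_(p, q) :=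
  \matrix_(i, j) \int[lebesgue_measure]_(x in D) (F x i j).

Definition Gamma (R : realType) (a : R) : R :=
  \int[lebesgue_measure]_(x in `]0, +oo[) (x `^ (a - 1) * expR (- x)).

(* The derivative relative to [D]: two-sided at interior points of [D], and
   one-sided at an endpoint of an interval [D]. *)
Definition derivable_within (R : realType) (p q : nat) (D : set R)
    (F : R -> 'M[R]_(p, q)) (t : R) : Prop :=
  cvg ((u - t)^-1 *: (F u - F t) @[u --> within D t^']).

Definition derive_within (R : realType) (p q : nat) (D : set R)
    (F : R -> 'M[R]_(p, q)) (t : R) : 'M[R]_(p, q) :=
  lim ((u - t)^-1 *: (F u - F t) @[u --> within D t^']).

(* The integrand (ln (t/s))^e y(s) / s shared by the fractional integral
   (e = alpha - 1) and the fractional derivative (e = - alpha). *)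
Definition hadamard_integrand (R : realType) (n : nat) (e : R)
    (y : R -> 'cV[R]_n) (t s : R) : 'cV[R]_n :=
  (ln (t / s) `^ e / s) *: y s.

Definition hadamardI (R : realType) (n : nat) (alpha c : R)
    (y : R -> 'cV[R]_n) (t : R) : 'cV[R]_n :=
  (Gamma alpha)^-1 *:
    mx_integral `]c, t] (hadamard_integrand (alpha - 1) y t).

(* For a function [y] known on ]c, b] only; at t = b the operator d/dt is the
   left derivative. *)
Definition hadamardD (R : realType) (n : nat) (alpha c b : R)
    (y : R -> 'cV[R]_n) (t : R) : 'cV[R]_n :=
  (Gamma (1 - alpha))^-1 *: (t *: derive_within `]c, b]
    (fun u => mx_integral `]c, u] (hadamard_integrand (- alpha) y u)) t).

Definition has_hadamardD (R : realType) (n : nat) (alpha c b : R)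
    (y : R -> 'cV[R]_n) : Prop :=
  forall t, c < t <= b ->
    mx_integrable `]c, t] (hadamard_integrand (- alpha) y t) /\
    derivable_within `]c, b]
      (fun u => mx_integral `]c, u] (hadamard_integrand (- alpha) y u)) t.

Definition ML (R : realType) (n : nat) (alpha beta : R) (A0 : 'M[R]_n) (x : R)
    : 'M[R]_n :=
  x `^ (beta - 1) *:
    lim (series (fun m : nat =>
      (x `^ (alpha * m%:R) / Gamma (m%:R * alpha + beta)) *: A0 ^+ m) @ \oo).

(* [Ylayer h alpha beta A0 A1 k t s] is Y_{alpha,beta,k}(t, s h^k): the second
   argument is s itself, not s h^k. *)
Fixpoint Ylayer (R : realType) (n : nat) (h alpha beta : R) (A0 A1 : 'M[R]_n)
    (k : nat) (t s : R) : 'M[R]_n :=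
  match k with
  | 0%N => ML alpha beta A0 (ln (t / s))
  | k'.+1 => mx_integral `[s * h ^+ k, t]
      (fun r => r^-1 *: (ML alpha alpha A0 (ln (t / r)) *m A1 *m
                         Ylayer h alpha beta A0 A1 k' (r / h) s))
  end.

(* For s > 0, h > 1 and t > s the [k] selected by [xget] exists and is
   unique. *)
Definition delayedML (R : realType) (n : nat) (h alpha beta : R)
    (A0 A1 : 'M[R]_n) (t s : R) : 'M[R]_n :=
  if t < s then 0
  else if t == s then 1%:M
  else let k := xget 0%N [set k : nat | s * h ^+ k < t <= s * h ^+ k.+1] in
       \sum_(0 <= j < k.+1) Ylayer h alpha beta A0 A1 j t s.

(* Continuity on ]1, T] is what makes a solution determined at every point:
   for A0 = A1 = 0, changing y on a null set affects none of the other
   conditions. No behaviour of y at 1 from the right is imposed besides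
   existence of the integrals and the initial condition. *)
Definition is_solution (R : realType) (n : nat) (h T alpha : R)
    (A0 A1 : 'M[R]_n) (f y : R -> 'cV[R]_n) : Prop :=
  [/\ {within `]1, T], continuous y},
      has_hadamardD alpha 1 T y,
      forall t, 1 < t <= T ->
        hadamardD alpha 1 T y t = A0 *m y t + A1 *m y (t / h) + f t,
      forall t, h^-1 < t <= 1 -> y t = 0
    & hadamardI (1 - alpha) 1 y t @[t --> 1^'+] --> (0 : 'cV[R]_n)].

(* Main.v *)
(** In the variable x = ln t, with tau = ln h, Hadamard integrals become Volterra convolutions
with k_a(x) = x^(a-1) / Gamma(a), and t |-> t / h becomes the translation by tau. The kernel
E = sum_m A0^m k_(ma+a) is the resolvent of k_a A0: u = k_a * (A0 u + g) iff u = E * g. The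
layers are E_0 = E and E_j = E * (A1 E_(j-1)), so the formula reads
v(x) = sum_j (E_j * f)(x - j tau), and v = k_a * (A0 v + A1 v(. - tau) + f) follows from
v = E * (A1 v(. - tau) + f). Convolving with k_(1-a) and differentiating gives the equation.

Conversely, a solution u satisfies k_(1-a) * u = k_1 * (A0 u + A1 u(. - tau) + f), both sides
having the same derivative off 0 and tau and the limit 0 at 0. Nothing is known of u near 0
beyond integrability, but W = k_1 * u = k_a * (k_(1-a) * u) is bounded and solves the same
delayed Volterra equation as k_1 * v, with forcing term k_1 * f. That equation has a unique
solution, by induction over intervals of length tau; differentiating k_1 * u = k_1 * v gives
u = v. *)
Require Import Defs.
From HB Require Import structures.
From mathcomp Require Import all_boot all_order all_algebra.
From mathcomp Require Import all_classical all_reals all_analysis.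
From mathcomp Require Import measurable_realfun ring lra.
Set Implicit Arguments.
Unset Strict Implicit.
Unset Printing Implicit Defensive.
Import Order.TTheory GRing.Theory Num.Theory.
Import numFieldNormedType.Exports.
Local Open Scope classical_set_scope.
Local Open Scope ring_scope.

(** The analytic core is associativity of convolution, for which Fubini wants absolute
    integrability. Two regimes provide it. Every object built from the formula is bounded, up to a
    horizon [X], by a multiple of [frac_kernel a], and the beta integral makes this class stable
    under convolution. For a solution no such bound is known, but [frac_kernel a] and
    [frac_kernel (1 - a)] are nonnegative and convolve to [frac_kernel 1], which is bounded, so that
    integrability of [u] suffices. Two points shape the rest. The delayed term of a solution may be
    discontinuous at [tau], because a priori [u] need not have a limit at 0; the functions with
    equal derivatives are therefore compared on either side of [tau] and glued there by continuity.
    At [t = T] the equation involves a left derivative only: the formula is continued past [ln T],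
    so that a two-sided derivative can be restricted, whereas a solution is compared on the open
    interval and its value at [T] is recovered from continuity. *)

(** * Image of a measure with density *)

Section weighted_pushforward.
Context {R : realType}.
Local Notation mu := (@lebesgue_measure R).
Variables (w phi : R -> R).
Hypothesis mw : measurable_fun setT w.
Hypothesis w0 : forall s, 0 <= w s.
Hypothesis mphi : measurable_fun setT phi.

Definition weighted_pushforward (A : set (measurableTypeR R)) : \bar R :=
  (\int[mu]_s ((w s)%:E * (\1_A (phi s))%:E))%E.

Let mind A : measurable A ->
  measurable_fun setT (fun s : R => (\1_A (phi s) : R)).
Proof. by move=> mA; exact: measurableT_comp. Qed.

Let mwind A : measurable A ->
  measurable_fun setT ((fun s => (w s)%:E * (\1_A (phi s))%:E)%E : R -> \bar R).
Proof.
by move=> mA; apply: emeasurable_funM; apply/measurable_EFinP => //; exact: mind.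
Qed.

Let wp0 : weighted_pushforward set0 = 0%E.
Proof.
by rewrite /weighted_pushforward integral0_eq// => s _; rewrite indic0 mule0.
Qed.

Let wp_ge0 A : (0 <= weighted_pushforward A)%E.
Proof. by apply: integral_ge0 => s _; rewrite mule_ge0// lee_fin. Qed.

Let wp_sigma : semi_sigma_additive weighted_pushforward.
Proof.
move=> F mF tF mUF; apply: cvg_toP.
  by apply: is_cvg_nneseries => *; exact: wp_ge0.
rewrite -integral_nneseries//; last 2 first.
- by move=> n; apply: (mwind (mF n)).
- by move=> n s _; rewrite mule_ge0// lee_fin.
apply: eq_integral => s _; rewrite nneseriesZl//.
congr (_ * _)%E.
apply/cvg_lim => //.
exact: (@measure_semi_sigma_additive _ (measurableTypeR R) R
  (@dirac _ (measurableTypeR R) (phi s) R) F mF tF mUF).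
Qed.

HB.instance Definition _ := isMeasure.Build _ _ _ weighted_pushforward
  wp0 wp_ge0 wp_sigma.

Lemma weighted_pushforward_unique :
  (forall a b, a < b -> weighted_pushforward `]a, b] = (b - a)%:E) ->
  forall A, measurable A -> mu A = weighted_pushforward A.
Proof.
move=> H; apply: (@lebesgue_measure_unique R (weighted_pushforward : {measure set (measurableTypeR R) -> \bar R})).
move=> _ [[a b] _ <-] /=.
rewrite [LHS]lebesgue_measure_itv/= lte_fin.
have [ab|ba] := ltP a b; first by rewrite H// EFinB.
by rewrite set_itv_ge ?wp0// bnd_simp -leNgt.
Qed.

Import HBNNSimple.

(** Approximation by simple functions: on indicators the identity is the hypothesis on measures, and
    both sides pass to monotone limits. *)
Lemma ge0_integral_weighted_pushforward (f : R -> \bar R) :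
  measurable_fun setT f -> (forall x, 0 <= f x)%E ->
  (forall A, measurable A -> mu A = weighted_pushforward A) ->
  (\int[mu]_x f x = \int[mu]_s ((w s)%:E * f (phi s)))%E.
Proof.
move=> mf f0 muw.
pose g := nnsfun_approx measurableT mf.
have gf x : (g n x)%:E @[n --> \oo] --> f x by apply: cvg_nnsfun_approx => //.
have ndg x : nondecreasing_seq (fun n => g n x).
  by move=> m n mn; have /lefP := nd_nnsfun_approx measurableT mf mn; exact.
have mg n : measurable_fun [set: R] (g n) by exact: measurable_funP.
transitivity (limn (fun n => \int[mu]_x (g n x)%:E)%E).
  rewrite -monotone_convergence//.
  - by apply: eq_integral => x _; apply/esym/cvg_lim => //; exact: gf.
  - by move=> n; apply/measurable_EFinP; exact: mg.
  - by move=> n x _; rewrite lee_fin.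
  - by move=> x _ m n mn; rewrite lee_fin; exact: ndg.
transitivity (limn (fun n => \int[mu]_s ((w s)%:E * (g n (phi s))%:E))%E); last first.
  rewrite -monotone_convergence//.
  - apply: eq_integral => x _; apply/cvg_lim => //; apply: cvgeZl => //.
  - move=> n; apply: emeasurable_funM; first exact/measurable_EFinP.
    by apply/measurable_EFinP; exact: measurableT_comp.
  - by move=> n x _; rewrite mule_ge0 ?lee_fin.
  - by move=> x _ m n mn; rewrite lee_wpmul2l// ?lee_fin//; exact: ndg.
apply: (congr1 (fun z => limn z)); apply/funext => n.
have mgr r : measurable (g n @^-1` [set r] : set R).
  by rewrite -[X in measurable X]setTI; exact: mg.
under eq_integral do rewrite fimfunE -fsumEFin//.
rewrite ge0_integral_fsum//; last 2 first.
- move=> r; apply/measurable_EFinP; apply: measurable_funM => //.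
  by apply: measurable_indic; exact: mgr.
- by move=> r x _; rewrite nnfun_muleindic_ge0.
under [RHS]eq_integral => s _.
  rewrite fimfunE -fsumEFin// ge0_mule_fsumr; last by move=> r; rewrite nnfun_muleindic_ge0.
  over.
rewrite ge0_integral_fsum//; last 2 first.
- move=> r; apply: emeasurable_funM; first exact/measurable_EFinP.
  apply/measurable_EFinP; apply: measurable_funM => //.
  by apply: mind; exact: mgr.
- by move=> r x _; apply: mule_ge0; [rewrite lee_fin|exact: nnfun_muleindic_ge0].
apply: eq_fsbigr => r /[!inE] -[x _ gr].
have r0 : 0 <= r by rewrite -gr.
under [LHS]eq_integral do rewrite EFinM.
rewrite ge0_integralZl//; last by apply/measurable_EFinP; apply: measurable_indic; exact: mgr.
transitivity (r%:E * weighted_pushforward (g n @^-1` [set r]))%E.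
  congr (_ * _)%E; rewrite integral_indic ?setIT; [|exact: measurableT|exact: mgr].
  by apply: muw; exact: mgr.
rewrite /weighted_pushforward -ge0_integralZl//; last 2 first.
- by apply: mwind; exact: mgr.
- by move=> s _; rewrite mule_ge0 ?lee_fin.
by apply: eq_integral => s _; rewrite EFinM muleCA.
Qed.

End weighted_pushforward.

(** * Changes of variable: translation, reflection, scaling, logarithm *)

Section change_of_variable.
Context {R : realType}.
Local Notation mu := (@lebesgue_measure R).

(* [phi] carries the measure of density [w] to Lebesgue measure, which by uniqueness of
   measures need only be tested on half-open intervals. *)
Definition itv_change (w phi : R -> R) : Prop :=
  [/\ measurable_fun setT w, forall s, 0 <= w s, measurable_fun setT phi
    & forall a b, a < b ->
      (\int[mu]_s ((w s)%:E * (\1_(`]a, b]%classic : set R) (phi s))%:E) =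
       (b - a)%:E)%E].

Lemma ge0_integral_change (w phi : R -> R) (f : R -> \bar R) :
  itv_change w phi -> measurable_fun setT f -> (forall x, 0 <= f x)%E ->
  (\int[mu]_x f x = \int[mu]_s ((w s)%:E * f (phi s)))%E.
Proof.
move=> [mw w0 mphi wphi] mf f0.
apply: ge0_integral_weighted_pushforward => //.
exact: weighted_pushforward_unique.
Qed.

(** Integrability is not at stake: positive and negative parts are transported separately in the
    extended reals, so the two integrals agree even when their value is a default one. *)
Lemma Rintegral_change (w phi f : R -> R) :
  itv_change w phi -> measurable_fun setT f ->
  \int[mu]_x f x = \int[mu]_s (w s * f (phi s)).
Proof.
move=> wp mf; have [mw w0 mphi _] := wp.
rewrite /Rintegral; congr fine.
rewrite integralE [RHS]integralE.
have mEf : measurable_fun setT (EFin \o f) by exact/measurable_EFinP.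
rewrite (ge0_integral_change wp (measurable_funepos mEf))//.
rewrite (ge0_integral_change wp (measurable_funeneg mEf))//.
congr (_ - _)%E; apply: eq_integral => s _.
  by rewrite !funeposE/= -!EFin_max -EFinM maxr_pMr// mulr0.
by rewrite !funenegE/= -!EFin_max -EFinM maxr_pMr// mulr0 mulrN.
Qed.

Lemma integrable_change (w phi f : R -> R) :
  itv_change w phi -> measurable_fun setT f ->
  mu.-integrable setT (fun s => (w s * f (phi s))%:E) ->
  mu.-integrable setT (EFin \o f).
Proof.
move=> wp mf; have [mw w0 mphi _] := wp.
have mEf : measurable_fun setT (EFin \o f) by exact/measurable_EFinP.
move=> /integrableP[_ ioo]; apply/integrableP; split => //.
rewrite (ge0_integral_change wp)//; last exact: measurableT_comp.
apply: le_lt_trans ioo; rewrite le_eqVlt; apply/orP; left; apply/eqP.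
by apply: eq_integral => s _ /=; rewrite normrM ger0_norm.
Qed.

Lemma integrable_changeV (w phi f : R -> R) :
  itv_change w phi -> measurable_fun setT f ->
  mu.-integrable setT (EFin \o f) ->
  mu.-integrable setT (fun s => (w s * f (phi s))%:E).
Proof.
move=> wp mf; have [mw w0 mphi _] := wp.
have mEf : measurable_fun setT (EFin \o f) by exact/measurable_EFinP.
move=> /integrableP[_ ioo]; apply/integrableP; split.
  by apply/measurable_EFinP; apply: measurable_funM => //; exact: measurableT_comp.
rewrite (ge0_integral_change wp) in ioo => //; last exact: measurableT_comp.
apply: le_lt_trans ioo; rewrite le_eqVlt; apply/orP; left; apply/eqP.
by apply: eq_integral => s _ /=; rewrite normrM ger0_norm.
Qed.

(** The flags leave open which ends of the preimage are closed: a reflection turns []a, b]] into an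
    interval closed on the left. *)
Let indic_change (phi : R -> R) (c d a b : R) (b1 b2 : bool) :
  (forall s, (a < phi s <= b) = (s \in Interval (BSide b1 c) (BSide b2 d))) ->
  c <= d ->
  (\int[mu]_s (\1_(`]a, b]%classic : set R) (phi s))%:E = (d - c)%:E)%E.
Proof.
move=> H cd.
transitivity (\int[mu]_s (\1_([set` Interval (BSide b1 c) (BSide b2 d)] : set R) s)%:E)%E.
  apply: eq_integral => s _; rewrite !indicE; congr (_%:R%:E)%R; congr nat_of_bool.
  have E : (phi s \in `]a, b]) = (s \in Interval (BSide b1 c) (BSide b2 d)).
    by rewrite [LHS]in_itv/= H.
  by apply/idP/idP; rewrite !inE/= E.
rewrite integral_indic//= setIT lebesgue_measure_itv/= lte_fin.
have [cd'|dc] := ltP c d; first by rewrite EFinB.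
have -> : c = d by apply/eqP; rewrite eq_le cd dc.
by rewrite subrr.
Qed.

Lemma itv_change_shift (c : R) : itv_change (cst 1) (fun s => s - c).
Proof.
split => //=; first exact: measurable_funB.
move=> a b ab; under eq_integral do rewrite mul1e.
rewrite (@indic_change _ (a + c) (b + c) _ _ false false)//; first by congr EFin; ring.
- by move=> s; rewrite in_itv/=; apply/andP/andP => -[]; lra.
- by rewrite lerD2r ltW.
Qed.

Lemma itv_change_reflect (c : R) : itv_change (cst 1) (fun s => c - s).
Proof.
split => //=; first exact: measurable_funB.
move=> a b ab; under eq_integral do rewrite mul1e.
rewrite (@indic_change _ (c - b) (c - a) _ _ true true)//; first by congr EFin; ring.
- by move=> s; rewrite in_itv/=; apply/andP/andP => -[]; lra.
- by rewrite lerB// ltW.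
Qed.

Lemma itv_change_scale (c : R) : 0 < c -> itv_change (cst c) (fun s => c * s).
Proof.
move=> c0; split => //=; first by move=> _; exact: ltW.
  exact: measurable_funM.
move=> a b ab; rewrite ge0_integralZl//=; last 2 first.
- apply/measurable_EFinP; apply: measurableT_comp => //.
- by rewrite lee_fin ltW.
rewrite (@indic_change _ (a / c) (b / c) _ _ false false)//.
- by rewrite -EFinM; congr EFin; field; rewrite gt_eqF.
- by move=> s; rewrite in_itv/= ltr_pdivrMr// ler_pdivlMr// mulrC.
- by rewrite ler_pM2r ?invr_gt0// ltW.
Qed.

(** On []expR a, expR b]] the claim is the fundamental theorem of calculus for [ln]. The density
    vanishes for [s <= 0], which discards the default values of [ln] there. *)
Lemma itv_change_ln :
  itv_change (fun s => if 0 < s then s^-1 else 0) (@ln R).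
Proof.
have minv : measurable_fun setT (fun s : R => if 0 < s then s^-1 else 0).
  apply: measurable_fun_if => //.
  - exact: measurable_fun_ltr.
  - rewrite setTI.
    rewrite [X in measurable_fun X _](_ : _ = `]0, +oo[%classic); last first.
      by apply/seteqP; split => x /=; rewrite in_itv/= andbT.
    apply: open_continuous_measurable_fun; first exact: interval_open.
    by move=> x; rewrite inE/= in_itv/= andbT => x0; apply: inv_continuous; rewrite gt_eqF.
split => //; first by move=> s; case: ifPn => // s0; rewrite invr_ge0 ltW.
move=> a b ab.
transitivity (\int[mu]_(x in `]expR a, expR b]) (x^-1)%:E)%E.
  rewrite [RHS]integral_mkcond; apply: eq_integral => s _.
  have sE : (s \in `]expR a, expR b]) = (0 < s) && (ln s \in `]a, b]).
    rewrite !in_itv/=; have [s0|s0] /= := ltP 0 s.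
      by rewrite -{1 2}[s]lnK ?posrE// ltr_expR ler_expR.
    by apply/negbTE; rewrite negb_and -leNgt (le_trans s0)// expR_ge0.
  rewrite /patch indicE !mem_setE.
  rewrite sE.
  by case: (0 < s); case: (ln s \in _); rewrite /= ?mule1 ?mule0 ?mul0e.
have eab : expR a < expR b by rewrite ltr_expR.
have pos x : expR a <= x -> 0 < x by apply: lt_le_trans; exact: expR_gt0.
have cinv : {within `[expR a, expR b], continuous (@GRing.inv R)}.
  apply: continuous_in_subspaceT => x; rewrite inE/= in_itv/= => /andP[+ _] => /pos x0.
  by apply: inv_continuous; rewrite gt_eqF.
have cln (x : R) : 0 < x -> @ln R @ x --> ln x by exact: continuous_ln.
rewrite integral_itv_obnd_cbnd; last first.
  apply/measurable_EFinP.
  apply: measurable_funS (subspace_continuous_measurable_fun _ cinv) => //.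
  exact: subset_itv_oc_cc.
rewrite (@continuous_FTC2 _ _ (@ln R))//.
- by rewrite !expRK EFinB.
- split.
  + move=> x; rewrite in_itv/= => /andP[/ltW/pos x0 _].
    by apply: ex_derive; exact: is_derive1_ln.
  + by apply: cvg_at_right_filter; apply: cln; exact: expR_gt0.
  + by apply: cvg_at_left_filter; apply: cln; exact: expR_gt0.
- move=> x; rewrite in_itv/= => /andP[/ltW/pos x0 _].
  by rewrite derive1E; apply: derive_val; exact: is_derive1_ln.
Qed.

End change_of_variable.

(** * The Gamma function: convergence, positivity, growth *)

Section Gamma_function.
Context {R : realType}.
Local Notation mu := (@lebesgue_measure R).
Implicit Types a x y : R.

(** The cut-off is explicit because the total power function does not vanish at negative bases. *)
Definition pos_powR a x : R := if 0 < x then x `^ a else 0.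

Definition Gamma_integrand a x : R := pos_powR (a - 1) x * expR (- x).

Lemma pos_powR_ge0 a x : 0 <= pos_powR a x.
Proof. by rewrite /pos_powR; case: ifP => // _; exact: powR_ge0. Qed.

Lemma measurable_pos_powR a : measurable_fun setT (pos_powR a).
Proof.
apply: measurable_fun_if => //; first exact: measurable_fun_ltr.
by apply: measurable_funTS; exact: measurable_powR.
Qed.

Lemma Gamma_integrand_ge0 a x : 0 <= Gamma_integrand a x.
Proof. by rewrite mulr_ge0 ?pos_powR_ge0 ?expR_ge0. Qed.

Lemma measurable_Gamma_integrand a : measurable_fun setT (Gamma_integrand a).
Proof.
apply: measurable_funM; first exact: measurable_pos_powR.
by apply: measurableT_comp => //; exact: measurable_expR.
Qed.

Lemma GammaE a : Gamma a = \int[mu]_x Gamma_integrand a x.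
Proof.
rewrite /Gamma Rintegral_mkcond; apply: eq_Rintegral => x _.
rewrite /patch mem_setE in_itv/= andbT /Gamma_integrand /pos_powR.
by case: ifP; rewrite ?mul0r.
Qed.

(** Up to the factor [c], the function is dominated by the exponential density plus its mirror
    image. *)
Lemma integrable_expRN_norm (c : R) : 0 < c ->
  mu.-integrable setT (fun y => (expR (- (c * `|y|)))%:E).
Proof.
move=> c0.
pose p := @exponential_pdf R c.
have ip : mu.-integrable setT (EFin \o p) by exact: integrable_exponential_pdf.
have mp : measurable_fun setT p by exact: measurable_exponential_pdf.
have ip' : mu.-integrable setT (EFin \o (p \o (fun y => - y))).
  apply: eq_integrable (integrable_changeV (itv_change_reflect 0) mp ip) => //.
  by move=> x _ /=; rewrite mul1r sub0r.
have := integrableD measurableT ip ip'.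
move/(integrableZl measurableT c^-1); apply: le_integrable => //.
  apply/measurable_EFinP; apply: measurableT_comp; first exact: measurable_expR.
  by apply: measurableT_comp => //; apply: measurableT_comp => //; exact: measurable_normr.
move=> y _ /=; rewrite lee_fin.
have p0 z : 0 <= p z by apply: exponential_pdf_ge0; exact: ltW.
rewrite [leLHS]ger0_norm ?expR_ge0// [leRHS]ger0_norm; last first.
  by rewrite mulr_ge0 ?invr_ge0 ?(ltW c0)// addr_ge0.
rewrite [leRHS]mulrC ler_pdivlMr//.
have [y0|y0] := leP 0 y.
  apply: ler_wpDr => //; rewrite ger0_norm// /p exponential_pdfE//.
  by rewrite mulrC mulNr.
apply: ler_wpDl => //; rewrite ltr0_norm// /p exponential_pdfE ?oppr_ge0 ?(ltW y0)//.
by rewrite mulrC mulNr.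
Qed.

(** In the variable [y = ln x] the integrand becomes [expR (a * y - expR y)], which decays at least
    exponentially at both ends. *)
Lemma integrable_Gamma_integrand a : 0 < a ->
  mu.-integrable setT (EFin \o Gamma_integrand a).
Proof.
move=> a0.
pose g y := expR (a * y - expR y).
have mg : measurable_fun setT g.
  apply: measurableT_comp; first exact: measurable_expR.
  by apply: measurable_funB => //; exact: measurable_expR.
have gE s : (if 0 < s then s^-1 else 0) * g (ln s) = Gamma_integrand a s.
  rewrite /Gamma_integrand /pos_powR; case: ifPn => s0; last by rewrite !mul0r.
  rewrite /g lnK ?posrE// expRD mulrA; congr (_ * _).
  rewrite /powR gt_eqF// mulrBl mul1r expRD expRN lnK ?posrE//.
  by rewrite mulrC.
suff ig : mu.-integrable setT (EFin \o g).
  by apply: eq_integrable (integrable_changeV itv_change_ln mg ig) => //= x _; rewrite gE.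
(* The target is [a * y - expR y <= a^2 - c * |y|]. For [y < 0] it follows from [c <= a]. For
   [y >= 0], use [expR y >= (1 + y / 2)^2], then [c <= 1] and [a * y <= y^2 / 4 + a^2]. *)
pose c := Num.min a 1.
have c0 : 0 < c by rewrite lt_min a0 ltr01.
have := integrable_expRN_norm c0.
move/(integrableZl measurableT (expR (a ^+ 2))); apply: le_integrable => //.
  exact/measurable_EFinP.
move=> y _ /=; rewrite lee_fin.
rewrite [leLHS]ger0_norm ?expR_ge0// [leRHS]ger0_norm ?mulr_ge0 ?expR_ge0//.
rewrite -expRD ler_expR.
have ca : c <= a by rewrite ge_min lexx.
have c1 : c <= 1 by rewrite ge_min lexx orbT.
have [y0|y0] := leP 0 y.
  have H : 1 + y / 2 <= expR (y / 2) := expR_ge1Dx _.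
  have E : expR y = expR (y / 2) ^+ 2.
    by rewrite expr2 -expRD; congr expR; lra.
  have H2 : (1 + y / 2) ^+ 2 <= expR y.
    by rewrite E ler_sqr ?nnegrE ?expR_ge0//; lra.
  have H3 : 0 <= (y / 2 - a) ^+ 2 by exact: sqr_ge0.
  have : c * y <= y by rewrite -[leRHS]mul1r ler_wpM2r.
  by rewrite ger0_norm//; nra.
rewrite ltr0_norm//.
have := expR_ge0 y; have : a * y <= c * y by rewrite ler_wnM2r// ltW.
by have := sqr_ge0 a; lra.
Qed.

Lemma integral_Gamma_integrand a : 0 < a ->
  (\int[mu]_x (Gamma_integrand a x)%:E = (Gamma a)%:E)%E.
Proof.
move=> a0; rewrite GammaE /Rintegral fineK//.
by apply: integrable_fin_num => //; exact: integrable_Gamma_integrand.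
Qed.

(** Keeping only an interval of length 1 turns a pointwise lower bound into one for [Gamma]; this
    serves both positivity and growth. *)
Lemma Gamma_ge a (M c : R) : 0 < a ->
  (forall x, M < x <= M + 1 -> c <= Gamma_integrand a x) -> c <= Gamma a.
Proof.
move=> a0 H; have [c0|c0] := leP c 0.
  by rewrite (le_trans c0)// GammaE Rintegral_ge0// => x _; exact: Gamma_integrand_ge0.
rewrite -lee_fin -integral_Gamma_integrand//.
apply: (@le_trans _ _ (\int[mu]_(x in `]M, (M + 1)%R]) (Gamma_integrand a x)%:E)%E); last first.
  apply: ge0_subset_integral => //.
  - by apply/measurable_EFinP; exact: measurable_Gamma_integrand.
  - by move=> x _; rewrite lee_fin; exact: Gamma_integrand_ge0.
apply: (@le_trans _ _ (\int[mu]_(x in `]M, (M + 1)%R]) c%:E)%E).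
  rewrite integral_cst//= lebesgue_measure_itv/= lte_fin ltrDl ltr01.
  by rewrite -EFinB addrAC subrr add0r mule1.
apply: ge0_le_integral => //.
- by move=> x _; rewrite lee_fin ltW.
- by apply/measurable_EFinP; apply: measurable_funTS; exact: measurable_Gamma_integrand.
Qed.

Lemma Gamma_gt0 a : 0 < a -> 0 < Gamma a.
Proof.
move=> a0.
(* On []1, 2]] one has [(a - 1) * ln x >= - |a - 1| * ln 2], whatever the sign of [a - 1], and
   [- x >= - 2]. *)
apply: (@lt_le_trans _ _ (expR (- (`|a - 1| * ln 2 + 2)))); first exact: expR_gt0.
apply: (@Gamma_ge _ 1) => // x /andP[x1 x2].
have x0 : 0 < x by rewrite (lt_trans _ x1).
rewrite /Gamma_integrand /pos_powR x0 /powR gt_eqF// -expRD ler_expR opprD lerD//; last lra.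
have lx0 : 0 <= ln x by rewrite ln_ge0// ltW.
have lx2 : ln x <= ln 2 by rewrite ler_ln ?posrE//; lra.
rewrite lerNl -mulNr (le_trans (ler_norm _))// normrM normrN ler_wpM2l//.
by rewrite ger0_norm.
Qed.

(* With [M] arbitrary, Gamma outgrows every exponential, hence the Mittag-Leffler series
   converges. *)
Lemma Gamma_ge_powR a (M : R) : 0 < a -> 0 < M ->
  M `^ a * (expR (- (M + 1)) / (M + 1)) <= Gamma a.
Proof.
move=> a0 M0; apply: (@Gamma_ge _ M) => // x /andP[x1 x2].
have x0 : 0 < x by rewrite (lt_trans _ x1).
rewrite /Gamma_integrand /pos_powR x0 mulrCA mulrC ler_pM ?expR_ge0//.
- by rewrite divr_ge0 ?powR_ge0// addr_ge0// ltW.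
- rewrite powRB ?(gt_eqF x0) ?implybT// powRr1 ?(ltW x0)// ler_pM ?powR_ge0//.
  + by rewrite invr_ge0 addr_ge0// ltW.
  + by rewrite ge0_ler_powR ?nnegrE// ltW.
  + by rewrite lef_pV2 ?posrE// addr_gt0.
- by rewrite ler_expR lerN2.
Qed.

Lemma Gamma1 : Gamma 1 = 1 :> R.
Proof.
apply: EFin_inj; rewrite -integral_Gamma_integrand//.
rewrite -(@integral_exponential_pdf R 1)//.
apply: ae_eq_integral => //.
- by apply/measurable_EFinP; exact: measurable_Gamma_integrand.
- by apply/measurable_EFinP; exact: measurable_exponential_pdf.
(* The integrand and the exponential density can differ only at 0, where the former is cut off. *)
- exists [set 0]; split => //; first exact: lebesgue_measure_set1.
  move=> x /= /existsNP[_]; apply: contra_notP => /eqP x0.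
  rewrite /Gamma_integrand /pos_powR; case: ifPn => [{}x0|].
    by rewrite exponential_pdfE ?ltW// subrr powRr0 !mul1r mulN1r.
  rewrite -leNgt le_eqVlt (negbTE x0)/= => {}x0.
  by rewrite mul0r lt0_exponential_pdf.
Qed.

End Gamma_function.

Opaque Gamma.

(** * Beta integral, fractional kernels and their semigroup law *)

Section convolution_kernels.
Context {R : realType}.
Local Notation mu := (@lebesgue_measure R).
Implicit Types (a b x y : R) (K L M : R -> R).

Lemma measurable_conv_integrand2 K L :
  measurable_fun setT K -> measurable_fun setT L ->
  measurable_fun setT (fun z : R * R => K (z.1 - z.2) * L z.2).
Proof.
move=> mK mL; apply: measurable_funM.
  by apply: measurableT_comp => //; exact: measurable_funB.
by apply: measurableT_comp.
Qed.

Lemma measurable_conv_integrand K L x :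
  measurable_fun setT K -> measurable_fun setT L ->
  measurable_fun setT (fun s : R => K (x - s) * L s).
Proof.
move=> mK mL; apply: measurable_funM => //.
by apply: measurableT_comp => //; exact: measurable_funB.
Qed.

Lemma ge0_integralZl_real (k : R) (g : R -> R) : measurable_fun setT g ->
  (forall s, 0 <= g s) -> 0 <= k ->
  (\int[mu]_s (k * g s)%:E = k%:E * \int[mu]_s (g s)%:E)%E.
Proof.
move=> mg g0 k0.
rewrite -(@ge0_integralZl _ _ _ mu _ measurableT (EFin \o g)) ?lee_fin//.
- exact/measurable_EFinP.
- by move=> s _; rewrite lee_fin.
Qed.

(** By homogeneity, after scaling [s] by [x]. The beta integral stays an extended real, its
    finiteness being established only with its value. *)
Lemma pos_powR_beta a b x : 0 < x ->
  (\int[mu]_s (pos_powR (a - 1) (x - s) * pos_powR (b - 1) s)%:E =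
   (x `^ (a + b - 1))%:E *
   \int[mu]_s (pos_powR (a - 1) (1 - s) * pos_powR (b - 1) s)%:E)%E.
Proof.
move=> x0.
have m y := measurable_conv_integrand y (measurable_pos_powR (a - 1)) (measurable_pos_powR (b - 1)).
have m0 y s : 0 <= pos_powR (a - 1) (y - s) * pos_powR (b - 1) s.
  by rewrite mulr_ge0 ?pos_powR_ge0.
rewrite (ge0_integral_change (itv_change_scale x0)); last 2 first.
- by apply/measurable_EFinP; exact: m.
- by move=> s; rewrite lee_fin; exact: m0.
rewrite -(ge0_integralZl_real (m 1) (m0 1) (powR_ge0 _ _)).
apply: eq_integral => s _; rewrite -!EFinM; congr EFin.
have -> : x - x * s = x * (1 - s) by ring.
have pM c y : pos_powR c (x * y) = x `^ c * pos_powR c y.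
  rewrite /pos_powR pmulr_rgt0//; case: ifPn => y0; last by rewrite mulr0.
  by rewrite powRM// ltW.
rewrite !pM.
have -> : x `^ (a + b - 1) = x * x `^ (a - 1) * x `^ (b - 1).
  have P c d : x `^ c * x `^ d = x `^ (c + d) by rewrite powRD// (gt_eqF x0) implybT.
  by rewrite -{2}[x]powRr1 ?(ltW x0)// !P; congr (_ `^ _); ring.
by rewrite /=; ring.
Qed.

(** Since [expR (- (x - s)) * expR (- s) = expR (- x)], the exponential weight leaves the
    integral. *)
Lemma pos_powR_expR_beta a b x :
  (\int[mu]_s (Gamma_integrand a (x - s) * Gamma_integrand b s)%:E =
   (Gamma_integrand (a + b) x)%:E *
   \int[mu]_s (pos_powR (a - 1) (1 - s) * pos_powR (b - 1) s)%:E)%E.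
Proof.
have E s : Gamma_integrand a (x - s) * Gamma_integrand b s =
    expR (- x) * (pos_powR (a - 1) (x - s) * pos_powR (b - 1) s).
  rewrite /Gamma_integrand.
  have -> : - x = - (x - s) + - s by ring.
  by rewrite expRD; ring.
under eq_integral do rewrite E.
have m y := measurable_conv_integrand y (measurable_pos_powR (a - 1)) (measurable_pos_powR (b - 1)).
have m0 y s : 0 <= pos_powR (a - 1) (y - s) * pos_powR (b - 1) s.
  by rewrite mulr_ge0 ?pos_powR_ge0.
rewrite (ge0_integralZl_real (m x) (m0 x) (expR_ge0 _)).
have [x0|x0] := ltP 0 x.
  by rewrite pos_powR_beta// muleA -EFinM mulrC /Gamma_integrand [pos_powR _ x]/pos_powR x0.
rewrite [X in (_ * X)%E]integral0_eq.
  by rewrite mule0 /Gamma_integrand [pos_powR _ x]/pos_powR ltNge x0/= mul0r mul0e.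
move=> s _; rewrite /pos_powR; have [s0|s0] := ltP 0 s; last by rewrite mulr0.
by rewrite subr_gt0 ltNge (le_trans x0 (ltW s0)) mul0r.
Qed.

(** Tonelli applied to [Gamma_integrand a (x - s) * Gamma_integrand b s]: one order of integration
    gives [Gamma (a + b)] times the beta integral, the other gives [Gamma b * Gamma a]. The latter
    being finite, so is the beta integral. *)
Lemma beta_integral a b : 0 < a -> 0 < b ->
  (\int[mu]_s (pos_powR (a - 1) (1 - s) * pos_powR (b - 1) s)%:E =
   (Gamma a * Gamma b / Gamma (a + b))%:E)%E.
Proof.
move=> a0 b0.
set B := LHS.
have ab0 : 0 < a + b by exact: addr_gt0.
have mG c : measurable_fun setT (Gamma_integrand c : R -> R) by exact: measurable_Gamma_integrand.
have B0 : (0 <= B)%E.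
  by apply: integral_ge0 => s _; rewrite lee_fin mulr_ge0 ?pos_powR_ge0.
pose f (z : R * R) := (Gamma_integrand a (z.1 - z.2) * Gamma_integrand b z.2)%:E.
have mf : measurable_fun setT f.
  by apply/measurable_EFinP; exact: measurable_conv_integrand2.
have f0 z : (0 <= f z)%E by rewrite lee_fin mulr_ge0 ?Gamma_integrand_ge0.
have := @fubini_tonelli _ _ _ _ _ mu mu f mf f0.
have -> : (\int[mu]_x \int[mu]_s f (x, s) = (Gamma (a + b))%:E * B)%E.
  under eq_integral => x _ do rewrite /f/= pos_powR_expR_beta -/B.
  rewrite ge0_integralZr//; last 2 first.
  - by apply/measurable_EFinP; exact: mG.
  - by move=> x _; rewrite lee_fin Gamma_integrand_ge0.
  by rewrite integral_Gamma_integrand.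
have -> : (\int[mu]_s \int[mu]_x f (x, s) = (Gamma b * Gamma a)%:E)%E.
  transitivity (\int[mu]_s (Gamma a * Gamma_integrand b s)%:E)%E.
    apply: eq_integral => s _; rewrite /f/=.
    under eq_integral do rewrite mulrC.
    have mGs : measurable_fun setT (fun x => Gamma_integrand a (x - s)).
      by apply: measurableT_comp; [exact: mG|exact: measurable_funB].
    rewrite (ge0_integralZl_real mGs (fun x => Gamma_integrand_ge0 _ _) (Gamma_integrand_ge0 _ _)).
    rewrite [RHS]EFinM [RHS]muleC; congr (_ * _)%E.
    rewrite -(integral_Gamma_integrand a0) [RHS](ge0_integral_change (itv_change_shift s))//.
    - by apply: eq_integral => x _; rewrite mul1e.
    - by apply/measurable_EFinP; exact: mG.
    - by move=> x; rewrite lee_fin Gamma_integrand_ge0.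
  rewrite (ge0_integralZl_real (mG b) (Gamma_integrand_ge0 b) (ltW (Gamma_gt0 a0))).
  by rewrite (integral_Gamma_integrand b0) -EFinM [X in X%:E]mulrC.
move: B0; case: B => [r| |] //= r0.
- rewrite -!EFinM => -[E]; congr EFin.
  apply: (mulfI (lt0r_neq0 (Gamma_gt0 ab0))).
  rewrite E; move: (lt0r_neq0 (Gamma_gt0 ab0)).
  by move: (Gamma a) (Gamma b) (Gamma _) => x y z z0; field.
- by rewrite gt0_muley// lte_fin Gamma_gt0.
Qed.

(* Extended by 0 to [x <= 0], so that Volterra integrals over [0, x] become convolutions
   over the whole line. *)
Definition frac_kernel a x : R := pos_powR (a - 1) x / Gamma a.

Lemma frac_kernelE a x : 0 < x -> frac_kernel a x = x `^ (a - 1) / Gamma a.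
Proof. by move=> x0; rewrite /frac_kernel /pos_powR x0. Qed.

Lemma frac_kernel_ge0 a x : 0 < a -> 0 <= frac_kernel a x.
Proof. by move=> a0; rewrite divr_ge0 ?pos_powR_ge0 ?ltW ?Gamma_gt0. Qed.

Lemma frac_kernel_le0 a x : x <= 0 -> frac_kernel a x = 0.
Proof. by move=> x0; rewrite /frac_kernel /pos_powR ltNge x0 mul0r. Qed.

Lemma measurable_frac_kernel a : measurable_fun setT (frac_kernel a).
Proof. by apply: measurable_funM => //; exact: measurable_pos_powR. Qed.

Lemma frac_kernel1 x : frac_kernel 1 x = (0 < x)%R%:R.
Proof.
by rewrite /frac_kernel subrr /pos_powR Gamma1 divr1 powRr0; case: ifP.
Qed.

(** Dividing by [Gamma] cancels the beta integral, so the kernels form a semigroup under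
    convolution. For [x <= 0] the supports of the two factors do not meet. *)
Lemma integral_frac_kernel_conv a b x : 0 < a -> 0 < b ->
  (\int[mu]_s (frac_kernel a (x - s) * frac_kernel b s)%:E =
   (frac_kernel (a + b) x)%:E)%E.
Proof.
move=> a0 b0; have ab0 := addr_gt0 a0 b0.
have G c : 0 < c -> Gamma c != 0 :> R by move=> c0; exact: lt0r_neq0 (Gamma_gt0 c0).
have E s : frac_kernel a (x - s) * frac_kernel b s =
    (Gamma a * Gamma b)^-1 * (pos_powR (a - 1) (x - s) * pos_powR (b - 1) s).
  rewrite /frac_kernel; move: (G a a0) (G b b0).
  by move: (Gamma a) (Gamma b) (pos_powR _ _) (pos_powR _ _) => u v p q u0 v0; field; rewrite ?u0 ?v0.
under eq_integral do rewrite E.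
have m y := measurable_conv_integrand y (measurable_pos_powR (a - 1)) (measurable_pos_powR (b - 1)).
have m0 y s : 0 <= pos_powR (a - 1) (y - s) * pos_powR (b - 1) s.
  by rewrite mulr_ge0 ?pos_powR_ge0.
rewrite (ge0_integralZl_real (m x) (m0 x)); last first.
  by rewrite invr_ge0 mulr_ge0// ltW// Gamma_gt0.
have [x0|x0] := ltP 0 x.
  rewrite pos_powR_beta// beta_integral// -!EFinM /frac_kernel /pos_powR x0.
  congr EFin; move: (G a a0) (G b b0) (G _ ab0).
  by move: (Gamma a) (Gamma b) (Gamma _) (_ `^ _) => u v w p u0 v0 w0; field; rewrite ?u0 ?v0 ?w0.
rewrite [X in (_ * X)%E]integral0_eq.
  by rewrite mule0 frac_kernel_le0.
move=> s _; rewrite /pos_powR; have [s0|s0] := ltP 0 s; last by rewrite mulr0.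
by rewrite subr_gt0 ltNge (le_trans x0 (ltW s0)) mul0r.
Qed.

Lemma integrable_frac_kernel_conv a b x : 0 < a -> 0 < b ->
  mu.-integrable setT (fun s => (frac_kernel a (x - s) * frac_kernel b s)%:E).
Proof.
move=> a0 b0; apply/integrableP; split.
  by apply/measurable_EFinP; apply: measurable_conv_integrand; exact: measurable_frac_kernel.
apply: (@le_lt_trans _ _ (\int[mu]_s (frac_kernel a (x - s) * frac_kernel b s)%:E)%E).
  rewrite le_eqVlt; apply/orP; left; apply/eqP; apply: eq_integral => s _ /=.
  by rewrite ger0_norm// mulr_ge0 ?frac_kernel_ge0.
by rewrite integral_frac_kernel_conv// ltry.
Qed.

Definition conv K L x : R := \int[mu]_s (K (x - s) * L s).

Lemma conv_frac_kernel a b x : 0 < a -> 0 < b ->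
  conv (frac_kernel a) (frac_kernel b) x = frac_kernel (a + b) x.
Proof. by move=> a0 b0; rewrite /conv /Rintegral integral_frac_kernel_conv. Qed.

Lemma convC K L x : measurable_fun setT K -> measurable_fun setT L ->
  conv K L x = conv L K x.
Proof.
move=> mK mL; rewrite /conv.
rewrite (Rintegral_change (itv_change_reflect x)); last exact: measurable_conv_integrand.
by apply: eq_Rintegral => s _; rewrite mul1r subKr mulrC.
Qed.

Lemma conv_shift K L c x : measurable_fun setT K -> measurable_fun setT L ->
  conv K (fun y => L (y - c)) x = conv K L (x - c).
Proof.
move=> mK mL; rewrite /conv [RHS](Rintegral_change (itv_change_shift c)).
  by apply: eq_Rintegral => s _; rewrite mul1r; congr (K _ * _); ring.
exact: measurable_conv_integrand.
Qed.

(** Tonelli's measurability is applied to the positive and negative parts, so no integrability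
    enters. *)
Lemma measurable_conv K L : measurable_fun setT K -> measurable_fun setT L ->
  measurable_fun setT (conv K L).
Proof.
move=> mK mL.
pose f (z : R * R) := (K (z.1 - z.2) * L z.2)%:E.
have mf : measurable_fun setT f.
  by apply/measurable_EFinP; exact: measurable_conv_integrand2.
suff : measurable_fun setT (fun x : R => \int[mu]_s f (x, s))%E.
  by move=> h; apply: measurableT_comp h => //; exact: measurable_fine.
rewrite [X in measurable_fun _ X](_ : _ =
  (fun x => \int[mu]_s (f^\+ (x, s)) - \int[mu]_s (f^\- (x, s)))%E); last first.
  apply/funext => x; rewrite integralE; congr (_ - _)%E; apply: eq_integral => s _ /=.
    by rewrite !funeposE.
  by rewrite !funenegE.
apply: emeasurable_funB.
  exact: (@measurable_fun_fubini_tonelli_F _ _ _ _ _ mu (f^\+)%E (measurable_funepos mf)).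
exact: (@measurable_fun_fubini_tonelli_F _ _ _ _ _ mu (f^\-)%E (measurable_funeneg mf)).
Qed.

End convolution_kernels.

(** * Weakly singular kernels and associativity of convolution *)

Section convolution_algebra.
Context {R : realType}.
Local Notation mu := (@lebesgue_measure R).
Implicit Types (a b x y X : R) (K L M : R -> R).

Lemma integrable_normM K (c : R) : mu.-integrable setT (EFin \o K) ->
  mu.-integrable setT (fun x => (c * K x)%:E).
Proof. by move=> iK; exact: (integrableZl measurableT c iK). Qed.

(** Fubini for [K (x - s) * L (s - r) * M r]. The inner integrals are required to converge only
    where the outer factor is nonzero; elsewhere the integrand vanishes, although the inner integral
    taken alone may diverge. *)
Lemma conv_assoc K L M x :
  measurable_fun setT K -> measurable_fun setT L -> measurable_fun setT M ->
  (forall r, M r != 0 ->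
    mu.-integrable setT (fun s => (K (x - r - s) * L s)%:E)) ->
  (forall s, K (x - s) != 0 ->
    mu.-integrable setT (fun r => (L (s - r) * M r)%:E)) ->
  (\int[mu]_r (`|M r|%:E * \int[mu]_s (`|K (x - r - s) * L s|)%:E) < +oo)%E ->
  conv (conv K L) M x = conv K (conv L M) x.
Proof.
move=> mK mL mM h1 h2 h3.
pose f (z : R * R) := (K (x - z.2) * L (z.2 - z.1) * M z.1)%:E.
have mf : measurable_fun setT f.
  apply/measurable_EFinP; apply: measurable_funM; last exact: measurableT_comp.
  apply: measurable_funM.
    by apply: measurableT_comp => //; exact: measurable_funB.
  by apply: measurableT_comp => //; exact: measurable_funB.
have mKL y : measurable_fun setT (fun s : R => K (y - s) * L s).
  exact: measurable_conv_integrand.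
have E1 r : (\int[mu]_s f (r, s) = (conv K L (x - r) * M r)%:E)%E.
  have [M0|M0] := eqVneq (M r) 0.
    by rewrite M0 mulr0 integral0_eq// => s _; rewrite /f/= M0 mulr0.
  have h := integrable_changeV (itv_change_shift r) (mKL (x - r)) (h1 _ M0).
  rewrite /conv (Rintegral_change (itv_change_shift r) (mKL (x - r))).
  rewrite -RintegralZr// /Rintegral fineK.
    apply: eq_integral => s _; rewrite /f/= mul1r; congr (K _ * _ * _)%:E; ring.
  apply: integrable_fin_num => //.
  apply: eq_integrable (integrable_normM (M r) h) => // s _ /=.
  by rewrite mulrC.
have E2 s : (\int[mu]_r f (r, s) = (K (x - s) * conv L M s)%:E)%E.
  have [K0|K0] := eqVneq (K (x - s)) 0.
    by rewrite K0 mul0r integral0_eq// => r _; rewrite /f/= K0 !mul0r.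
  have h := h2 _ K0.
  rewrite /conv -RintegralZl// /Rintegral fineK.
    by apply: eq_integral => r _; rewrite /f/= mulrA.
  apply: integrable_fin_num => //.
  exact: (integrable_normM (K (x - s)) h).
have intf : (mu \x mu)%E.-integrable setT f.
  apply/integrable12ltyP => //; apply: le_lt_trans h3.
  rewrite le_eqVlt; apply/orP; left; apply/eqP; apply: eq_integral => r _.
  have mn y : measurable_fun setT (fun s : R => `|K (y - s) * L s|).
    by apply: measurableT_comp => //; exact: mKL.
  rewrite -(ge0_integralZl_real (mn _))//.
  rewrite [RHS](ge0_integral_change (itv_change_shift r)).
  - apply: eq_integral => s _; rewrite mul1e /f/= !normrM.
    have -> : x - r - (s - r) = x - s by ring.
    by congr EFin; ring.
  - by apply/measurable_EFinP; apply: measurable_funM => //; exact: mn.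
  - by move=> s; rewrite lee_fin mulr_ge0.
have := integral21_prod_meas1 intf.
rewrite -(integral12_prod_meas1 intf) /fubini_F /fubini_G.
under eq_integral do rewrite E2.
under [in X in _ = X -> _]eq_integral do rewrite E1.
by rewrite /conv /Rintegral => ->.
Qed.

(* The bound forces [K] to vanish on [x <= 0], where [frac_kernel] does. *)
Definition weakly_singular a X K := measurable_fun setT K /\
  exists2 C, 0 <= C & forall x, x <= X -> `|K x| <= C * frac_kernel a x.

Lemma weakly_singular_le0 a X K x : 0 <= X -> weakly_singular a X K -> x <= 0 ->
  K x = 0.
Proof.
move=> X0 [_ [C _ H]] x0; apply/eqP; rewrite -normr_le0.
by rewrite (le_trans (H _ (le_trans x0 X0)))// frac_kernel_le0// mulr0.
Qed.

(** The two bounds are known only up to [X], but for [x <= X] the product vanishes unless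
    [0 < s < x], where both apply. *)
Lemma weakly_singular_conv_bound a b X K L : 0 < a -> 0 < b -> 0 <= X ->
  weakly_singular a X K -> weakly_singular b X L ->
  exists2 C, 0 <= C & forall x s, x <= X ->
    `|K (x - s) * L s| <= C * (frac_kernel a (x - s) * frac_kernel b s).
Proof.
move=> a0 b0 X0 wK wL.
have [mK [C C0 HC]] := wK; have [mL [D D0 HD]] := wL.
exists (C * D); first exact: mulr_ge0.
move=> x s xX; have [s0|s0] := leP s 0.
  by rewrite (weakly_singular_le0 X0 wL s0) (@frac_kernel_le0 _ b)// !mulr0 normr0.
have [sx|sx] := leP x s.
  have h : x - s <= 0 by rewrite subr_le0.
  by rewrite (weakly_singular_le0 X0 wK h) [frac_kernel a _]frac_kernel_le0// !(mul0r,mulr0) normr0.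
rewrite normrM mulrACA ler_pM// ?HC ?HD//.
  by rewrite lerBlDr (le_trans xX)// lerDl ltW.
by rewrite (le_trans (ltW sx)).
Qed.

Lemma weakly_singular_conv_integrable a b X K L x : 0 < a -> 0 < b -> 0 <= X ->
  weakly_singular a X K -> weakly_singular b X L -> x <= X ->
  mu.-integrable setT (fun s => (K (x - s) * L s)%:E).
Proof.
move=> a0 b0 X0 wK wL xX.
have [C C0 HC] := weakly_singular_conv_bound a0 b0 X0 wK wL.
have := integrable_normM C (integrable_frac_kernel_conv x a0 b0).
apply: le_integrable => //.
  apply/measurable_EFinP; apply: measurable_conv_integrand; by [case: wK|case: wL].
move=> s _ /=; rewrite lee_fin (le_trans (HC _ _ xX))//; exact: ler_norm.
Qed.

Lemma le_frac_kernel a b X : 0 < a -> a <= b ->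
  exists2 C, 0 <= C & forall x, x <= X -> frac_kernel b x <= C * frac_kernel a x.
Proof.
move=> a0 ab; have b0 : 0 < b by exact: lt_le_trans ab.
(* For [x > 0] the ratio of the two kernels is [x^(b - a) * Gamma a / Gamma b], nondecreasing in
   [x]. *)
exists (X `^ (b - a) * (Gamma a / Gamma b)).
  by rewrite mulr_ge0 ?powR_ge0// divr_ge0// ltW// Gamma_gt0.
move=> x xX; rewrite /frac_kernel /pos_powR; case: ifPn => x0; last by rewrite !mul0r mulr0.
have -> : x `^ (b - 1) = x `^ (b - a) * x `^ (a - 1).
  by rewrite -powRD ?(gt_eqF x0) ?implybT//; congr (_ `^ _); ring.
have -> : X `^ (b - a) * (Gamma a / Gamma b) * (x `^ (a - 1) / Gamma a) =
   X `^ (b - a) * (x `^ (a - 1) / Gamma b).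
  move: (lt0r_neq0 (Gamma_gt0 a0)) (lt0r_neq0 (Gamma_gt0 b0)).
  move: (Gamma a) (Gamma b) (X `^ _) (x `^ _) => u v p q u0 v0; field.
  by rewrite ?u0 ?v0.
rewrite -mulrA ler_wpM2r//.
  by rewrite divr_ge0 ?powR_ge0// ltW// Gamma_gt0.
by rewrite ge0_ler_powR ?nnegrE ?subr_ge0 ?(ltW x0)// (le_trans (ltW x0)).
Qed.

(** Convolution improves the exponent to [a + b]. Retaining any positive [c <= a + b] keeps the
    exponent fixed along iterated convolutions. *)
Lemma weakly_singular_conv a b c X K L : 0 < a -> 0 < b -> 0 <= X ->
  0 < c -> c <= a + b ->
  weakly_singular a X K -> weakly_singular b X L -> weakly_singular c X (conv K L).
Proof.
move=> a0 b0 X0 c0 cab wK wL.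
split; first by apply: measurable_conv; [case: wK|case: wL].
have [C C0 HC] := weakly_singular_conv_bound a0 b0 X0 wK wL.
have [D D0 HD] := le_frac_kernel X c0 cab.
exists (C * D); first exact: mulr_ge0.
move=> x xX; rewrite -mulrA; apply: (@le_trans _ _ (C * frac_kernel (a + b) x)); last first.
  by rewrite ler_wpM2l// HD.
rewrite -conv_frac_kernel// /conv -RintegralZl//; last exact: integrable_frac_kernel_conv.
have iKL := weakly_singular_conv_integrable a0 b0 X0 wK wL xX.
rewrite (le_trans (le_normr_Rintegral _ _))//.
apply: le_Rintegral => //.
- exact: (integrable_norm iKL).
- exact: (integrable_normM C (integrable_frac_kernel_conv x a0 b0)).
- by move=> s _; exact: HC.
Qed.

(** The semigroup law bounds the inner integral by [C * frac_kernel (a + a) (x - r)], and the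
    product of this with [frac_kernel a r] is integrable by the same law. *)
Lemma weakly_singular_conv_assoc a X K L M x : 0 < a -> 0 <= X ->
  weakly_singular a X K -> weakly_singular a X L -> weakly_singular a X M ->
  x <= X -> conv (conv K L) M x = conv K (conv L M) x.
Proof.
move=> a0 X0 wK wL wM xX.
have [[mK _] [mL _] [mM [D D0 HD]]] := And3 wK wL wM.
have [C C0 HC] := weakly_singular_conv_bound a0 a0 X0 wK wL.
apply: conv_assoc => //.
- move=> r Mr; apply: weakly_singular_conv_integrable wK wL _ => //.
  have [r0|r0] := leP r 0.
    by move: Mr; rewrite (weakly_singular_le0 X0 wM r0) eqxx.
  by rewrite (le_trans _ xX)// gerBl ltW.
- move=> s Ks; apply: weakly_singular_conv_integrable wL wM _ => //.
  have [s0|s0] := leP (x - s) 0.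
    by move: Ks; rewrite (weakly_singular_le0 X0 wK s0) eqxx.
  by rewrite (le_trans _ xX)// ltW// -subr_gt0.
have aa0 : 0 < a + a by exact: addr_gt0.
have ik := integrable_frac_kernel_conv x aa0 a0.
have := integrable_normM (C * D) ik.
move=> /integrableP[_]; apply: le_lt_trans.
apply: ge0_le_integral => //.
- by move=> r _; rewrite mule_ge0// integral_ge0.
- apply: emeasurable_funM.
    by apply/measurable_EFinP; exact: measurableT_comp.
  pose f (z : R * R) := (`|K (x - z.1 - z.2) * L z.2|)%:E.
  have mf : measurable_fun setT f.
    apply/measurable_EFinP; apply: measurableT_comp => //; apply: measurable_funM.
      apply: measurableT_comp => //; apply: measurable_funB => //; exact: measurable_funB.
    exact: measurableT_comp.
  apply: (@measurable_fun_fubini_tonelli_F _ _ _ _ _ mu f mf) => z.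
  by rewrite lee_fin.
- apply/measurable_EFinP; apply: measurableT_comp => //; apply: measurable_funM => //.
  apply: measurable_conv_integrand; exact: measurable_frac_kernel.
move=> r _ /=.
have k0 b y : 0 < b -> 0 <= frac_kernel b y :> R by exact: frac_kernel_ge0.
have kk0 : 0 <= C * D * (frac_kernel (a + a) (x - r) * frac_kernel a r).
  by apply: mulr_ge0; [exact: mulr_ge0|apply: mulr_ge0; exact: k0].
rewrite [X in (_ <= X%:E)%E]ger0_norm//.
have [r0|r0] := leP r 0.
  by rewrite (weakly_singular_le0 X0 wM r0) normr0 mul0e lee_fin.
have xrX : x - r <= X by rewrite (le_trans _ xX)// gerBl ltW.
have H : (\int[mu]_s `|K (x - r - s) * L s|%:E <= (C * frac_kernel (a + a) (x - r))%:E)%E.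
  rewrite EFinM -integral_frac_kernel_conv// -ge0_integralZl_real//.
  - apply: ge0_le_integral => //.
    + apply/measurable_EFinP; apply: measurableT_comp => //; exact: measurable_conv_integrand.
    + apply/measurable_EFinP; apply: measurable_funM => //.
      apply: measurable_conv_integrand; exact: measurable_frac_kernel.
    + by move=> s _; rewrite lee_fin; exact: HC.
  - apply: measurable_conv_integrand; exact: measurable_frac_kernel.
  - by move=> s; rewrite mulr_ge0 ?k0.
have [rx|rx] := leP x r.
  move: H; rewrite frac_kernel_le0 ?subr_le0// mulr0 => H.
  have -> : (\int[mu]_s `|K (x - r - s) * L s|%:E = 0)%E.
    by apply/eqP; rewrite eq_le H integral_ge0.
  by rewrite mule0 lee_fin mul0r mulr0.
apply: (le_trans (lee_wpmul2l _ H)); first by rewrite lee_fin.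
rewrite -EFinM lee_fin.
rewrite mulrACA [leRHS]mulrC.
rewrite ler_wpM2r ?(mulr_ge0 C0 (k0 _ _ _))// HD// (le_trans (ltW rx))//.
Qed.

Lemma Mittag_Leffler_term_bound a c X : 0 < a -> 0 <= c ->
  exists2 D, 0 <= D & forall (m : nat) x, x <= X ->
    c ^+ m * frac_kernel (m%:R * a + a) x <= D * frac_kernel a x * 2^-1 ^+ m.
Proof.
move=> a0 c0.
(* [M] is chosen with [M^a = q], so that [Gamma_ge_powR] gives [Gamma (m * a + a) >= q^(m + 1) / G],
   while [c * x^a <= q / 2]: successive bounds have ratio 1/2. The summand 1 keeps [q] positive when
   [c] or [X] vanishes. *)
pose q : R := 2 * c * X `^ a + 1; pose M := q `^ a^-1.
have q0 : 0 < q by rewrite ltr_wpDl// !mulr_ge0// powR_ge0.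
have M0 : 0 < M by exact: powR_gt0.
have Ma : M `^ a = q by rewrite /M -powRrM mulVf ?gt_eqF// powRr1// ltW.
pose G := (M + 1) / expR (- (M + 1)).
have G0 : 0 < G by rewrite divr_gt0 ?expR_gt0// addr_gt0.
exists (Gamma a * G / q).
  by rewrite divr_ge0 ?(ltW q0)// mulr_ge0 ?(ltW G0)// ltW// Gamma_gt0.
move=> m x xX; rewrite /frac_kernel /pos_powR; case: ifPn => x0; last by rewrite !(mul0r, mulr0).
have b0 : 0 < m%:R * a + a by rewrite ltr_wpDl// mulr_ge0// ltW.
have H1 : (Gamma (m%:R * a + a))^-1 <= G / (q ^+ m * q).
  have -> : G / (q ^+ m * q) = (M `^ (m%:R * a + a) * (expR (- (M + 1)) / (M + 1)))^-1.
    rewrite [m%:R * a]mulrC powRD ?(gt_eqF M0) ?implybT// powRrM powR_mulrn ?powR_ge0// Ma.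
    by rewrite [RHS]invfM invf_div [RHS]mulrC.
  rewrite lef_pV2 ?posrE ?Gamma_gt0 ?Gamma_ge_powR//.
  by rewrite mulr_gt0 ?powR_gt0// divr_gt0 ?expR_gt0// addr_gt0.
have H2 : x `^ (m%:R * a + a - 1) = (x `^ a) ^+ m * x `^ (a - 1).
  rewrite -addrA [LHS]powRD ?(gt_eqF x0) ?implybT//.
  by rewrite [m%:R * a]mulrC powRrM powR_mulrn// powR_ge0.
have H3 : c * x `^ a <= q / 2.
  have : x `^ a <= X `^ a by rewrite ge0_ler_powR ?nnegrE ?(ltW x0) ?(ltW a0)// (le_trans (ltW x0)).
  by move=> /(ler_wpM2l c0); rewrite /q; lra.
have H4 : (c * x `^ a) ^+ m <= (q / 2) ^+ m.
  by rewrite lerXn2r// nnegrE ?divr_ge0 ?mulr_ge0 ?powR_ge0// ltW.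
rewrite H2.
have -> : Gamma a * G / q * (x `^ (a - 1) / Gamma a) * 2^-1 ^+ m =
    (q / 2) ^+ m * (x `^ (a - 1) * (G / (q ^+ m * q))).
  move: (lt0r_neq0 (Gamma_gt0 a0)) (lt0r_neq0 q0).
  rewrite exprMn.
  have qm : q ^+ m != 0 by rewrite expf_neq0// lt0r_neq0.
  move: (Gamma a) (x `^ _) (2^-1 ^+ m) qm; rewrite -/q -/G.
  move: (q ^+ m) => v u w z v0 u0 q0'.
  by field; rewrite ?u0 ?v0 ?q0'.
have -> : c ^+ m * ((x `^ a) ^+ m * x `^ (a - 1) / Gamma (m%:R * a + a)) =
   (c * x `^ a) ^+ m * (x `^ (a - 1) * (Gamma (m%:R * a + a))^-1).
  by rewrite exprMn; ring.
apply: ler_pM => //.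
- by rewrite exprn_ge0// mulr_ge0// powR_ge0.
- by rewrite mulr_ge0 ?powR_ge0// invr_ge0 ltW// Gamma_gt0.
- by rewrite ler_wpM2l ?powR_ge0.
Qed.

End convolution_algebra.

Opaque frac_kernel.

(** * Associativity for integrable functions; linearity and continuity of convolution *)

Section fractional_convolution.
Context {R : realType}.
Local Notation mu := (@lebesgue_measure R).
Implicit Types (a b x X : R) (K L M u : R -> R).

(* Only integrability is assumed of [u]: a solution is not known a priori to satisfy a
   bound by a fractional kernel near 0. *)
Lemma conv_assoc_frac_kernel a b u x : 0 < a -> 0 < b -> a + b = 1 ->
  mu.-integrable setT (EFin \o u) ->
  (forall s, s < x ->
    mu.-integrable setT (fun r => (frac_kernel b (s - r) * u r)%:E)) ->
  conv (frac_kernel a) (conv (frac_kernel b) u) x = conv (frac_kernel 1) u x.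
Proof.
move=> a0 b0 ab iu h.
have mk c : measurable_fun setT (frac_kernel c : R -> R) by exact: measurable_frac_kernel.
have mu_ : measurable_fun setT u by apply/measurable_EFinP; exact: measurable_int iu.
rewrite -conv_assoc//.
- apply: eq_Rintegral => s _; congr (_ * _).
  by rewrite (conv_frac_kernel _ a0 b0) ab.
- by move=> r _; exact: integrable_frac_kernel_conv.
- move=> s; have [xs|xs] := leP x s; last by move=> _; exact: h.
  by rewrite frac_kernel_le0 ?subr_le0// eqxx.
have /integrableP[_] := iu; apply: le_lt_trans; apply: ge0_le_integral => //.
- by move=> r _; rewrite mule_ge0// integral_ge0.
- apply: emeasurable_funM.
    by apply/measurable_EFinP; exact: measurableT_comp.
  pose f (z : R * R) := (`|frac_kernel a (x - z.1 - z.2) * frac_kernel b z.2|)%:E.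
  have mf : measurable_fun setT f.
    apply/measurable_EFinP; apply: measurableT_comp => //; apply: measurable_funM.
      apply: measurableT_comp => //; apply: measurable_funB => //; exact: measurable_funB.
    exact: measurableT_comp.
  apply: (@measurable_fun_fubini_tonelli_F _ _ _ _ _ mu f mf) => z.
  by rewrite lee_fin.
- by apply/measurable_EFinP; exact: measurableT_comp.
move=> r _ /=.
have -> : (\int[mu]_s `|frac_kernel a (x - r - s) * frac_kernel b s|%:E = (frac_kernel 1 (x - r))%:E)%E.
  rewrite -ab -integral_frac_kernel_conv//; apply: eq_integral => s _.
  by rewrite ger0_norm// mulr_ge0// frac_kernel_ge0.
rewrite -EFinM lee_fin frac_kernel1; case: (0 < x - r); rewrite ?mulr1//.
by rewrite mulr0.
Qed.

Lemma convDr K L M x :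
  mu.-integrable setT (fun s => (K (x - s) * L s)%:E) ->
  mu.-integrable setT (fun s => (K (x - s) * M s)%:E) ->
  conv K (fun s => L s + M s) x = conv K L x + conv K M x.
Proof.
move=> i1 i2; rewrite /conv -RintegralD//.
by apply: eq_Rintegral => s _; rewrite mulrDr.
Qed.

Lemma convZr K L (c : R) x :
  mu.-integrable setT (fun s => (K (x - s) * L s)%:E) ->
  conv K (fun s => c * L s) x = c * conv K L x.
Proof.
move=> i1; rewrite /conv -RintegralZl//.
by apply: eq_Rintegral => s _; rewrite mulrCA.
Qed.

Lemma conv_sumr (I : Type) (r : seq I) K (L : I -> R -> R) x :
  (forall i, mu.-integrable setT (fun s => (K (x - s) * L i s)%:E)) ->
  conv K (fun s => \sum_(i <- r) L i s) x = \sum_(i <- r) conv K (L i) x.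
Proof.
move=> iL; elim: r => [|i r IH].
  rewrite big_nil /conv /Rintegral integral0_eq// => s _.
  by rewrite big_nil mulr0.
under [in LHS]eq_fun do rewrite big_cons.
rewrite big_cons convDr ?IH//.
apply: eq_integrable (integrable_sum measurableT r (P := xpredT) (fun i _ => iL i)) => //.
by move=> s _ /=; rewrite sumEFin mulr_sumr.
Qed.

Lemma weakly_singularS a X Y K : Y <= X -> weakly_singular a X K ->
  weakly_singular a Y K.
Proof.
move=> YX [mK [C C0 HC]]; split => //; exists C => // x xY.
by apply: HC; exact: le_trans YX.
Qed.

Lemma weakly_singularD a X K L : 0 < a -> weakly_singular a X K -> weakly_singular a X L ->
  weakly_singular a X (fun x => K x + L x).
Proof.
move=> a0 [mK [C C0 HC]] [mL [D D0 HD]]; split; first exact: measurable_funD.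
exists (C + D); first exact: addr_ge0.
move=> x xX; rewrite mulrDl (le_trans (ler_normD _ _))// lerD// ?HC ?HD//.
Qed.

Lemma weakly_singularZ a X K (c : R) : weakly_singular a X K ->
  weakly_singular a X (fun x => c * K x).
Proof.
move=> [mK [C C0 HC]]; split; first exact: measurable_funM.
exists (`|c| * C); first exact: mulr_ge0.
by move=> x xX; rewrite normrM -mulrA ler_wpM2l// HC.
Qed.

Lemma weakly_singular0 a X : weakly_singular a X (cst 0).
Proof.
split; first exact: measurable_cst.
by exists 0 => // x xX; rewrite /= normr0 mul0r.
Qed.

Lemma weakly_singular_sum a X (I : Type) (r : seq I) (K : I -> R -> R) : 0 < a ->
  (forall i, weakly_singular a X (K i)) ->
  weakly_singular a X (fun x => \sum_(i <- r) K i x).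
Proof.
move=> a0 wK; elim: r => [|i r IH].
  rewrite (_ : (fun _ => _) = cst 0); first exact: weakly_singular0.
  by apply/funext => x; rewrite big_nil.
rewrite (_ : (fun _ => _) = (fun x => K i x + \sum_(j <- r) K j x)).
  exact: weakly_singularD.
by apply/funext => x; rewrite big_cons.
Qed.

Lemma weakly_singular_frac_kernel a b X : 0 < a -> a <= b ->
  weakly_singular a X (frac_kernel b).
Proof.
move=> a0 ab; split; first exact: measurable_frac_kernel.
have [C C0 HC] := le_frac_kernel X a0 ab; exists C => // x xX.
by rewrite ger0_norm ?frac_kernel_ge0 ?HC// (lt_le_trans a0).
Qed.

Lemma weakly_singular_bounded a X (B : R) K : 0 < a -> a <= 1 ->
  measurable_fun setT K -> (forall x, x <= 0 -> K x = 0) ->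
  (forall x, x <= X -> `|K x| <= B) -> weakly_singular a X K.
Proof.
move=> a0 a1 mK K0 KB; split => //.
have [C C0 HC] := le_frac_kernel X a0 a1.
exists (`|B| * C); first exact: mulr_ge0.
move=> x xX; have [x0|x0] := leP x 0.
  by rewrite K0// normr0; apply: mulr_ge0; [exact: mulr_ge0|exact: frac_kernel_ge0].
rewrite (le_trans (KB _ xX))// (le_trans (ler_norm _))// -[leLHS]mulr1 -mulrA ler_wpM2l//.
by rewrite (le_trans _ (HC _ xX))// frac_kernel1 x0.
Qed.

(** Truncation at [x] is multiplication by [frac_kernel 1 (x - s)], so this is a case of the
    integrability of convolution integrands. *)
Lemma weakly_singular_integrable a X K x : 0 < a -> 0 <= X -> weakly_singular a X K ->
  x <= X -> mu.-integrable setT (fun s => (if s < x then K s else 0)%:E).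
Proof.
move=> a0 X0 wK xX.
have w1 : weakly_singular 1 X (frac_kernel 1) by apply: weakly_singular_frac_kernel.
have := weakly_singular_conv_integrable ltr01 a0 X0 w1 wK xX.
apply: eq_integrable => // s _.
rewrite frac_kernel1 subr_gt0; case: ifP => _; rewrite ?mul1r//.
by rewrite mul0r.
Qed.

(** Dominated convergence along sequences. Commutativity puts the moving argument on the bounded [g]
    and keeps the singular [K] fixed; a jump of [g] at 0 affects only the point [s = x0]. *)
Lemma conv_continuous a X (B : R) K (g : R -> R) x0 : 0 < a -> 0 <= X ->
  weakly_singular a X K -> measurable_fun setT g ->
  (forall x, x <= 0 -> g x = 0) -> (forall x, x <= X -> `|g x| <= B) ->
  (forall x, 0 < x < X -> {for x, continuous g}) -> x0 < X ->
  {for x0, continuous (conv K g)}.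
Proof.
move=> a0 X0 wK mg g0 gB cg x0X.
have mK : measurable_fun setT K by case: wK.
have [_ [C C0 HC]] := wK.
have B0 : 0 <= B by rewrite (le_trans _ (gB 0 X0)).
have -> : conv K g = conv g K by apply/funext => x; exact: convC.
apply/(@cvg_nbhsP _ R^o) => w wx0.
have : \forall n \near \oo, w n < X by exact: (cvgr_lt x0).
move=> [N _ HN].
rewrite -(cvg_shiftn N).
pose f n s := (g (w (n + N)%N - s) * K s)%:E.
have mf n : measurable_fun setT (f n).
  by apply/measurable_EFinP; exact: measurable_conv_integrand.
(* The factor [frac_kernel 1 (X - s)] restricts the bound to [s < X], where that on [K] is valid;
   for [s >= X] the factor [g] vanishes. *)
pose G s := (B * (C * (frac_kernel 1 (X - s) * frac_kernel a s)))%:E.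
have iG : mu.-integrable setT G.
  apply: integrable_normM; apply: integrable_normM.
  exact: integrable_frac_kernel_conv.
have fG n s : (`|f n s| <= G s)%E.
  rewrite /f /G lee_fin normrM.
  have wX : w (n + N)%N < X by apply: HN; rewrite /= leq_addl.
  have [s0|s0] := leP s 0.
    rewrite (weakly_singular_le0 X0 wK s0) normr0 mulr0.
    by do 3 (apply: mulr_ge0 => //); exact: frac_kernel_ge0.
  have [sX|sX] := leP X s.
    rewrite g0 ?normr0 ?mul0r; last by rewrite subr_le0 (le_trans (ltW wX)).
    by do 3 (apply: mulr_ge0 => //); exact: frac_kernel_ge0.
  rewrite frac_kernel1 subr_gt0 sX mul1r ler_pM//.
    by apply: gB; rewrite lerBlDr (le_trans (ltW wX))// lerDl ltW.
  by apply: HC; exact: ltW.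
have := @dominated_convergence _ _ _ mu _ measurableT f (fun s => (g (x0 - s) * K s)%:E) G mf.
case.
- by apply/measurable_EFinP; exact: measurable_conv_integrand.
- exists [set x0]; split => //; first exact: lebesgue_measure_set1.
  move=> s /= /not_implyP[_]; apply: contra_notP => /eqP sx0.
  rewrite /f; apply: cvg_EFin; first exact: nearW.
  rewrite -[X in X --> _]/((fun n => g (w (n + N)%N - s) * K s) @ \oo).
  have wN : (fun n => w (n + N)%N - s) @ \oo --> x0 - s.
    by apply: cvgB; [rewrite cvg_shiftn|exact: cvg_cst].
  have [s0|s0] := leP s 0.
    rewrite (weakly_singular_le0 X0 wK s0) mulr0; under eq_fun do rewrite mulr0.
    exact: cvg_cst.
  apply: cvgM; last exact: cvg_cst.
  have [sx|sx] := ltP s x0.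
    apply: (cvg_comp _ _ wN); apply: cg; rewrite subr_gt0 sx/=.
    by rewrite ltrBlDr (lt_trans x0X)// ltrDl.
  have xs : x0 < s by rewrite lt_neqAle eq_sym sx0.
  rewrite g0; last by rewrite subr_le0 ltW.
  apply: cvg_near_cst.
  have : \forall n \near \oo, w (n + N)%N - s < 0.
    by apply: (cvgr_lt (x0 - s)) => //; rewrite subr_lt0.
  by apply: filterS => n /ltW/g0.
- exact: iG.
- by apply: aeW => s n _; exact: fG.
move=> i1 _ h; apply: fine_cvg.
rewrite fineK; first exact: h.
exact: integrable_fin_num.
Qed.

End fractional_convolution.

(** * Convolution of matrix-valued kernels *)

Section matrix_convolution.
Context {R : realType}.
Local Notation mu := (@lebesgue_measure R).

Definition mconv (p q r : nat) (K : R -> 'M[R]_(p, q)) (L : R -> 'M[R]_(q, r))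
    (x : R) : 'M[R]_(p, r) :=
  \matrix_(i, j) \sum_k conv (fun y => K y i k) (fun y => L y k j) x.

Definition mweakly_singular (a X : R) (p q : nat) (K : R -> 'M[R]_(p, q)) :=
  forall i j, weakly_singular a X (fun x => K x i j).

Lemma mconv_shift (p q r : nat) (K : R -> 'M[R]_(p, q)) (L : R -> 'M[R]_(q, r)) c x :
  (forall i k, measurable_fun setT (fun y => K y i k)) ->
  (forall k j, measurable_fun setT (fun y => L y k j)) ->
  mconv K (fun y => L (y - c)) x = mconv K L (x - c).
Proof.
move=> mK mL; apply/matrixP => i j; rewrite !mxE; apply: eq_bigr => k _.
by rewrite (conv_shift c x (mK i k) (mL k j)).
Qed.

Variables (a X : R).
Hypotheses (a0 : 0 < a) (X0 : 0 <= X).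

Lemma weakly_singular_eq (K L : R -> R) : K =1 L ->
  weakly_singular a X K -> weakly_singular a X L.
Proof. by move=> /funext ->. Qed.

Lemma eq_conv (K L M : R -> R) x : weakly_singular a X K -> x <= X ->
  (forall y, y <= X -> L y = M y) -> conv K L x = conv K M x.
Proof.
move=> wK xX LM; apply: eq_Rintegral => s _.
have [sX|sX] := leP s X; first by rewrite LM.
rewrite (weakly_singular_le0 X0 wK) ?mul0r//.
by rewrite subr_le0 (le_trans xX)// ltW.
Qed.

Lemma mws_le0 (p q : nat) (K : R -> 'M[R]_(p, q)) x : mweakly_singular a X K ->
  x <= 0 -> K x = 0.
Proof.
by move=> wK x0; apply/matrixP => i j; rewrite mxE (weakly_singular_le0 X0 (wK i j) x0).
Qed.

Lemma ws_int (K L : R -> R) x : weakly_singular a X K -> weakly_singular a X L ->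
  x <= X -> mu.-integrable setT (fun s => (K (x - s) * L s)%:E).
Proof. exact: weakly_singular_conv_integrable. Qed.

Lemma ws_conv (K L : R -> R) : weakly_singular a X K -> weakly_singular a X L ->
  weakly_singular a X (conv K L).
Proof. by apply: weakly_singular_conv => //; rewrite lerDl ltW. Qed.

Lemma mws_mconv (p q r : nat) (K : R -> 'M[R]_(p, q)) (L : R -> 'M[R]_(q, r)) :
  mweakly_singular a X K -> mweakly_singular a X L ->
  mweakly_singular a X (mconv K L).
Proof.
move=> wK wL i j.
apply: (@weakly_singular_eq (fun x => \sum_k conv (fun y => K y i k) (fun y => L y k j) x)).
  by move=> x; rewrite mxE.
by apply: weakly_singular_sum => // k; exact: ws_conv.
Qed.

Lemma mwsD (p q : nat) (K L : R -> 'M[R]_(p, q)) :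
  mweakly_singular a X K -> mweakly_singular a X L ->
  mweakly_singular a X (fun x => K x + L x).
Proof.
move=> wK wL i j; apply: (@weakly_singular_eq (fun x => K x i j + L x i j)).
  by move=> x; rewrite mxE.
exact: weakly_singularD.
Qed.

Lemma mwsMl (p q r : nat) (A : 'M[R]_(p, q)) (L : R -> 'M[R]_(q, r)) :
  mweakly_singular a X L -> mweakly_singular a X (fun x => A *m L x).
Proof.
move=> wL i j; apply: (@weakly_singular_eq (fun x => \sum_k A i k * L x k j)).
  by move=> x; rewrite mxE.
by apply: weakly_singular_sum => // k; exact: weakly_singularZ.
Qed.

Lemma mwsMr (p q r : nat) (K : R -> 'M[R]_(p, q)) (A : 'M[R]_(q, r)) :
  mweakly_singular a X K -> mweakly_singular a X (fun x => K x *m A).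
Proof.
move=> wK i j; apply: (@weakly_singular_eq (fun x => \sum_k A k j * K x i k)).
  by move=> x; rewrite mxE; apply: eq_bigr => k _; rewrite mulrC.
by apply: weakly_singular_sum => // k; exact: weakly_singularZ.
Qed.

Lemma mwsN (p q : nat) (K : R -> 'M[R]_(p, q)) :
  mweakly_singular a X K -> mweakly_singular a X (fun x => - K x).
Proof.
move=> wK i j; apply: (@weakly_singular_eq (fun x => -1 * K x i j)).
  by move=> x; rewrite mxE mulN1r.
exact: weakly_singularZ.
Qed.

Lemma eq_mconv (p q r : nat) (K : R -> 'M[R]_(p, q)) (L M : R -> 'M[R]_(q, r)) x :
  mweakly_singular a X K -> x <= X ->
  (forall y, y <= X -> L y = M y) -> mconv K L x = mconv K M x.
Proof.
move=> wK xX LM; apply/matrixP => i j; rewrite !mxE; apply: eq_bigr => k _.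
by apply: eq_conv => // y yX; rewrite LM.
Qed.

Lemma mconvDr (p q r : nat) (K : R -> 'M[R]_(p, q)) (L M : R -> 'M[R]_(q, r)) x :
  mweakly_singular a X K -> mweakly_singular a X L -> mweakly_singular a X M ->
  x <= X -> mconv K (fun y => L y + M y) x = mconv K L x + mconv K M x.
Proof.
move=> wK wL wM xX; apply/matrixP => i j; rewrite !mxE -big_split/=.
apply: eq_bigr => k _; rewrite -convDr; [|exact: (ws_int (wK i k) (wL k j) xX)|exact: (ws_int (wK i k) (wM k j) xX)].
by apply: eq_Rintegral => s _; rewrite mxE.
Qed.

Lemma mconvNr (p q r : nat) (K : R -> 'M[R]_(p, q)) (L : R -> 'M[R]_(q, r)) x :
  mweakly_singular a X K -> mweakly_singular a X L ->
  x <= X -> mconv K (fun y => - L y) x = - mconv K L x.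
Proof.
move=> wK wL xX; apply/matrixP => i j; rewrite !mxE -sumrN.
apply: eq_bigr => k _; rewrite -mulN1r -convZr; last exact: (ws_int (wK i k) (wL k j) xX).
by apply: eq_Rintegral => s _; rewrite mxE mulN1r.
Qed.

Lemma mconv_mulmx (p q r m : nat) (K : R -> 'M[R]_(p, q)) (A : 'M[R]_(q, r))
    (L : R -> 'M[R]_(r, m)) x :
  mweakly_singular a X K -> mweakly_singular a X L -> x <= X ->
  mconv K (fun y => A *m L y) x = mconv (fun y => K y *m A) L x.
Proof.
move=> wK wL xX; apply/matrixP => i j; rewrite !mxE.
transitivity (\sum_k \sum_l A k l * conv (fun y => K y i k) (fun y => L y l j) x).
  apply: eq_bigr => k _.
  rewrite (_ : (fun y => (A *m L y) k j) = (fun y => \sum_l A k l * L y l j)); last first.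
    by apply/funext => y; rewrite mxE.
  rewrite conv_sumr => [|l]; last exact: (ws_int (wK i k) (weakly_singularZ _ (wL l j)) xX).
  by apply: eq_bigr => l _; rewrite convZr//; exact: (ws_int (wK i k) (wL l j) xX).
rewrite exchange_big/=; apply: eq_bigr => l _.
have mL : measurable_fun setT (fun y => L y l j) by case: (wL l j).
have mK k : measurable_fun setT (fun y => K y i k) by case: (wK i k).
rewrite (_ : (fun y => (K y *m A) i l) = (fun y => \sum_k A k l * K y i k)); last first.
  by apply/funext => y; rewrite mxE; apply: eq_bigr => k _; rewrite mulrC.
have mS : measurable_fun setT (fun y => \sum_k A k l * K y i k).
  have [] // : weakly_singular a X (fun y => \sum_k A k l * K y i k).
  by apply: weakly_singular_sum => // k; exact: weakly_singularZ.
rewrite (convC x mS mL) conv_sumr => [|k]; last first.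
  exact: (ws_int (wL l j) (weakly_singularZ _ (wK i k)) xX).
apply: eq_bigr => k _; rewrite convZr; last exact: (ws_int (wL l j) (wK i k) xX).
by rewrite (convC x mL (mK k)).
Qed.

Lemma mulmx_mconv (p q r m : nat) (A : 'M[R]_(p, q)) (K : R -> 'M[R]_(q, r))
    (L : R -> 'M[R]_(r, m)) x :
  mweakly_singular a X K -> mweakly_singular a X L -> x <= X ->
  mconv (fun y => A *m K y) L x = A *m mconv K L x.
Proof.
move=> wK wL xX; apply/matrixP => i j; rewrite !mxE.
transitivity (\sum_k \sum_l A i l * conv (fun y => K y l k) (fun y => L y k j) x); last first.
  by rewrite exchange_big/=; apply: eq_bigr => l _; rewrite mxE mulr_sumr.
apply: eq_bigr => k _.
have mL : measurable_fun setT (fun y => L y k j) by case: (wL k j).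
have mK l : measurable_fun setT (fun y => K y l k) by case: (wK l k).
rewrite (_ : (fun y => (A *m K y) i k) = (fun y => \sum_l A i l * K y l k)); last first.
  by apply/funext => y; rewrite mxE.
have mS : measurable_fun setT (fun y => \sum_l A i l * K y l k).
  have [] // : weakly_singular a X (fun y => \sum_l A i l * K y l k).
  by apply: weakly_singular_sum => // l; exact: weakly_singularZ.
rewrite (convC x mS mL) conv_sumr => [|l]; last first.
  exact: (ws_int (wL k j) (weakly_singularZ _ (wK l k)) xX).
apply: eq_bigr => l _; rewrite convZr; last exact: (ws_int (wL k j) (wK l k) xX).
by rewrite (convC x mL (mK l)).
Qed.

Lemma mconvA (p q r m : nat) (K : R -> 'M[R]_(p, q)) (L : R -> 'M[R]_(q, r))
    (M : R -> 'M[R]_(r, m)) x :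
  mweakly_singular a X K -> mweakly_singular a X L -> mweakly_singular a X M ->
  x <= X -> mconv (mconv K L) M x = mconv K (mconv L M) x.
Proof.
move=> wK wL wM xX; apply/matrixP => i j; rewrite !mxE.
transitivity (\sum_k \sum_l conv (conv (fun y => K y i l) (fun y => L y l k)) (fun y => M y k j) x).
  apply: eq_bigr => k _.
  rewrite (_ : (fun y => mconv K L y i k) =
      (fun y => \sum_l conv (fun y => K y i l) (fun y => L y l k) y)); last first.
    by apply/funext => y; rewrite mxE.
  have wc l : weakly_singular a X (conv (fun y => K y i l) (fun y => L y l k)) by exact: ws_conv.
  have mS : measurable_fun setT (fun y => \sum_l conv (fun y => K y i l) (fun y => L y l k) y).
    have [] // : weakly_singular a X (fun y => \sum_l conv (fun y => K y i l) (fun y => L y l k) y).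
    exact: weakly_singular_sum.
  have mM : measurable_fun setT (fun y => M y k j) by case: (wM k j).
  rewrite (convC x mS mM) conv_sumr => [|l]; last exact: (ws_int (wM k j) (wc l) xX).
  by apply: eq_bigr => l _; apply: convC => //; case: (wc l).
rewrite exchange_big/=; apply: eq_bigr => l _.
rewrite (_ : (fun y => mconv L M y l j) =
      (fun y => \sum_k conv (fun y => L y l k) (fun y => M y k j) y)); last first.
  by apply/funext => y; rewrite mxE.
rewrite conv_sumr => [|k]; last exact: (ws_int (wK i l) (ws_conv (wL l k) (wM k j)) xX).
by apply: eq_bigr => k _; apply: (weakly_singular_conv_assoc a0 X0).
Qed.

End matrix_convolution.

(** * The Mittag-Leffler kernel and its fixed-point equation *)

Section Mittag_Leffler_kernel.
Context {R : realType}.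
Local Notation mu := (@lebesgue_measure R).

Lemma cvg_mx {T : Type} {F : set_system T} {FF : Filter F} (p q : nat)
    (f : T -> 'M[R]_(p, q)) (L : 'M[R]_(p, q)) :
  (forall i j, f x i j @[x --> F] --> L i j) -> f x @[x --> F] --> L.
Proof.
move=> fL; apply/cvg_ballP => e e0.
have : \forall x \near F, forall ij : 'I_p * 'I_q, ball (L ij.1 ij.2) e (f x ij.1 ij.2).
  by apply: filter_forall => -[i j]; have /cvg_ballP := fL i j; exact.
by apply: filterS => x H; split => // i j; exact: (H (i, j)).
Qed.

Lemma cvg_mx_coord {T : Type} {F : set_system T} {FF : Filter F} (p q : nat)
    (f : T -> 'M[R]_(p, q)) (L : 'M[R]_(p, q)) i j :
  f x @[x --> F] --> L -> f x i j @[x --> F] --> L i j.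
Proof.
by move=> fL; apply: (cvg_comp f (fun M : 'M[R]_(p, q) => M i j) fL); exact: coord_continuous.
Qed.

Variables (n : nat) (A : 'M[R]_n) (a : R).
Hypothesis a0 : 0 < a.

Definition ML_partial (N : nat) (x : R) (i j : 'I_n) : R :=
  series (fun m : nat => (A ^+ m) i j * frac_kernel (m%:R * a + a) x) N.

(** The factor [x^(a - 1)] is distributed over the series, which makes every term vanish for
    [x <= 0]. Limits are taken entrywise, so that scalar dominated convergence applies. *)
Definition ML_kernel (x : R) : 'M[R]_n :=
  \matrix_(i, j) limn (fun N => ML_partial N x i j).

Lemma exprmx_entry_bound : exists2 c, 0 <= c &
  forall (m : nat) i j, `|(A ^+ m) i j| <= c ^+ m.
Proof.
(* The sum of all moduli bounds every row sum, so the estimate survives each left multiplication by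
   [A]. *)
pose c := \sum_i \sum_k `|A i k|.
have c0 : 0 <= c by apply: sumr_ge0 => i _; exact: sumr_ge0.
have Ac i : \sum_k `|A i k| <= c.
  by rewrite /c [leRHS](bigD1 i)//= ler_wpDr//; apply: sumr_ge0 => k _; exact: sumr_ge0.
exists c => //; elim=> [|m IH] i j.
  by rewrite !expr0 mxE; case: (i == j); rewrite ?normr1 ?normr0.
rewrite exprS -mulmxE mxE (le_trans (ler_norm_sum _ _ _))//.
rewrite exprS (le_trans _ (ler_wpM2r (exprn_ge0 _ c0) (Ac i)))//.
rewrite mulr_suml; apply: ler_sum => k _; rewrite normrM.
by rewrite ler_wpM2l.
Qed.

Lemma ML_term_bound X : exists2 D, 0 <= D & forall (m : nat) x i j, x <= X ->
  `|(A ^+ m) i j * frac_kernel (m%:R * a + a) x| <= D * frac_kernel a x * 2^-1 ^+ m.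
Proof.
have [c c0 Hc] := exprmx_entry_bound.
have [D D0 HD] := Mittag_Leffler_term_bound X a0 c0.
exists D => // m x i j xX; apply: le_trans (HD m _ xX).
have b0 : 0 < m%:R * a + a by rewrite ltr_wpDl// mulr_ge0// ltW.
rewrite normrM ler_pM//.
by rewrite ger0_norm// frac_kernel_ge0.
Qed.

Lemma ML_partial_bound X : exists2 D, 0 <= D & forall N x i j, x <= X ->
  `|ML_partial N x i j| <= D * frac_kernel a x.
Proof.
have [D D0 HD] := ML_term_bound X.
exists (2 * D); first exact: mulr_ge0.
move=> N x i j xX; have k0 : 0 <= D * frac_kernel a x.
  by rewrite mulr_ge0// frac_kernel_ge0.
(* Strengthened for the induction: the last factor is the sum of the first [N] terms of the
   geometric series of ratio 1/2. *)
suff : `|ML_partial N x i j| <= D * frac_kernel a x * (2 - 2 * 2^-1 ^+ N).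
  have : 0 <= 2^-1 ^+ N :> R by rewrite exprn_ge0.
  by move=> ?; nra.
elim: N => [|N IH].
  by rewrite /ML_partial /series/= big_geq// normr0 mulr_ge0// expr0 mulr1 subrr.
rewrite /ML_partial seriesSr.
rewrite (le_trans (ler_normD _ _))//.
have := HD N x i j xX; move: IH; rewrite /ML_partial exprS.
have -> : 2 * (2^-1 * 2^-1 ^+ N) = 2^-1 ^+ N :> R by rewrite mulrA divff// mul1r.
move: (D * _) (2^-1 ^+ N) => u v.
set p := `| _ |; set q := `| _ |; lra.
Qed.

Lemma ML_partial_cvg x i j : cvgn (fun N => ML_partial N x i j).
Proof.
have [D D0 HD] := ML_term_bound x.
rewrite /ML_partial; apply: normed_cvg.
apply: (@series_le_cvg _ _ (geometric (D * frac_kernel a x) 2^-1)).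
- by move=> m; exact: normr_ge0.
- by move=> m; rewrite /= mulr_ge0 ?exprn_ge0// mulr_ge0// frac_kernel_ge0.
- by move=> m; exact: HD.
- apply: is_cvg_geometric_series; rewrite ger0_norm//; lra.
Qed.

Lemma ML_partial_cvgE x i j : ML_partial N x i j @[N --> \oo] --> ML_kernel x i j.
Proof. by rewrite mxE; exact: ML_partial_cvg. Qed.

Lemma measurable_ML_partial N i j : measurable_fun setT (fun x => ML_partial N x i j).
Proof.
apply: measurable_sum => m; apply: measurable_funM => //.
exact: measurable_frac_kernel.
Qed.

Lemma mws_ML_kernel X : mweakly_singular a X ML_kernel.
Proof.
move=> i j; split.
  apply: (@measurable_fun_cvg _ _ _ _ (fun N x => ML_partial N x i j)) => [N|x _].
    exact: measurable_ML_partial.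
  exact: ML_partial_cvgE.
have [D D0 HD] := ML_partial_bound X; exists D => // x xX.
rewrite mxE -lim_norm; last exact: ML_partial_cvg.
apply: limr_le; first by apply: is_cvg_norm; exact: ML_partial_cvg.
by apply: nearW => N; exact: HD.
Qed.

Lemma ML_kernelE x : 0 < x -> ML a a A x = ML_kernel x.
Proof.
move=> x0; rewrite /ML.
have H : series (fun m : nat => (x `^ (a * m%:R) / Gamma (m%:R * a + a)) *: A ^+ m) N
    @[N --> \oo] --> (x `^ (a - 1))^-1 *: ML_kernel x.
  apply: cvg_mx => i j; rewrite mxE.
  rewrite [X in X @ _ --> _](_ : _ = (fun N => (x `^ (a - 1))^-1 * ML_partial N x i j)).
    by apply: cvgM; [exact: cvg_cst|exact: ML_partial_cvgE].
  apply/funext => N; rewrite /series/= summxE mulr_sumr; apply: eq_bigr => m _.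
  have E : x `^ (m%:R * a + a - 1) = x `^ (a * m%:R) * x `^ (a - 1).
    by rewrite -addrA [LHS]powRD ?(gt_eqF x0) ?implybT// [m%:R * a]mulrC.
  rewrite mxE frac_kernelE// E.
  have : x `^ (a - 1) != 0 by rewrite gt_eqF// powR_gt0.
  move: (x `^ (a - 1)) => u u0.
  move: (x `^ _) (Gamma _) ((A ^+ m) i j) => v w z.
  rewrite [RHS](_ : _ = (u^-1 * u) * (v / w * z)); last by ring.
  by rewrite mulVf// mul1r.
rewrite (cvg_lim _ H)// scalerA divff ?scale1r// gt_eqF// powR_gt0//.
Qed.

(** Convolving a term with [frac_kernel a] raises its exponent [m * a + a] by [a], so the partial
    sums of index [N] and [N.+1] satisfy the relation exactly; dominated convergence gives the
    limit. *)
Lemma ML_kernel_fixpoint x i j : ML_kernel x i j =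
  (i == j)%:R * frac_kernel a x +
  \sum_l A i l * conv (frac_kernel a) (fun y => ML_kernel y l j) x.
Proof.
have := @ML_partial_cvgE x i j.
have mk b : measurable_fun setT (frac_kernel b : R -> R) by exact: measurable_frac_kernel.
have [D D0 HD] := ML_partial_bound `|x|.
have X0 : 0 <= `|x| by [].
have wk : weakly_singular a `|x| (frac_kernel a) by exact: weakly_singular_frac_kernel.
have wP N l : weakly_singular a `|x| (fun y => ML_partial N y l j).
  split; first exact: measurable_ML_partial.
  by exists D => // y yx; exact: HD.
have rec N : ML_partial N.+1 x i j = (i == j)%:R * frac_kernel a x +
    \sum_l A i l * conv (frac_kernel a) (fun y => ML_partial N y l j) x.
  rewrite /ML_partial /series/= big_nat_recl//= mul0r add0r expr0.
  have -> : (1 : 'M[R]_n) i j = (i == j)%:R by rewrite mxE.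
  congr (_ + _).
  transitivity (\sum_(0 <= m < N) \sum_l A i l * ((A ^+ m) l j * frac_kernel (m.+1%:R * a + a) x)).
    apply: eq_bigr => m _; rewrite exprS -mulmxE mxE mulr_suml.
    by apply: eq_bigr => l _; rewrite mulrA.
  rewrite exchange_big/=; apply: eq_bigr => l _; rewrite -mulr_sumr; congr (_ * _).
  have b0 m : 0 < m%:R * a + a by rewrite ltr_wpDl// mulr_ge0// ltW.
  have im m : mu.-integrable setT
     (fun s => (frac_kernel a (x - s) * frac_kernel (m%:R * a + a) s)%:E).
    exact: integrable_frac_kernel_conv.
  rewrite conv_sumr => [|m].
    apply: eq_bigr => m _; rewrite (convZr _ (im m)) (conv_frac_kernel _ a0 (b0 m)).
    by rewrite -natr1 mulrDl mul1r -addrA [_ + (a + a)]addrCA.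
  apply: eq_integrable (integrable_normM ((A ^+ m) l j) (im m)) => // s _ /=.
  by rewrite mulrCA.
move=> H1.
have H2 : ML_partial N.+1 x i j @[N --> \oo] --> ML_kernel x i j.
  by move: H1; rewrite -(cvg_shiftS (fun N => ML_partial N x i j)).
rewrite -(cvg_lim _ H2)//; apply/cvg_lim => //.
under eq_cvg do rewrite rec.
apply: cvgD; first exact: cvg_cst.
apply: (@cvg_big _ _ _ _ _ add_continuous _ _ _ (fun l N => A i l * conv (frac_kernel a) (fun y => ML_partial N y l j) x)) => l _.
apply: cvgM; first exact: cvg_cst.
have ik := integrable_frac_kernel_conv x a0 a0.
have mf N : measurable_fun setT (fun s : R => (frac_kernel a (x - s) * ML_partial N s l j)%:E).
  by apply/measurable_EFinP; apply: measurable_conv_integrand (mk a) (measurable_ML_partial N l j).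
have := @dominated_convergence _ _ _ mu _ measurableT
  (fun N (s : R) => (frac_kernel a (x - s) * ML_partial N s l j)%:E)
  (fun s : R => (frac_kernel a (x - s) * ML_kernel s l j)%:E)
  (fun s : R => (D * (frac_kernel a (x - s) * frac_kernel a s))%:E) mf.
case.
- apply/measurable_EFinP; apply: measurable_conv_integrand (mk a) _.
  by have [] := mws_ML_kernel 0 l j.
- apply: aeW => s _; apply: cvg_EFin; first exact: nearW.
  by apply: cvgM; [exact: cvg_cst|exact: ML_partial_cvgE].
- exact: integrable_normM.
- apply: aeW => s N _; rewrite lee_fin normrM ger0_norm ?frac_kernel_ge0//.
  rewrite mulrCA; have [sx|sx] := leP s `|x|.
    by rewrite ler_wpM2l ?HD// frac_kernel_ge0.
  rewrite (@frac_kernel_le0 _ _ (x - s)) ?mul0r//.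
  by rewrite subr_le0 (le_trans (ler_norm _))// ltW.
move=> i1 _ h; apply: fine_cvg.
by rewrite fineK; [exact: h|exact: integrable_fin_num].
Qed.

End Mittag_Leffler_kernel.

(** * The resolvent and the delayed Volterra equation *)

Section delay_equation.
Context {R : realType}.

Lemma weakly_singular_le (a b X : R) K : 0 < a -> a <= b ->
  weakly_singular b X K -> weakly_singular a X K.
Proof.
move=> a0 ab [mK [C C0 HC]]; split => //.
have [D D0 HD] := le_frac_kernel X a0 ab.
exists (C * D); first exact: mulr_ge0.
move=> x xX; apply: (le_trans (HC _ xX)); rewrite -mulrA.
exact: (ler_wpM2l C0 (HD _ xX)).
Qed.

(** Particular to exponent 1: for [a < 1] a translate of [frac_kernel a] is singular at [c] and
    escapes the bound, while the indicator [frac_kernel 1] dominates its translates to the right.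
    Delayed functions are therefore kept in class 1 and the kernels in class [a]. *)
Lemma weakly_singular1_shift (X c : R) K : 0 <= X -> 0 <= c ->
  weakly_singular 1 X K -> weakly_singular 1 X (fun x => K (x - c)).
Proof.
move=> X0 c0 wK; have [mK [C C0 HC]] := wK; split.
  by apply: measurableT_comp => //; exact: measurable_funB.
exists C => // x xX; have xcX : x - c <= X by rewrite (le_trans _ xX)// gerBl.
rewrite (le_trans (HC _ xcX))// ler_wpM2l// !frac_kernel1 ler_nat.
case: (ltP 0 (x - c)) => //; rewrite subr_gt0 => cx.
by rewrite (le_lt_trans c0 cx).
Qed.

Variables (n : nat) (A0 A1 : 'M[R]_n) (a tau : R).
Hypotheses (a0 : 0 < a) (a1 : a <= 1) (tau0 : 0 < tau).

Let E := ML_kernel A0 a.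

(** A scalar matrix, so that [mconvA] also covers products mixing the scalar kernel with matrix
    kernels. *)
Definition frac_mx (x : R) : 'M[R]_n := (frac_kernel a x)%:M.
Local Notation K := frac_mx.

Lemma mconv_frac_mxl (q : nat) (F : R -> 'M[R]_(n, q)) x i j :
  mconv K F x i j = conv (frac_kernel a) (fun y => F y i j) x.
Proof.
rewrite mxE (bigD1 i)//= big1 ?addr0 => [|k ki].
  by apply: eq_Rintegral => s _; rewrite mxE eqxx mulr1n.
rewrite /conv /Rintegral integral0_eq// => s _.
by rewrite mxE eq_sym (negbTE ki) mulr0n mul0r.
Qed.

Lemma mconv_frac_mxr (p : nat) (F : R -> 'M[R]_(p, n)) x i j :
  mconv F K x i j = conv (fun y => F y i j) (frac_kernel a) x.
Proof.
rewrite mxE (bigD1 j)//= big1 ?addr0 => [|k kj].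
  by apply: eq_Rintegral => s _; rewrite mxE eqxx mulr1n.
rewrite /conv /Rintegral integral0_eq// => s _.
by rewrite mxE (negbTE kj) mulr0n mulr0.
Qed.

Lemma ML_kernel_comm x : E x *m A0 = A0 *m E x.
Proof.
apply/matrixP => i j; rewrite !mxE.
have H1 : \sum_k ML_partial A0 a N x i k * A0 k j @[N --> \oo] --> \sum_k E x i k * A0 k j.
  apply: (@cvg_big _ _ _ _ _ add_continuous _ _ _ (fun k N => ML_partial A0 a N x i k * A0 k j)) => k _.
  by apply: cvgM; [exact: ML_partial_cvgE|exact: cvg_cst].
have H2 : \sum_k A0 i k * ML_partial A0 a N x k j @[N --> \oo] --> \sum_k A0 i k * E x k j.
  apply: (@cvg_big _ _ _ _ _ add_continuous _ _ _ (fun k N => A0 i k * ML_partial A0 a N x k j)) => k _.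
  by apply: cvgM; [exact: cvg_cst|exact: ML_partial_cvgE].
rewrite -(cvg_lim _ H1)// -(cvg_lim _ H2)//; congr (limn _); apply/funext => N.
rewrite /ML_partial /series/=.
transitivity (\sum_(0 <= m < N) (A0 ^+ m *m A0) i j * frac_kernel (m%:R * a + a) x).
  under eq_bigr do rewrite mulr_suml.
  rewrite exchange_big/=; apply: eq_bigr => m _; rewrite mxE mulr_suml.
  by apply: eq_bigr => k _; rewrite mulrAC.
under [RHS]eq_bigr do rewrite mulr_sumr.
rewrite [RHS]exchange_big/=; apply: eq_bigr => m _.
rewrite mulmxE -exprSr exprS -mulmxE mxE mulr_suml.
by apply: eq_bigr => k _; rewrite mulrA.
Qed.

Section fixed_horizon.
Variable X : R.
Hypothesis X0 : 0 <= X.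

Lemma mws_frac_mx : mweakly_singular a X K.
Proof.
move=> i j; have [->|ij] := eqVneq i j.
  apply: (@weakly_singular_eq _ _ _ (frac_kernel a)) => [y|]; first by rewrite mxE eqxx mulr1n.
  exact: weakly_singular_frac_kernel.
apply: (@weakly_singular_eq _ _ _ (cst 0)) => [y|]; first by rewrite mxE (negbTE ij) mulr0n.
exact: weakly_singular0.
Qed.

Lemma mws_E : mweakly_singular a X E.
Proof. exact: mws_ML_kernel. Qed.

Lemma ML_kernel_fixl x : x <= X -> E x = K x + mconv K (fun y => A0 *m E y) x.
Proof.
move=> xX; apply/matrixP => i j; rewrite /E ML_kernel_fixpoint// mxE mconv_frac_mxl.
congr (_ + _); first by rewrite mxE mulr_natl.
rewrite (_ : (fun y => _) = (fun y => \sum_l A0 i l * E y l j)); last first.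
  by apply/funext => y; rewrite mxE.
have wk : weakly_singular a X (frac_kernel a) by exact: weakly_singular_frac_kernel.
rewrite conv_sumr => [|l]; last exact: (ws_int a0 X0 wk (weakly_singularZ _ (mws_E l j)) xX).
by apply: eq_bigr => l _; rewrite convZr//; exact: (ws_int a0 X0 wk (mws_E l j) xX).
Qed.

(** Obtained from the left form since [E] commutes with [A0] and the scalar kernel commutes under
    convolution. The left form yields existence for the resolvent, this one uniqueness. *)
Lemma ML_kernel_fixr x : x <= X -> E x = K x + mconv (fun y => E y *m A0) K x.
Proof.
move=> xX; rewrite {1}ML_kernel_fixl//; congr (_ + _); apply/matrixP => i j.
rewrite mconv_frac_mxl mconv_frac_mxr convC//.
- by apply: eq_Rintegral => s _; rewrite ML_kernel_comm.
- exact: measurable_frac_kernel.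
- by have [] := mwsMl a0 A0 mws_E i j.
Qed.

Lemma mconvDl (p q r : nat) (L M : R -> 'M[R]_(p, q)) (N : R -> 'M[R]_(q, r)) x :
  mweakly_singular a X L -> mweakly_singular a X M -> mweakly_singular a X N ->
  x <= X -> mconv (fun y => L y + M y) N x = mconv L N x + mconv M N x.
Proof.
move=> wL wM wN xX; apply/matrixP => i j; rewrite !mxE -big_split/=.
apply: eq_bigr => k _.
rewrite /conv -RintegralD//.
- by apply: eq_Rintegral => s _; rewrite mxE mulrDl.
- exact: (ws_int a0 X0 (wL i k) (wN k j) xX).
- exact: (ws_int a0 X0 (wM i k) (wN k j) xX).
Qed.

Lemma eq_mconvl (p q r : nat) (L M : R -> 'M[R]_(p, q)) (N : R -> 'M[R]_(q, r)) x :
  mweakly_singular a X L -> mweakly_singular a X M -> mweakly_singular a X N -> x <= X ->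
  (forall y, y <= X -> L y = M y) -> mconv L N x = mconv M N x.
Proof.
move=> wL wM wN xX LM; apply/matrixP => i j; rewrite !mxE; apply: eq_bigr => k _.
apply: eq_Rintegral => s _.
have [s0|s0] := leP s 0.
  by rewrite (weakly_singular_le0 X0 (wN k j) s0) !mulr0.
by rewrite LM// (le_trans _ xX)// gerBl ltW.
Qed.

Lemma resolvent_solves (q : nat) (g : R -> 'M[R]_(n, q)) x : mweakly_singular a X g ->
  x <= X -> mconv E g x = mconv K (fun y => A0 *m mconv E g y + g y) x.
Proof.
move=> wg xX; have wE := mws_E; have wK := mws_frac_mx.
have wAE := mwsMl a0 A0 wE; have wKAE := mws_mconv a0 X0 wK wAE.
have wEg := mws_mconv a0 X0 wE wg.
rewrite (mconvDr a0 X0 wK (mwsMl a0 A0 wEg) wg xX).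
transitivity (mconv (fun y => K y + mconv K (fun z => A0 *m E z) y) g x).
  apply: eq_mconvl => //; first exact: mwsD.
  exact: ML_kernel_fixl.
rewrite mconvDl// addrC; congr (_ + _).
rewrite (mconvA a0 X0 wK wAE wg xX).
apply: (eq_mconv X0 wK xX) => y yX.
by rewrite (mulmx_mconv a0 X0 _ wE wg yX).
Qed.

(** Convolve [A0 u + g] with [E] on the left. By the right fixed-point form and the equation for [u]
    the result is [u + E * (A0 u)], by linearity it is [E * (A0 u) + E * g]; cancel [E * (A0 u)]. *)
Lemma resolvent_unique (q : nat) (u g : R -> 'M[R]_(n, q)) :
  mweakly_singular a X u -> mweakly_singular a X g ->
  (forall x, x <= X -> u x = mconv K (fun y => A0 *m u y + g y) x) ->
  forall x, x <= X -> u x = mconv E g x.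
Proof.
move=> wu wg Hu x xX; have wE := mws_E; have wK := mws_frac_mx.
have wEA := mwsMr a0 A0 wE.
have wAug := mwsD a0 (mwsMl a0 A0 wu) wg.
have H : mconv E (fun y => A0 *m u y + g y) x = u x + mconv E (fun y => A0 *m u y) x.
  transitivity (mconv (fun y => K y + mconv (fun z => E z *m A0) K y) (fun y => A0 *m u y + g y) x).
    apply: eq_mconvl => //.
      by apply: mwsD => //; exact: mws_mconv.
    exact: ML_kernel_fixr.
  rewrite mconvDl//; last exact: mws_mconv.
  rewrite -Hu//; congr (_ + _).
  rewrite (mconvA a0 X0 wEA wK wAug xX).
  rewrite (mconv_mulmx a0 X0 _ wE wu xX).
  by apply: (eq_mconv X0 wEA xX) => y yX; rewrite -Hu.
move: H; rewrite (mconvDr a0 X0 wE (mwsMl a0 A0 wu) wg xX) addrC.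
by move/addIr.
Qed.

Lemma mws1W (p q : nat) (F : R -> 'M[R]_(p, q)) :
  mweakly_singular 1 X F -> mweakly_singular a X F.
Proof. by move=> wF i j; exact: (weakly_singular_le a0 a1 (wF i j)). Qed.

Lemma mws1_shift (p q : nat) (F : R -> 'M[R]_(p, q)) c : 0 <= c ->
  mweakly_singular 1 X F -> mweakly_singular 1 X (fun x => F (x - c)).
Proof. by move=> c0 wF i j; exact: (weakly_singular1_shift X0 c0 (wF i j)). Qed.

Lemma mws1_mconv (p q r : nat) (L : R -> 'M[R]_(p, q)) (f : R -> 'M[R]_(q, r)) :
  mweakly_singular a X L -> mweakly_singular 1 X f -> mweakly_singular 1 X (mconv L f).
Proof.
move=> wL wf i j.
apply: (@weakly_singular_eq _ _ _ (fun x => \sum_k conv (fun y => L y i k) (fun y => f y k j) x)).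
  by move=> x; rewrite mxE.
apply: weakly_singular_sum => // k.
apply: (weakly_singular_conv a0 ltr01 X0 ltr01 _ (wL i k) (wf k j)).
by rewrite lerDr ltW.
Qed.

(** The resolvent absorbs the undelayed term, leaving [D = E * (A1 D(. - tau))]. The values for
    [x <= (k + 1) * tau] then depend only on those for [x <= k * tau]. *)
Lemma delay_homogeneous0 (q : nat) (D : R -> 'M[R]_(n, q)) : mweakly_singular 1 X D ->
  (forall x, x <= X -> D x = mconv K (fun y => A0 *m D y + A1 *m D (y - tau)) x) ->
  forall x, x <= X -> D x = 0.
Proof.
move=> wD HD.
have wS : mweakly_singular a X (fun y => A1 *m D (y - tau)).
  apply: mws1W; apply: mwsMl => //; apply: mws1_shift => //; exact: ltW.
have HE := resolvent_unique (mws1W wD) wS HD.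
have main (k : nat) x : x <= X -> x <= k%:R * tau -> D x = 0.
  elim: k x => [|k IH] x xX xk.
    by apply: (mws_le0 X0 wD); rewrite mul0r in xk.
  have [x0|x0] := leP x 0; first exact: (mws_le0 X0 wD).
  rewrite HE//.
  have wE' : mweakly_singular a x E.
    by move=> i j; exact: (weakly_singularS xX (mws_E i j)).
  rewrite (@eq_mconv _ a x (ltW x0) _ _ _ E _ (fun _ => 0)) => //.
    apply/matrixP => i j; rewrite !mxE big1// => l _.
    by rewrite /conv /Rintegral integral0_eq// => s _; rewrite [X in _ * X]mxE mulr0.
  move=> y yx; rewrite IH ?mulmx0//.
    by rewrite (le_trans _ xX)// (le_trans _ yx)// gerBl ltW.
  by rewrite lerBlDr (le_trans yx)// (le_trans xk)// -natr1 mulrDl mul1r.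
move=> x xX; apply: (main (Num.truncn `|x / tau|).+1) => //.
by rewrite -ler_pdivrMr// (le_trans (ler_norm _))// ltW// truncnS_gt.
Qed.

(** The delay is left out of the recursion: convolution commutes with translation, so the shift by
    [k * tau] is applied once, from outside. *)
Fixpoint layer (k : nat) : R -> 'M[R]_n :=
  if k is k'.+1 then mconv E (fun y => A1 *m layer k' y) else E.

Lemma mws_layer k : mweakly_singular a X (layer k).
Proof.
elim: k => [|k IH]; first exact: mws_E.
by apply: mws_mconv => //; [exact: mws_E|exact: mwsMl].
Qed.

(** The terms with [j * tau >= x] vanish, so a fixed number of layers replaces the piecewise
    definition. *)
Definition delay_solution (q : nat) (f : R -> 'M[R]_(n, q)) (N : nat) (x : R) : 'M[R]_(n, q) :=
  \sum_(0 <= j < N) mconv (layer j) f (x - j%:R * tau).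

Variables (q : nat) (f : R -> 'M[R]_(n, q)).
Hypothesis wf : mweakly_singular 1 X f.

Lemma mws1_layer_shift j : mweakly_singular 1 X (fun x => mconv (layer j) f (x - j%:R * tau)).
Proof.
apply: mws1_shift; first by rewrite mulr_ge0// ltW.
by apply: mws1_mconv => //; exact: mws_layer.
Qed.

Lemma mws1_delay_solution N : mweakly_singular 1 X (delay_solution f N).
Proof.
elim: N => [|N IH] i j.
  apply: (@weakly_singular_eq _ _ _ (cst 0)) => [x|]; last exact: weakly_singular0.
  by rewrite /delay_solution big_geq// mxE.
apply: (@weakly_singular_eq _ _ _
  (fun x => delay_solution f N x i j + mconv (layer N) f (x - N%:R * tau) i j)).
  by move=> x; rewrite /delay_solution big_nat_recr//= [RHS]mxE.
by apply: weakly_singularD => //; exact: mws1_layer_shift.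
Qed.

(** Layer 0 accounts for [f]. By associativity and translation, the term of layer [j + 1] is [E]
    convolved with [A1] times the term of layer [j] delayed by [tau]. *)
Lemma delay_solution_rec N x : x <= X ->
  delay_solution f N.+1 x =
  mconv E (fun y => A1 *m delay_solution f N (y - tau) + f y) x.
Proof.
move=> xX; have wE := mws_E; have wf' := mws1W wf.
elim: N => [|N IH].
  rewrite /delay_solution big_nat1 mul0r subr0/=.
  apply: (eq_mconv X0 wE xX) => y yX.
  by rewrite big_geq// mulmx0 add0r.
rewrite {1}/delay_solution big_nat_recr//= -/(delay_solution f N.+1 x) IH.
have wS := mwsD a0 (mwsMl a0 A1 (mws1W (mws1_shift (ltW tau0) (mws1_delay_solution N)))) wf'.
have Nt0 : 0 <= N.+1%:R * tau by rewrite mulr_ge0// ltW.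
have wT := mwsMl a0 A1 (mws1W (mws1_shift Nt0 (mws1_mconv (mws_layer N) wf))).
have -> : mconv (mconv E (fun y => A1 *m layer N y)) f (x - N.+1%:R * tau) =
    mconv E (fun y => A1 *m mconv (layer N) f (y - N.+1%:R * tau)) x.
  have xX' : x - N.+1%:R * tau <= X by rewrite (le_trans _ xX)// gerBl mulr_ge0// ltW.
  have wA := mwsMl a0 A1 (mws_layer N).
  rewrite (mconvA a0 X0 wE wA wf' xX').
  have wM := mws_mconv a0 X0 (mws_layer N) wf'.
  rewrite (@mconv_shift _ _ _ _ E (fun y => A1 *m mconv (layer N) f y)).
  - apply: (eq_mconv X0 wE xX') => y yX.
    by rewrite (mulmx_mconv a0 X0 _ (mws_layer N) wf' yX).
  - by move=> i k; case: (wE i k).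
  - by move=> k j; have [] := mwsMl a0 A1 wM k j.
rewrite -(mconvDr a0 X0 wE wS wT xX).
apply: (eq_mconv X0 wE xX) => y yX.
rewrite /delay_solution big_nat_recr//= mulmxDr addrAC.
by have -> : y - tau - N%:R * tau = y - N.+1%:R * tau by rewrite -natr1; ring.
Qed.

Lemma delay_solution_stable N x : x <= X -> x <= N%:R * tau ->
  delay_solution f N.+1 x = delay_solution f N x.
Proof.
move=> xX xN; rewrite /delay_solution big_nat_recr//=.
have wM := mws_mconv a0 X0 (mws_layer N) (mws1W wf).
by rewrite (mws_le0 X0 wM) ?addr0// subr_le0.
Qed.

(** The recursion passes from [N] layers to [N.+1]. As [X <= N * tau], the additional layer vanishes
    up to the horizon and the recursion closes into an equation. *)
Lemma delay_solution_fix N x : X <= N%:R * tau -> x <= X ->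
  delay_solution f N.+1 x =
  mconv K (fun y => A0 *m delay_solution f N.+1 y + A1 *m delay_solution f N.+1 (y - tau) + f y) x.
Proof.
move=> XN xX; have wE := mws_E; have wK := mws_frac_mx.
pose g y := A1 *m delay_solution f N (y - tau) + f y.
have wg : mweakly_singular a X g :=
  mwsD a0 (mwsMl a0 A1 (mws1W (mws1_shift (ltW tau0) (mws1_delay_solution N)))) (mws1W wf).
rewrite delay_solution_rec// (resolvent_solves wg xX).
apply: (eq_mconv X0 wK xX) => y yX.
rewrite -addrA; congr (_ *m _ + _); first by rewrite delay_solution_rec.
have yt : y - tau <= X by rewrite (le_trans _ yX)// gerBl ltW.
by rewrite /g delay_solution_stable// (le_trans yt).
Qed.

End fixed_horizon.
End delay_equation.

(** * Passage to the variable [ln t] *)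

Section log_variable.
Context {R : realType}.
Local Notation mu := (@lebesgue_measure R).

Lemma Rintegral_ln (A : set R) (g G : R -> R) : (forall s, A s -> 0 < s) ->
  measurable_fun setT G -> (forall s, A s -> g s = s^-1 * G (ln s)) ->
  (forall s, 0 < s -> ~ A s -> G (ln s) = 0) ->
  \int[mu]_(s in A) g s = \int[mu]_x G x.
Proof.
move=> A0 mG gG G0; rewrite Rintegral_mkcond (Rintegral_change itv_change_ln mG).
apply: eq_Rintegral => s _; rewrite /patch; case: ifPn => [|].
  by rewrite inE => As; rewrite gG// A0.
move=> /negP; rewrite inE => As; case: ifPn => s0; last by rewrite mul0r.
by rewrite G0// mulr0.
Qed.

Lemma integrable_ln (A : set R) (g G : R -> R) : measurable A ->
  (forall s, A s -> 0 < s) ->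
  measurable_fun setT G -> (forall s, A s -> g s = s^-1 * G (ln s)) ->
  (forall s, 0 < s -> ~ A s -> G (ln s) = 0) ->
  mu.-integrable A (EFin \o g) <-> mu.-integrable setT (EFin \o G).
Proof.
move=> mA A0 mG gG G0.
have E s : ((EFin \o g) \_ A) s = ((if 0 < s then s^-1 else 0) * G (ln s))%:E.
  rewrite /patch; case: ifPn => [|].
    by rewrite inE => As; rewrite /= gG// A0.
  move=> /negP; rewrite inE => As; case: ifPn => s0; last by rewrite mul0r.
  by rewrite G0// mulr0.
split.
  move=> iA; have H := proj1 (@integrable_mkcond _ (measurableTypeR R) _ mu A (EFin \o g) mA) iA; apply: (integrable_change itv_change_ln mG).
  by apply: eq_integrable H => // s _; rewrite E.
move=> iG; have H := integrable_changeV itv_change_ln mG iG; apply: (proj2 (@integrable_mkcond _ (measurableTypeR R) _ mu A (EFin \o g) mA)).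
by apply: eq_integrable H => // s _; rewrite E.
Qed.

(** Endpoints are negligible, so agreement is asked on the open interval only: at the endpoints the
    kernels take exceptional values, such as [1%:M] for [delayedML] at [t = s]. *)
Lemma Rintegral_ln_itv (a b : R) (b0 b1 : bool) (g G : R -> R) : 0 < a -> a <= b ->
  measurable_fun setT G -> (forall s, a < s < b -> g s = s^-1 * G (ln s)) ->
  (forall x, x <= ln a \/ ln b <= x -> G x = 0) ->
  \int[mu]_(s in [set` Interval (BSide b0 a) (BSide b1 b)]) g s = \int[mu]_x G x.
Proof.
move=> a0 ab mG gG G0; have b0' := lt_le_trans a0 ab.
have mg : measurable_fun `]a, b[ (fun s => (g s)%:E).
  apply/measurable_EFinP.
  have [mw _ _ _] := @itv_change_ln R.
  have mwG : measurable_fun `]a, b[ (fun s : R => (if 0 < s then s^-1 else 0) * G (ln s)).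
    apply: measurable_funTS; apply: measurable_funM => //.
    by apply: measurableT_comp => //; exact: measurable_ln.
  apply: eq_measurable_fun mwG => s; rewrite inE/= in_itv/= => /andP[as_ sb].
  by rewrite (lt_trans a0 as_) gG// as_.
rewrite /Rintegral integral_itv_bndoo//.
apply: (@Rintegral_ln `]a, b[ g G) => //.
- by move=> s /=; rewrite in_itv/= => /andP[+ _]; exact: lt_trans.
move=> s s0 /= /negP; rewrite in_itv/= negb_and -!leNgt => /orP[sa|bs]; apply: G0.
  by left; rewrite ler_ln ?posrE.
by right; rewrite ler_ln ?posrE.
Qed.

Lemma Rintegral_sum (I : Type) (r : seq I) (F : I -> R -> R) :
  (forall i, mu.-integrable setT (EFin \o F i)) ->
  \int[mu]_x (\sum_(i <- r) F i x) = \sum_(i <- r) \int[mu]_x F i x.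
Proof.
move=> iF; elim: r => [|i r IH].
  by rewrite big_nil /Rintegral integral0_eq// => s _; rewrite big_nil.
under [in LHS]eq_Rintegral do rewrite big_cons.
rewrite big_cons RintegralD ?IH//.
apply: eq_integrable (integrable_sum measurableT r (P := xpredT) (fun i _ => iF i)) => //.
by move=> s _ /=; rewrite sumEFin.
Qed.

Lemma measurable_mulmx_entry (p q r : nat) (K : R -> 'M[R]_(p, q)) (L : R -> 'M[R]_(q, r)) c i j :
  (forall i k, measurable_fun setT (fun y => K y i k)) ->
  (forall k j, measurable_fun setT (fun y => L y k j)) ->
  measurable_fun setT (fun s : R => (K (c - s) *m L s) i j).
Proof.
move=> mK mL.
rewrite (_ : (fun s => _) = (fun s => \sum_k K (c - s) i k * L s k j)); last first.
  by apply/funext => s; rewrite mxE.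
apply: measurable_sum => k; apply: measurable_funM => //.
by apply: (@measurableT_comp _ _ _ _ _ _ (fun y => K y i k)) => //; exact: measurable_funB.
Qed.

Lemma measurable_mx_shift (q r : nat) (L : R -> 'M[R]_(q, r)) d k j :
  (forall k j, measurable_fun setT (fun y => L y k j)) ->
  measurable_fun setT (fun y : R => L (y - d) k j).
Proof.
move=> mL.
by apply: (@measurableT_comp _ _ _ _ _ _ (fun y => L y k j)) => //; exact: measurable_funB.
Qed.

Lemma mconv_integral (a X : R) (p q r : nat) (K : R -> 'M[R]_(p, q)) (L : R -> 'M[R]_(q, r)) c d i j :
  0 < a -> 0 <= X -> mweakly_singular a X K -> mweakly_singular a X L -> c - d <= X ->
  \int[mu]_s (K (c - s) *m L (s - d)) i j = mconv K L (c - d) i j.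
Proof.
move=> a0 X0 wK wL cdX.
have mK k l : measurable_fun setT (fun y => K y k l) by case: (wK k l).
have mL k l : measurable_fun setT (fun y => L y k l) by case: (wL k l).
transitivity (\int[mu]_s (K (c - d - s) *m L s) i j).
  have mKL := measurable_mulmx_entry (c - d) i j mK mL.
  rewrite [RHS](Rintegral_change (itv_change_shift d) mKL).
  by apply: eq_Rintegral => s _; rewrite mul1r opprB addrA subrK.
rewrite mxE.
transitivity (\int[mu]_s \sum_k (K (c - d - s) i k * L s k j)).
  by apply: eq_Rintegral => s _; rewrite mxE.
rewrite Rintegral_sum// => k.
exact: (ws_int a0 X0 (wK i k) (wL k j) cdX).
Qed.

Variables (n : nat) (A0 A1 : 'M[R]_n) (a h : R).
Hypotheses (a0 : 0 < a) (a1 : a <= 1) (h1 : 1 < h).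
Local Notation tau := (ln h).
Local Notation E := (ML_kernel A0 a).
Local Notation lay := (layer A0 A1 a).

(** By induction: for layer [k.+1], with [c = ln (s * h ^+ k.+1)], the substitution [x = ln r],
    whose density is [r^-1], turns the defining integral into a convolution at [ln t - c]. *)
Lemma Ylayer_layer k t s : 0 < s -> s * h ^+ k < t ->
  Ylayer h a a A0 A1 k t s = lay k (ln t - ln s - k%:R * tau).
Proof.
have h0 : 0 < h by rewrite (lt_trans _ h1).
move=> s0; elim: k t => [|k IH] t st.
  rewrite /= expr0 mulr1 in st; have t0 : 0 < t by exact: lt_trans st.
  rewrite /= mul0r subr0 -ln_div ?posrE// ML_kernelE// ln_gt0//.
  by rewrite ltr_pdivlMr// mul1r.
have sh0 : 0 < s * h ^+ k.+1 by rewrite mulr_gt0// exprn_gt0.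
have t0 : 0 < t by exact: lt_trans st.
apply/matrixP => i j.
pose c := ln s + k.+1%:R * tau.
have lsh : ln (s * h ^+ k.+1) = c.
  by rewrite lnM ?posrE ?exprn_gt0// lnXn// /c mulr_natl.
pose X := `|ln t - c|.
have X0 : 0 <= X by exact: normr_ge0.
have wE : mweakly_singular a X E by exact: mws_ML_kernel.
have wL : mweakly_singular a X (fun y => A1 *m lay k y).
  by apply: mwsMl => //; exact: mws_layer.
have mE i' k' : measurable_fun setT (fun y => E y i' k') by case: (wE i' k').
have mL i' k' : measurable_fun setT (fun y => (A1 *m lay k y) i' k') by case: (wL i' k').
rewrite [LHS]/= mxE.
have -> : ln t - ln s - k.+1%:R * tau = ln t - c by rewrite /c; ring.
rewrite -(mconv_integral _ _ a0 X0 wE wL (ler_norm _)).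
apply: Rintegral_ln_itv => //.
- exact: ltW.
- apply: (@measurable_mulmx_entry _ _ _ E (fun y => A1 *m lay k (y - c))) => // k' j'.
  exact: (@measurable_mx_shift _ _ (fun y => A1 *m lay k y)).
- move=> r /andP[sr rt]; have r0 : 0 < r by exact: lt_trans sr.
  rewrite mxE; congr (_ * _).
  have lnrt : 0 < ln (t / r) by rewrite ln_gt0// ltr_pdivlMr// mul1r.
  rewrite ML_kernelE// ln_div ?posrE// IH; last first.
    by rewrite ltr_pdivlMr// -mulrA -exprSr.
  rewrite -mulmxA ln_div ?posrE//.
  have -> : ln r - tau - ln s - k%:R * tau = ln r - c.
    by rewrite /c -natr1; ring.
  by [].
- move=> x; rewrite lsh => -[xc|tx]; rewrite mxE big1// => l _.
    by rewrite (weakly_singular_le0 X0 (wL l j)) ?mulr0// subr_le0.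
  by rewrite (weakly_singular_le0 X0 (wE i l)) ?mul0r// subr_le0.
Qed.

(** Layers beyond the [k] selected by [xget] are evaluated at nonpositive arguments, hence vanish,
    and one sum serves all pieces of the definition. *)
Lemma delayedML_layer N t s : 0 < s -> s < t -> t <= s * h ^+ N ->
  delayedML h a a A0 A1 t s = \sum_(0 <= j < N) lay j (ln t - ln s - j%:R * tau).
Proof.
move=> s0 st tN.
have h0 : 0 < h by rewrite (lt_trans _ h1).
have t0 : 0 < t by exact: lt_trans st.
rewrite /delayedML ltNge (ltW st)/= gt_eqF//=.
case: xgetP => [k _ /= /andP[skt tsk]|H]; last first.
  have P : exists k, t <= s * h ^+ k.+1.
    exists N; rewrite (le_trans tN)// ler_pM2l// exprS ler_peMl// ?exprn_ge0// ltW//.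
  (* The least [k] with [t <= s * h ^+ k.+1] belongs to the set searched by [xget]: [s * h ^+ k < t]
     holds by minimality, or by [s < t] when [k = 0]. *)
  case: (ex_minnP P) => k tk mink; exfalso; apply: (H k) => /=; rewrite tk andbT.
  case: k mink {tk} => [|k] mink; first by rewrite expr0 mulr1.
  by rewrite ltNge; apply/negP => /mink; rewrite ltnn.
have kN : (k.+1 <= N)%N.
  rewrite ltnNge; apply/negP => Nk; move: (lt_le_trans skt tN).
  rewrite ltr_pM2l// ltr_eXn2l// => kN.
  by have := leq_trans kN Nk; rewrite ltnn.
rewrite [RHS](big_cat_nat (n := k.+1))//= [X in _ + X]big_nat_cond [X in _ + X]big1 ?addr0.
  apply: eq_big_nat => j /andP[_ jk]; apply: Ylayer_layer => //.
  apply: le_lt_trans skt; rewrite ler_pM2l// ler_weXn2l// ltW//.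
move=> j /andP[/andP[kj _] _].
apply: (mws_le0 (lexx 0) (mws_layer A0 A1 a0 (lexx 0) j)).
rewrite subr_le0 lerBlDl mulr_natl -lnXn// -lnM ?posrE ?exprn_gt0//.
rewrite ler_ln ?posrE// ?mulr_gt0 ?exprn_gt0// (le_trans tsk)// ler_pM2l//.
by rewrite ler_weXn2l// ltW.
Qed.

End log_variable.

(** * Primitives as convolutions with [frac_kernel 1] *)

Section calculus.
Context {R : realType}.
Local Notation mu := (@lebesgue_measure R).

(** [frac_kernel 1] is the indicator of the positive half-line, and [g] vanishes below 0, which
    frees the lower bound: 0 serves for derivatives, a negative one for continuity at every
    point. *)
Lemma conv1_itv (g : R -> R) (c x : R) (b : bool) : c <= 0 ->
  mu.-integrable setT (EFin \o g) -> (forall s, s <= 0 -> g s = 0) ->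
  conv (frac_kernel 1) g x = \int[mu]_(s in [set` Interval (BSide b c) (BRight x)]) g s.
Proof.
move=> c0 ig g0; rewrite -Rintegral_itv_bndo_bndc; last exact: integrableS ig.
rewrite Rintegral_mkcond; apply: eq_Rintegral => s _.
rewrite frac_kernel1 subr_gt0 /patch mem_setE.
have [sx|xs] := ltP s x; last first.
  by rewrite mul0r in_itv/= ltNge xs andbF.
rewrite mul1r in_itv/= sx andbT.
have [s0|s0] := leP s 0; first by rewrite g0// if_same.
case: b => /=; first by rewrite (le_trans c0 (ltW s0)).
by rewrite (le_lt_trans c0 s0).
Qed.

Lemma conv1_derive (g : R -> R) (x : R) : mu.-integrable setT (EFin \o g) ->
  (forall s, s <= 0 -> g s = 0) -> 0 < x -> {for x, continuous g} ->
  is_derive x 1 (conv (frac_kernel 1) g) (g x).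
Proof.
move=> ig g0 x0 cg.
have -> : conv (frac_kernel 1) g =
    (fun y => \int[mu]_(s in [set` Interval (BRight 0) (BRight y)]) g s).
  by apply/funext => y; exact: conv1_itv.
have x1 : x < x + 1 by rewrite ltrDl.
have ig' : mu.-integrable [set` Interval (BRight 0) (BRight (x + 1))] (EFin \o g).
  exact: integrableS ig.
have [] := @continuous_FTC1 R g (BRight 0) x (x + 1) x1 ig' _ cg; first by [].
by move=> d e; apply: (DeriveDef d); rewrite -derive1E; exact: e.
Qed.

Lemma conv1_continuous (g : R -> R) : mu.-integrable setT (EFin \o g) ->
  (forall s, s <= 0 -> g s = 0) -> continuous (conv (frac_kernel 1) g).
Proof.
move=> ig g0 x.
pose c := - (`|x| + 1); pose d := `|x| + 1.
have c0 : c <= 0 by rewrite oppr_le0 addr_ge0.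
have cd : c < d by rewrite (le_lt_trans c0)// ltr_wpDl.
have ig' : mu.-integrable `[c, d] (EFin \o g) by exact: integrableS ig.
have H := parameterized_integral_continuous (ltW cd) ig'.
have -> : conv (frac_kernel 1) g = (fun y => parameterized_integral mu c y g).
  by apply/funext => y; exact: conv1_itv.
have xcd : x \in `]c, d[.
  rewrite in_itv/= /c /d; have := ler_norm x; have := ler_norm (- x); rewrite normrN; lra.
exact: (within_continuous_continuous cd H xcd).
Qed.

Lemma continuous_comp_within (c f : R -> R) (A : set R) : continuous c ->
  (forall x, A (c x)) -> {within A, continuous f} -> continuous (f \o c).
Proof.
move=> cc cA /subspace_continuousP cf x.
move=> P /(cf (c x) (cA x)) HP.
have H : nbhs x (c @^-1` (fun t => A t -> P (f t))) := cc x _ HP.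
by apply: filterS H => y /(_ (cA y)).
Qed.

Lemma derive0_cst (F : R -> R) (a b : R) : a <= b ->
  (forall x, a < x < b -> is_derive x 1 F 0) ->
  {within `[a, b], continuous F} -> F a = F b.
Proof.
rewrite le_eqVlt => /predU1P[->//|ab] dF cF.
have dF' x : x \in `]a, b[ -> is_derive x 1 F ((fun=> 0) x).
  by rewrite in_itv/=; exact: dF.
have [c _] := MVT ab dF' cF.
by rewrite mul0r => /eqP; rewrite subr_eq0 => /eqP.
Qed.

Lemma within_itv_bounded (f : R -> R) (a b : R) : a <= b -> {within `[a, b], continuous f} ->
  exists B, forall x, a <= x <= b -> `|f x| <= B.
Proof.
move=> ab cf; have [c _ Hc] := EVT_max ab cf; have [d _ Hd] := EVT_min ab cf.
exists (`|f c| + `|f d|) => x xab.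
have := Hc x; have := Hd x; rewrite !in_itv/= => /(_ xab) h1 /(_ xab) h2.
rewrite ler_norml; have := ler_norm (f c); have := ler_norm (- f d); rewrite normrN.
by have := normr_ge0 (f c); have := normr_ge0 (f d); lra.
Qed.

End calculus.

(** * The forcing term on the whole line *)

Section forcing.
Context {R : realType}.
Variables (n : nat) (T : R) (f : R -> 'cV[R]_n).
Hypotheses (T1 : 1 < T) (hf : {within `[1, T], continuous f}).

(* The clamp makes [f] continuous on the whole line without changing it on [1, T]. *)
Definition forcing (x : R) : 'cV[R]_n :=
  if 0 < x then f (Num.max 1 (Num.min (expR x) T)) else 0.

Let clamp (x : R) : R := Num.max 1 (Num.min (expR x) T).

Let clamp_itv x : (`[1, T]%classic : set R) (clamp x).
Proof.
by rewrite /= in_itv/= /clamp le_max lexx/= ge_max (ltW T1)/= ge_min lexx orbT.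
Qed.

Let clamp_continuous : continuous clamp.
Proof.
move=> x; apply: (@continuous_max _ _ (cst 1) (fun y => Num.min (expR y) T)).
  exact: cst_continuous.
apply: (@continuous_min _ _ expR (cst T)); first exact: continuous_expR.
exact: cst_continuous.
Qed.

Let coord_within i j : {within `[1, T], continuous (fun t => f t i j)}.
Proof.
apply/subspace_continuousP => x Ax.
have /subspace_continuousP/(_ x Ax) H := hf.
have {}H : f y @[y --> within `[1, T] (nbhs x)] --> f x := H.
exact: (cvg_mx_coord H).
Qed.

Let clamped_continuous i j : continuous (fun x => f (clamp x) i j).
Proof.
exact: (@continuous_comp_within _ clamp (fun t => f t i j) _ clamp_continuous
  clamp_itv (@coord_within i j)).
Qed.

Lemma forcing_le0 x : x <= 0 -> forcing x = 0.
Proof. by move=> x0; rewrite /forcing ltNge x0. Qed.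

Lemma forcingE x : 0 < x -> x <= ln T -> forcing x = f (expR x).
Proof.
move=> x0 xT; rewrite /forcing x0; congr f.
have eT : expR x <= T by rewrite -[leRHS]lnK ?posrE ?ler_expR// (lt_trans ltr01).
rewrite min_l//; apply: max_r.
by rewrite -expR0 ler_expR ltW.
Qed.

Lemma forcing_continuous i j x : 0 < x -> {for x, continuous (fun y => forcing y i j)}.
Proof.
move=> x0; have := @clamped_continuous i j x.
rewrite /prop_for /continuous_at {2}/forcing x0; apply: cvg_trans.
apply: near_eq_cvg; near=> y; rewrite /forcing.
have -> : 0 < y by near: y; exact: lt_nbhsr.
by [].
Unshelve. all: by end_near. Qed.

Lemma measurable_forcing i j : measurable_fun setT (fun y => forcing y i j).
Proof.
rewrite (_ : (fun y => _) = (fun y => if 0 < y then f (clamp y) i j else 0)); last first.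
  by apply/funext => y; rewrite /forcing; case: ifP; rewrite ?mxE.
apply: measurable_fun_if => //; first exact: measurable_fun_ltr.
by apply: measurable_funTS; exact: continuous_measurable_fun.
Qed.

Lemma forcing_bounded i j : exists B, forall x, `|forcing x i j| <= B.
Proof.
have [B HB] := within_itv_bounded (ltW T1) (@coord_within i j).
have B0 : 0 <= B by rewrite (le_trans _ (HB 1 _))// lexx ltW.
exists B => x; rewrite /forcing; case: ifP => _; last by rewrite mxE normr0.
by apply: HB; have := clamp_itv x; rewrite /= in_itv.
Qed.

Lemma mws1_forcing X : mweakly_singular 1 X forcing.
Proof.
move=> i j; have [B HB] := forcing_bounded i j.
apply: (weakly_singular_bounded ltr01 (lexx 1) (measurable_forcing i j)) => [x x0|x _].
  by rewrite forcing_le0// mxE.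
exact: HB.
Qed.

End forcing.

(** * The formula in the logarithmic variable *)

Section explicit_solution.
Context {R : realType}.
Local Notation mu := (@lebesgue_measure R).
Variables (n : nat) (A0 A1 : 'M[R]_n) (a h T : R) (f : R -> 'cV[R]_n).
Hypotheses (a0 : 0 < a) (a1 : a <= 1) (h1 : 1 < h) (T1 : 1 < T).
Hypothesis hf : {within `[1, T], continuous f}.
Local Notation tau := (ln h).
Local Notation ft := (forcing T f).
Variables (Y : R) (N : nat).
Hypotheses (TY : ln T < Y) (YN : Y <= N%:R * tau).

Definition log_solution : R -> 'cV[R]_n := delay_solution A0 A1 a tau ft N.+1.
Local Notation v := log_solution.

Let Y0 : 0 <= Y. Proof. by rewrite (le_trans _ (ltW TY))// ln_ge0// ltW. Qed.
Let tau0 : 0 < tau. Proof. exact: ln_gt0. Qed.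
Let wft : mweakly_singular 1 Y ft. Proof. exact: mws1_forcing. Qed.

Lemma mws1_log_solution : mweakly_singular 1 Y v.
Proof. exact: mws1_delay_solution. Qed.

Lemma log_solution_fix x : x <= Y ->
  v x = mconv (frac_mx n a) (fun y => A0 *m v y + A1 *m v (y - tau) + ft y) x.
Proof. exact: delay_solution_fix. Qed.

Lemma log_solution_continuous i j x : x < Y -> {for x, continuous (fun y => v y i j)}.
Proof.
move=> xY.
rewrite (_ : (fun y => v y i j) = (fun y => \sum_(0 <= m < N.+1)
   \sum_k conv (fun z => layer A0 A1 a m z i k) (fun z => ft z k j) (y - m%:R * tau))); last first.
  apply/funext => y; rewrite /log_solution /delay_solution summxE.
  by apply: eq_bigr => m _; rewrite mxE.
rewrite /prop_for /continuous_at.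
apply: (@cvg_big _ _ _ _ _ add_continuous) => m _.
apply: (@cvg_big _ _ _ _ _ add_continuous) => k _.
apply: (@continuous_comp _ _ _ (fun y => y - m%:R * tau)
  (conv (fun z => layer A0 A1 a m z i k) (fun z => ft z k j))).
  by apply: cvgB => //; exact: cvg_cst.
have [B HB] := forcing_bounded T1 hf k j.
apply: (@conv_continuous _ a Y B) => //.
- exact: mws_layer.
- exact: measurable_forcing.
- by move=> y y0; rewrite forcing_le0// mxE.
- by move=> y /andP[y0 _]; exact: forcing_continuous.
- by rewrite (le_lt_trans _ xY)// gerBl mulr_ge0// ltW.
Qed.

(** Layer by layer: with [x = ln s], the integral of layer [m] against [f] is the convolution of
    that layer with the forcing term at [ln t - m * tau]. *)
Lemma explicit_solutionE t : 1 <= t <= T ->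
  mx_integral `[1, t] (fun s => s^-1 *: (delayedML h a a A0 A1 t s *m f s)) = v (ln t).
Proof.
move=> /andP[t1 tT]; have t0 : 0 < t by rewrite (lt_le_trans ltr01).
have h0 : 0 < h by rewrite (lt_trans _ h1).
have ltY m : ln t - m%:R * tau <= Y.
  rewrite lerBlDr (@le_trans _ _ (ln T))//.
    by rewrite ler_ln ?posrE// (lt_trans ltr01).
  by rewrite (le_trans (ltW TY))// lerDl mulr_ge0// ltW.
have wft' : mweakly_singular a Y ft by exact: mws1W.
have wl m : mweakly_singular a Y (layer A0 A1 a m) by exact: mws_layer.
have ml m i k : measurable_fun setT (fun y => layer A0 A1 a m y i k) by case: (wl m i k).
have mft k j : measurable_fun setT (fun y => ft y k j) by case: (wft k j).
apply/matrixP => i j; rewrite mxE.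
transitivity (\int[mu]_x \sum_(0 <= m < N.+1) (layer A0 A1 a m (ln t - m%:R * tau - x) *m ft x) i j).
  apply: Rintegral_ln_itv => //.
  - by apply: measurable_sum => m; exact: measurable_mulmx_entry.
  - move=> s /andP[s1 st]; have s0 : 0 < s by rewrite (lt_trans ltr01).
    rewrite mxE; congr (_ * _).
    rewrite (delayedML_layer A0 A1 a0 h1 (N := N.+1)) => //; last first.
      rewrite (@le_trans _ _ (h ^+ N.+1))//; last by rewrite ler_peMl ?exprn_ge0 ?(ltW h0)// ltW.
      rewrite (le_trans tT)// -ler_ln ?posrE ?exprn_gt0 ?(lt_trans ltr01)//.
      rewrite lnXn// -mulr_natl (le_trans (ltW TY))// (le_trans YN)// ler_pM2r// ler_nat//.
    rewrite mulmx_suml summxE; apply: eq_bigr => m _.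
    rewrite (forcingE _ T1); last 2 first.
    + by rewrite ln_gt0.
    + by rewrite ler_ln ?posrE ?(lt_trans ltr01)// (le_trans (ltW st)).
    rewrite lnK ?posrE//.
    by have -> : ln t - m%:R * tau - ln s = ln t - ln s - m%:R * tau by ring.
  - move=> x; rewrite ln1 => -[x0|tx]; rewrite big1// => m _.
      by rewrite forcing_le0// mulmx0 mxE.
    rewrite (mws_le0 Y0 (wl m)) ?mul0mx ?mxE//.
    by rewrite addrAC subr_le0 (le_trans _ (mulr_ge0 (ler0n _ m) (ltW tau0)))// subr_le0.
rewrite /log_solution /delay_solution summxE.
rewrite Rintegral_sum.
  apply: eq_bigr => m _.
  have := @mconv_integral _ a Y _ _ _ (layer A0 A1 a m) ft (ln t - m%:R * tau) 0 i j a0 Y0 (wl m) wft'.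
  rewrite subr0 => /(_ (ltY m)) <-.
  by apply: eq_Rintegral => x _; rewrite subr0.
move=> m.
have := integrable_sum measurableT (index_enum 'I_n) (P := xpredT)
  (fun k _ => ws_int a0 Y0 (wl m i k) (wft' k j) (ltY m)).
by apply: eq_integrable => // s _ /=; rewrite mxE sumEFin.
Qed.

End explicit_solution.

(** * Derivatives relative to an interval *)

Section one_sided_derivative.
Context {R : realType}.

(** Properness makes the limit in [derive_within] unique, also at [t = b] where only left neighbours
    remain. *)
Lemma proper_within_left (c b t : R) : c < t <= b ->
  ProperFilter (within `]c, b] t^').
Proof.
move=> /andP[ct tb]; apply: Build_ProperFilter.
rewrite /within/= => /nbhs_ballP[e /= e0 He].
pose d := Num.min ((t - c) / 2) (e / 2).
have d0 : 0 < d by rewrite lt_min !divr_gt0// subr_gt0.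
have dtc : d <= (t - c) / 2 by rewrite ge_min lexx.
have de : d <= e / 2 by rewrite ge_min lexx orbT.
apply: (He (t - d)).
- by rewrite /ball/= opprB addrC subrK gtr0_norm//; lra.
- by rewrite lt_eqF//; lra.
- by rewrite /= in_itv/=; lra.
Qed.

(** Caratheodory's criterion supplies a slope function continuous at [t], and continuity restricts
    to any [D]. *)
Lemma cvg_quotient_within (phi F : R -> R) (D : set R) (t d : R) : D t ->
  (forall u, D u -> phi u = F u) -> is_derive t 1 F d ->
  ((u - t)^-1 * (phi u - phi t)) @[u --> within D t^'] --> d.
Proof.
move=> Dt phiF /is_derive1_caratheodory [g [Fg cg gt]].
have H : g u @[u --> within D t^'] --> d.
  rewrite -gt; apply: cvg_within_filter.
  by move/continuous_withinNx : cg.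
apply: cvg_trans H; apply: near_eq_cvg.
have : \forall u \near within D t^', D u by exact: withinT.
have : \forall u \near within D t^', u != t.
  by apply: cvg_within; exact: withinT.
apply: filterS2 => u ut Du.
by rewrite !phiF// Fg mulrCA mulVf ?mulr1// subr_eq0.
Qed.

Lemma is_derive_within (phi : R -> R) (c b t d : R) : c < t < b ->
  ((u - t)^-1 * (phi u - phi t)) @[u --> within `]c, b] t^'] --> d ->
  is_derive t 1 phi d.
Proof.
move=> ctb H; apply/is_derive1_caratheodory.
exists (fun u => if u == t then d else (u - t)^-1 * (phi u - phi t)); split.
- move=> u; have [->|ut] := eqVneq u t; first by rewrite !subrr mulr0.
  by rewrite mulrAC mulVf ?mul1r// subr_eq0.
- apply/continuous_withinNx; rewrite eqxx => P /H HP.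
  have Hb : \forall u \near t, u \in `]c, b[ by apply: near_in_itvoo; rewrite in_itv.
  apply: filterS2 Hb HP => u; rewrite in_itv/= => /andP[cu ub] HP ut.
  by rewrite /= (negbTE ut); apply: HP => //; rewrite /= in_itv/= cu ltW.
- by rewrite eqxx.
Qed.

End one_sided_derivative.

(** * A solution and its Hadamard integrals in the logarithmic variable *)

Section log_pullback.
Context {R : realType}.
Local Notation mu := (@lebesgue_measure R).
Variables (n : nat) (T : R) (y : R -> 'cV[R]_n).
Hypotheses (T1 : 1 < T) (cy : {within `]1, T], continuous y}).

(** The cut at [ln T] gives a function on the whole line; convolutions at points up to [ln T] do not
    see it, the kernels vanishing at nonpositive arguments. The value 0 for [x <= 0] encodes the
    zero history. *)
Definition log_pullback (x : R) : 'cV[R]_n :=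
  if (0 < x) && (x < ln T) then y (expR x) else 0.
Local Notation u := log_pullback.

Let T0 : 0 < T. Proof. exact: lt_trans T1. Qed.

Lemma log_pullback_le0 x : x <= 0 -> u x = 0.
Proof. by move=> x0; rewrite /log_pullback ltNge x0. Qed.

Lemma log_pullbackE t : 1 < t < T -> u (ln t) = y t.
Proof.
move=> /andP[t1 tT]; have t0 : 0 < t by exact: lt_trans t1.
by rewrite /log_pullback ln_gt0// ltr_ln ?posrE// tT lnK.
Qed.

Lemma log_pullback_continuous i j x : 0 < x < ln T ->
  {for x, continuous (fun z => u z i j)}.
Proof.
move=> /andP[x0 xT].
have ex : expR x \in `]1, T[%classic.
  rewrite inE/= in_itv/= -expR0 ltr_expR x0/=.
  by rewrite -[ltRHS]lnK ?posrE// ltr_expR.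
have cy' : {in `]1, T[%classic, continuous y}.
  rewrite -continuous_open_subspace; last exact: interval_open.
  by apply: continuous_subspaceW cy; exact: subset_itv_oo_oc.
have H : y (expR z) i j @[z --> x] --> y (expR x) i j.
  apply: (cvg_mx_coord (f := fun z => y (expR z))).
  apply: (@continuous_comp _ _ _ expR y); first exact: continuous_expR.
  exact: cy'.
rewrite /prop_for /continuous_at {2}/log_pullback x0 xT/=; apply: cvg_trans H.
apply: near_eq_cvg; near=> z; rewrite /log_pullback.
have -> : 0 < z by near: z; exact: lt_nbhsr.
have -> // : z < ln T by near: z; exact: lt_nbhsl.
Unshelve. all: by end_near. Qed.

Lemma measurable_log_pullback i j : measurable_fun setT (fun z => u z i j).
Proof.
rewrite (_ : (fun z => u z i j) = (fun z => u z i j) \_ `]0, ln T[); last first.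
  apply/funext => z; rewrite /patch mem_setE in_itv/=; case: ifPn => //.
  by rewrite /log_pullback => /negbTE ->; rewrite mxE.
apply: (proj1 (measurable_restrict _ _ _)) => //; rewrite setTI.
apply: open_continuous_measurable_fun; first exact: interval_open.
by move=> z; rewrite inE/= in_itv/=; exact: log_pullback_continuous.
Qed.

Variable a : R.
Hypotheses (a0 : 0 < a) (a1 : a < 1).
Local Notation k := (@frac_kernel R (1 - a)).

Section at_point.
Variables (t : R) (i : 'I_n) (j : 'I_1).
Hypothesis tT : 1 < t <= T.

Let g0' : Gamma (1 - a) != 0 :> R.
Proof. by rewrite lt0r_neq0// Gamma_gt0// subr_gt0. Qed.

Let G x := Gamma (1 - a) * (k (ln t - x) * u x i j).

Let mG : measurable_fun setT G.
Proof.
apply: measurable_funM => //; apply: measurable_conv_integrand.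
  exact: measurable_frac_kernel.
exact: measurable_log_pullback.
Qed.

Let GE s : (`]1, t]%classic : set R) s ->
  hadamard_integrand (- a) y t s i j = s^-1 * G (ln s).
Proof.
move: tT => /andP[t1 tT']; rewrite /= in_itv/= => /andP[s1 st].
have t0 : 0 < t by exact: lt_trans t1.
have s0 : 0 < s by exact: lt_trans s1.
rewrite /hadamard_integrand mxE /G; move: st; rewrite le_eqVlt => /predU1P[->|st].
  (* At [s = t] the power of 0 is 0 by convention, and so is the kernel; hence the cut of
     [log_pullback] at [ln T] is harmless for [t = T]. *)
  rewrite divff ?gt_eqF// ln1 powR0 ?oppr_eq0 ?gt_eqF// !mul0r.
  by rewrite frac_kernel_le0 ?subrr// mul0r !mulr0.
have lst : 0 < ln t - ln s by rewrite subr_gt0 ltr_ln ?posrE.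
rewrite log_pullbackE ?s1 ?(lt_le_trans st)// frac_kernelE// ln_div ?posrE//.
have -> : 1 - a - 1 = - a by ring.
move: g0'; move: (Gamma _) (_ `^ _) (y s i j) => g p z g0.
by field; rewrite g0 gt_eqF.
Qed.

Let G0 s : 0 < s -> ~ (`]1, t]%classic : set R) s -> G (ln s) = 0.
Proof.
move: tT => /andP[t1 tT']; have t0 : 0 < t by exact: lt_trans t1.
move=> s0 /= /negP; rewrite in_itv/= negb_and -!leNgt -ltNge => /orP[s1|ts].
  by rewrite /G log_pullback_le0 ?mxE ?mulr0// ln_le0.
by rewrite /G frac_kernel_le0 ?mul0r ?mulr0// subr_le0 ler_ln ?posrE// ltW.
Qed.

Lemma hadamard_integrableP :
  lebesgue_measure.-integrable `]1, t]
    (fun s => (hadamard_integrand (- a) y t s i j)%:E) <->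
  mu.-integrable setT (fun s => (k (ln t - s) * u s i j)%:E).
Proof.
have A0 s : (`]1, t]%classic : set R) s -> 0 < s.
  by rewrite /= in_itv/= => /andP[s1 _]; exact: lt_trans s1.
have mA : measurable (`]1, t]%classic : set R) by [].
have [h1 h2] := integrable_ln mA A0 mG GE G0.
split=> [H|iG].
  have iG := h1 H.
  apply: eq_integrable (integrable_normM (Gamma (1 - a))^-1 iG) => // s _.
  by rewrite /G/= mulKf.
by apply: h2; exact: integrable_normM.
Qed.

Lemma hadamard_integral :
  mu.-integrable setT (fun s => (k (ln t - s) * u s i j)%:E) ->
  mx_integral `]1, t] (hadamard_integrand (- a) y t) i j =
  Gamma (1 - a) * conv k (fun z => u z i j) (ln t).
Proof.
move=> iG; rewrite mxE (@Rintegral_ln _ `]1, t] _ G _ mG GE G0); last first.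
  by move=> s /=; rewrite in_itv/= => /andP[s1 _]; exact: lt_trans s1.
by rewrite /conv -RintegralZl.
Qed.

End at_point.
End log_pullback.

(** * Auxiliary integrability and continuity facts *)

Section integrability_and_continuity.
Context {R : realType}.
Local Notation mu := (@lebesgue_measure R).

(** After truncation at [Z] the bound holds on the whole line, hence up to every horizon [Z']. *)
Lemma weakly_singular_trunc b (Z Z' : R) (K : R -> R) : 0 < b -> weakly_singular b Z K ->
  weakly_singular b Z' (fun s => if s < Z then K s else 0).
Proof.
move=> b0 [mK [C C0 HC]]; split.
  apply: measurable_fun_if => //; first exact: measurable_fun_ltr.
  exact: measurable_funTS.
exists C => // x _; case: ifPn => [xZ|_]; first exact: HC (ltW xZ).
by rewrite normr0 mulr_ge0// frac_kernel_ge0.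
Qed.

Lemma conv_le0 (K L : R -> R) x : (forall s, s <= 0 -> K s = 0) ->
  (forall s, s <= 0 -> L s = 0) -> x <= 0 -> conv K L x = 0.
Proof.
move=> K0 L0 x0; rewrite /conv /Rintegral integral0_eq// => s _.
have [s0|s0] := leP s 0; first by rewrite L0// mulr0.
by rewrite K0 ?mul0r// subr_le0 (le_trans x0)// ltW.
Qed.

Lemma integrable_frac_kernel1 (w : R -> R) x : mu.-integrable setT (EFin \o w) ->
  mu.-integrable setT (fun s => (frac_kernel 1 (x - s) * w s)%:E).
Proof.
move=> iw; have mw : measurable_fun setT w by apply/measurable_EFinP; exact: measurable_int iw.
apply: le_integrable iw => //.
  apply/measurable_EFinP; apply: measurable_conv_integrand => //.
  exact: measurable_frac_kernel.
move=> s _ /=; rewrite lee_fin frac_kernel1.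
by case: (0 < x - s); rewrite ?mul1r// mul0r normr0.
Qed.

Lemma integrable_shift (w : R -> R) c : measurable_fun setT w -> mu.-integrable setT (EFin \o w) ->
  mu.-integrable setT (fun s => (w (s - c))%:E).
Proof.
move=> mw iw; apply: eq_integrable (integrable_changeV (itv_change_shift c) mw iw) => //.
by move=> s _; rewrite mul1r.
Qed.

Lemma integrable_mulmx (p q r : nat) (A : 'M[R]_(p, q)) (w : R -> 'M[R]_(q, r)) i j :
  (forall l, mu.-integrable setT (fun s => (w s l j)%:E)) ->
  mu.-integrable setT (fun s => ((A *m w s) i j)%:E).
Proof.
move=> iw.
apply: eq_integrable (integrable_sum measurableT (index_enum 'I_q) (P := xpredT)
  (fun l _ => integrable_normM (A i l) (iw l))) => // s _ /=.
by rewrite mxE sumEFin.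
Qed.

Lemma mulmx_entry_continuous (p q r : nat) (A : 'M[R]_(p, q)) (F : R -> 'M[R]_(q, r)) i j x :
  (forall k, {for x, continuous (fun z => F z k j)}) ->
  {for x, continuous (fun z => (A *m F z) i j)}.
Proof.
move=> cF.
rewrite (_ : (fun z => _) = (fun z => \sum_k A i k * F z k j)); last first.
  by apply/funext => z; rewrite mxE.
rewrite /prop_for /continuous_at; apply: (@cvg_big _ _ _ _ _ add_continuous) => k _.
by apply: cvgM; [exact: cvg_cst|exact: cF].
Qed.

End integrability_and_continuity.

(** * Equivalence of the equation and the formula *)

Section equivalence.
Context {R : realType}.
Local Notation mu := (@lebesgue_measure R).
Variables (n : nat) (A0 A1 : 'M[R]_n) (a h T : R) (f : R -> 'cV[R]_n).
Hypotheses (a0 : 0 < a) (a1 : a < 1) (h1 : 1 < h) (hT : h <= T).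
Hypothesis hf : {within `[1, T], continuous f}.
Local Notation tau := (ln h).
Local Notation ft := (forcing T f).
Local Notation X := (ln T).
(* A horizon beyond [ln T] makes the formula differentiable on both sides at [t = T]. *)
Local Notation Y := (ln T + 1).
Variable N : nat.
Hypothesis YN : Y <= N%:R * tau.
Local Notation v := (log_solution A0 A1 a h T f N).
Local Notation kk := (@frac_kernel R).

Let T1 : 1 < T. Proof. exact: lt_le_trans hT. Qed.
Let T0 : 0 < T. Proof. exact: lt_trans T1. Qed.
Let tau0 : 0 < tau. Proof. exact: ln_gt0. Qed.
Let X0 : 0 < X. Proof. exact: ln_gt0. Qed.
Let XY : X < Y. Proof. by rewrite ltrDl. Qed.
Let Y0 : 0 <= Y. Proof. by rewrite (le_trans (ltW X0))// ltW. Qed.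
Let h0 : 0 < h. Proof. exact: lt_trans h1. Qed.
Let b0 : 0 < 1 - a. Proof. by rewrite subr_gt0. Qed.
Let g0 : Gamma (1 - a) != 0 :> R. Proof. by rewrite lt0r_neq0// Gamma_gt0. Qed.
Let wv : mweakly_singular 1 Y v.
Proof. exact: (mws1_log_solution A0 A1 a0 h1 T1 hf N XY). Qed.

(** The right-hand side of the equation along [v]; as [v] vanishes for [x <= 0], the translate
    carries the zero history. *)
Let g (x : R) : 'cV[R]_n := A0 *m v x + A1 *m v (x - tau) + ft x.

Let wg : mweakly_singular 1 Y g.
Proof.
have w1 := mwsMl ltr01 A0 wv.
have w2 := mwsMl ltr01 A1 (mws1_shift Y0 (ltW tau0) wv).
exact: (mwsD ltr01 (mwsD ltr01 w1 w2) (mws1_forcing T1 hf Y)).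
Qed.

Let vE x i j : x <= Y -> v x i j = conv (kk a) (fun s => g s i j) x.
Proof.
move=> xY; rewrite (log_solution_fix A0 A1 a0 (ltW a1) h1 T1 hf XY YN xY).
by rewrite mconv_frac_mxl.
Qed.

(** Truncation makes the right-hand side integrable over the line, as [conv_assoc_frac_kernel] and
    [conv1_derive] require. *)
Let gt i j (s : R) : R := if s < Y then g s i j else 0.

Let wgt i j Z : weakly_singular 1 Z (gt i j).
Proof. exact: weakly_singular_trunc (wg i j). Qed.

Let igt i j : mu.-integrable setT (EFin \o gt i j).
Proof. exact: (weakly_singular_integrable ltr01 Y0 (wg i j) (lexx Y)). Qed.

Let gt_le0 i j s : s <= 0 -> gt i j s = 0.
Proof.
move=> s0; rewrite /gt (weakly_singular_le0 Y0 (wg i j) s0).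
by rewrite if_same.
Qed.

Let v_continuous i j x : x < Y -> {for x, continuous (fun z => v z i j)}.
Proof. exact: (log_solution_continuous a0 h1 T1 hf XY). Qed.

Let g_continuous i j x : 0 < x < Y -> {for x, continuous (fun z => g z i j)}.
Proof.
move=> /andP[x0 xY].
rewrite (_ : (fun z => g z i j) =
  (fun z => (A0 *m v z) i j + (A1 *m v (z - tau)) i j + ft z i j)); last first.
  by apply/funext => z; rewrite !mxE.
have c1 := mulmx_entry_continuous (A := A0) (i := i) (fun k => @v_continuous k j x xY).
have xtY : x - tau < Y by rewrite (le_lt_trans _ xY)// gerBl ltW.
have c2 : {for x, continuous (fun z => (A1 *m v (z - tau)) i j)}.
  apply: (mulmx_entry_continuous (F := fun z => v (z - tau))) => k.
  apply: (@continuous_comp _ _ _ (fun z => z - tau) (fun z => v z k j)).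
    by apply: cvgB => //; exact: cvg_cst.
  exact: v_continuous.
have c3 : {for x, continuous (fun z => ft z i j)} by exact: (forcing_continuous T1 hf).
by apply: cvgD; [exact: (cvgD c1 c2)|exact: c3].
Qed.

Let gt_continuous i j x : 0 < x < Y -> {for x, continuous (gt i j)}.
Proof.
move=> xY; have := @g_continuous i j x xY; move: xY => /andP[x0 xY].
rewrite /prop_for /continuous_at {2}/gt xY; apply: cvg_trans.
apply: near_eq_cvg; near=> z; rewrite /gt.
have -> // : z < Y by near: z; exact: lt_nbhsl.
Unshelve. all: by end_near. Qed.

Let Psi i j := conv (kk 1) (gt i j).

Let Psi_derive i j x : 0 < x < Y -> is_derive x 1 (Psi i j) (g x i j).
Proof.
move=> xY; have xY' : x < Y by case/andP: xY.
have -> : g x i j = gt i j x by rewrite /gt xY'.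
apply: conv1_derive; [exact: igt|exact: gt_le0|by case/andP: xY|exact: gt_continuous].
Qed.

Let conv_vE i j x : x <= Y ->
  conv (kk (1 - a)) (fun z => v z i j) x = Psi i j x.
Proof.
move=> xY; rewrite /Psi -(conv_assoc_frac_kernel b0 a0 _ (igt i j)); last 2 first.
- by rewrite subrK.
- move=> s _; apply: (weakly_singular_conv_integrable a0 ltr01 (normr_ge0 s) _ (wgt i j _) (ler_norm s)).
  exact: weakly_singular_frac_kernel.
apply: eq_Rintegral => s _.
have [sx|xs] := ltP s x; last by rewrite frac_kernel_le0 ?mul0r// subr_le0.
have sY : s < Y by exact: lt_le_trans xY.
congr (_ * _); rewrite vE ?(ltW sY)//; apply: eq_Rintegral => r _.
rewrite /gt; case: ifPn => //; rewrite -leNgt => Yr.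
by rewrite frac_kernel_le0 ?mul0r// subr_le0 (le_trans (ltW sY)).
Qed.

(** Integration commutes with the matrices and with the delay. Only integrability is asked, so that
    both a solution and the formula qualify as [w]. *)
Lemma conv1_linear (w e : R -> 'cV[R]_n) i j x :
  (forall l, measurable_fun setT (fun s => w s l j)) ->
  (forall l, mu.-integrable setT (fun s => (kk 1 (x - s) * w s l j)%:E)) ->
  (forall l, mu.-integrable setT (fun s => (kk 1 (x - s) * w (s - tau) l j)%:E)) ->
  mu.-integrable setT (fun s => (kk 1 (x - s) * e s i j)%:E) ->
  conv (kk 1) (fun s => (A0 *m w s + A1 *m w (s - tau) + e s) i j) x =
  (A0 *m mconv (frac_mx n 1) w x + A1 *m mconv (frac_mx n 1) w (x - tau)
    + mconv (frac_mx n 1) e x) i j.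
Proof.
move=> mw iw iwt ie.
have mk := @measurable_frac_kernel R 1.
have lin (A : 'M[R]_n) (z : R -> 'cV[R]_n) :
    (forall l, mu.-integrable setT (fun s => (kk 1 (x - s) * z s l j)%:E)) ->
    mu.-integrable setT (fun s => (kk 1 (x - s) * (\sum_l A i l * z s l j))%:E) /\
    conv (kk 1) (fun s => \sum_l A i l * z s l j) x =
      \sum_l A i l * conv (kk 1) (fun s => z s l j) x.
  move=> iz.
  have iAz l : mu.-integrable setT (fun s => (kk 1 (x - s) * (A i l * z s l j))%:E).
    by apply: eq_integrable (integrable_normM (A i l) (iz l)) => // s _; rewrite mulrCA.
  split.
    apply: eq_integrable (integrable_sum measurableT (index_enum 'I_n) (P := xpredT)
      (fun l _ => iAz l)) => // s _ /=.
    by rewrite sumEFin mulr_sumr.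
  rewrite (@conv_sumr _ _ _ _ (fun l s => A i l * z s l j))//.
  by apply: eq_bigr => l _; rewrite convZr.
have [i1 e1] := lin A0 w iw.
have [i2 e2] := lin A1 (fun s => w (s - tau)) iwt.
transitivity (conv (kk 1) (fun s => (\sum_l A0 i l * w s l j)
    + (\sum_l A1 i l * w (s - tau) l j) + e s i j) x).
  apply: eq_Rintegral => s _; congr (_ * _).
  by rewrite mxE; congr (_ + _); rewrite mxE; congr (_ + _); rewrite mxE.
rewrite (@convDr _ _ (fun s => (\sum_l A0 i l * w s l j)
    + (\sum_l A1 i l * w (s - tau) l j)) (fun s => e s i j))//; last first.
  apply: eq_integrable (integrableD measurableT i1 i2) => // s _.
  by rewrite -EFinD mulrDr.
rewrite convDr// e1 e2 [RHS]mxE mconv_frac_mxl; congr (_ + _).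
rewrite [RHS]mxE; congr (_ + _); rewrite [RHS]mxE; apply: eq_bigr => l _.
  by rewrite mconv_frac_mxl.
by rewrite mconv_frac_mxl (@conv_shift _ _ (fun s => w s l j)).
Qed.

(** * The formula satisfies the equation *)

Section formula_solves.
Variable y : R -> 'cV[R]_n.
Hypothesis yE : forall t, 1 <= t <= T -> y t = v (ln t).
Hypothesis y0 : forall t, h^-1 < t <= 1 -> y t = 0.

Let cy : {within `]1, T], continuous y}.
Proof.
apply/subspace_continuousP => t; rewrite /= in_itv/= => /andP[t1 tT].
have t0 : 0 < t by exact: lt_trans t1.
have H : v (ln s) @[s --> within `]1, T] (nbhs t)] --> v (ln t).
  apply: cvg_mx => i j; apply: cvg_within_filter.
  apply: (@continuous_comp _ _ _ (@ln R) (fun z => v z i j)); first exact: continuous_ln.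
  by apply: v_continuous; rewrite (le_lt_trans _ XY)// ler_ln ?posrE.
suff : y s @[s --> within `]1, T] (nbhs t)] --> y t by [].
rewrite yE ?(ltW t1)//; apply: cvg_trans H; apply: near_eq_cvg.
have : \forall s \near within `]1, T] (nbhs t), (`]1, T]%classic : set R) s by exact: withinT.
by apply: filterS => s; rewrite /= in_itv/= => /andP[s1 sT]; rewrite yE// (ltW s1).
Qed.

Let uE x : x < X -> log_pullback T y x = v x.
Proof.
move=> xX; have [x0|x0] := leP x 0.
  by rewrite log_pullback_le0// (mws_le0 Y0 wv).
rewrite /log_pullback x0 xX/= yE ?expRK//.
rewrite -expR0 ler_expR (ltW x0)/= -[leRHS]lnK ?posrE//.
by rewrite ler_expR ltW.
Qed.

Let int_ku t i j : 1 < t <= T ->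
  mu.-integrable setT (fun s => (kk (1 - a) (ln t - s) * log_pullback T y s i j)%:E).
Proof.
move=> /andP[t1 tT]; have t0 : 0 < t by exact: lt_trans t1.
have tX : ln t <= X by rewrite ler_ln ?posrE.
have wk : weakly_singular (1 - a) Y (kk (1 - a)) by exact: weakly_singular_frac_kernel.
have := weakly_singular_conv_integrable b0 ltr01 Y0 wk (wv i j) (le_trans tX (ltW XY)).
apply: eq_integrable => // s _.
have [st|ts] := ltP s (ln t); first by rewrite uE// (lt_le_trans st).
by rewrite !frac_kernel_le0 ?subr_le0// !mul0r.
Qed.

Let phiE t i j : 1 < t <= T ->
  mx_integral `]1, t] (hadamard_integrand (- a) y t) i j =
  Gamma (1 - a) * Psi i j (ln t).
Proof.
move=> tT; rewrite (hadamard_integral T1 cy a0 a1 tT (int_ku i j tT)).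
move: tT => /andP[t1 tT]; have t0 : 0 < t by exact: lt_trans t1.
have tX : ln t <= X by rewrite ler_ln ?posrE.
rewrite -(conv_vE _ _ (le_trans tX (ltW XY))); congr (_ * _); apply: eq_Rintegral => s _.
have [st|ts] := ltP s (ln t); first by rewrite uE// (lt_le_trans st).
by rewrite frac_kernel_le0 ?subr_le0// !mul0r.
Qed.

(** The chain rule through [ln] produces [t^-1], which the factor [t] of [hadamardD] cancels. *)
Let phi_cvg t : 1 < t <= T ->
  ((z - t)^-1 *: (mx_integral `]1, z] (hadamard_integrand (- a) y z) -
     mx_integral `]1, t] (hadamard_integrand (- a) y t)))
    @[z --> within `]1, T] t^'] --> (Gamma (1 - a) / t) *: g (ln t).
Proof.
move=> tT; have := tT => /andP[t1 tT']; have t0 : 0 < t by exact: lt_trans t1.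
have tX : ln t <= X by rewrite ler_ln ?posrE.
apply: cvg_mx => i j.
have lt0 : 0 < ln t < Y by rewrite ln_gt0// (le_lt_trans tX XY).
have d1 : is_derive t 1 (Psi i j \o @ln R) (g (ln t) i j * t^-1).
  apply: is_derive1_comp; first exact: Psi_derive.
  exact: is_derive1_ln.
have d2 : is_derive t 1 (fun z => Gamma (1 - a) * Psi i j (ln z))
    (Gamma (1 - a) / t * g (ln t) i j).
  have -> : Gamma (1 - a) / t * g (ln t) i j = Gamma (1 - a) *: (g (ln t) i j * t^-1 : R).
    by rewrite -mulrA [t^-1 * _]mulrC.
  exact: (is_deriveZ (Gamma (1 - a)) d1).
have D1t : (`]1, T]%classic : set R) t by rewrite /= in_itv.
pose phi z := mx_integral `]1, z] (hadamard_integrand (- a) y z) i j.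
have phiD z : (`]1, T]%classic : set R) z -> phi z = Gamma (1 - a) * Psi i j (ln z).
  by rewrite /= in_itv/= => zT; exact: phiE.
have H := cvg_quotient_within D1t phiD d2.
rewrite [X in _ --> X]mxE; apply: cvg_trans H.
apply: near_eq_cvg; apply: nearW => z; rewrite [RHS]mxE; congr (_ * _).
by rewrite [RHS]mxE; congr (_ + _); rewrite [RHS]mxE.
Qed.

Lemma formula_is_solution : is_solution h T a A0 A1 f y.
Proof.
split.
- exact: cy.
- move=> t tT; split.
    move=> i j; apply: (proj2 (hadamard_integrableP T1 cy a0 a1 i j tT)).
    exact: int_ku.
  by apply/cvg_ex; eexists; exact: phi_cvg.
- move=> t tT; have := tT => /andP[t1 tT']; have t0 : 0 < t by exact: lt_trans t1.
  have PF := proper_within_left tT.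
  rewrite /hadamardD /derive_within (cvg_lim _ (phi_cvg tT))//.
  rewrite !scalerA; set c := (X in X *: _).
  have -> : c = 1.
    rewrite /c; move: g0; move: (Gamma _) => q q0; field.
    by rewrite q0 gt_eqF.
  rewrite scale1r /g.
  rewrite yE ?(ltW t1)//; congr (_ + _ *m _ + _).
    have [th|th] := leP 1 (t / h).
      rewrite yE ?th/=; last by rewrite (le_trans _ tT')// ler_pdivrMr// ler_peMr// ltW.
      by rewrite ln_div ?posrE.
    rewrite y0; last first.
      by rewrite (ltW th) andbT ltr_pdivlMr// mulVf// gt_eqF.
    by rewrite (mws_le0 Y0 wv)// -ln_div ?posrE// ln_le0// ltW.
  rewrite (forcingE _ T1) ?lnK ?posrE//; first by rewrite ln_gt0.
  by rewrite ler_ln ?posrE.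
- exact: y0.
- have -> : (0 : 'cV[R]_n) = \col_i 0 by apply/matrixP => i j; rewrite !mxE.
  apply: cvg_mx => i j; rewrite mxE.
  (* Since [(1 - alpha) - 1 = - alpha], the integral in the initial condition is the one inside
     [hadamardD]; after normalisation it equals [Psi] at [ln t], continuous and null at 0. *)
  have c0 : Psi i j (ln t) @[t --> 1^'+] --> (0 : R).
    apply: cvg_at_right_filter.
    have -> : (0 : R) = Psi i j (ln 1).
      rewrite ln1 /Psi /conv /Rintegral integral0_eq// => s _.
      have [s0|s0] := leP s 0; first by rewrite gt_le0// mulr0.
      by rewrite frac_kernel_le0 ?mul0r// sub0r oppr_le0 ltW.
    apply: (@continuous_comp _ _ _ (@ln R) (Psi i j)); first exact: continuous_ln.
    apply: conv1_continuous; [exact: igt|exact: gt_le0].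
  apply: cvg_trans c0; apply: near_eq_cvg; near=> t.
  have tT : 1 < t <= T.
    by apply/andP; split; near: t; [exact: nbhs_right_gt|exact: nbhs_right_le].
  have -> : hadamardI (1 - a) 1 y t i j =
     (Gamma (1 - a))^-1 * mx_integral `]1, t] (hadamard_integrand (- a) y t) i j.
    by rewrite /hadamardI mxE addrAC subrr add0r.
  by rewrite phiE// mulKf.
Unshelve. all: by end_near. Qed.

End formula_solves.

(** * Every solution is given by the formula *)

Section solution_has_formula.
Variable y : R -> 'cV[R]_n.
Hypothesis sol : is_solution h T a A0 A1 f y.

Let cy : {within `]1, T], continuous y}. Proof. by case: sol. Qed.
Let y0 t : h^-1 < t <= 1 -> y t = 0. Proof. by case: sol => _ _ _ + _; exact. Qed.

Local Notation u := (log_pullback T y).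
Local Notation k := (kk (1 - a)).

Let mu_ i j : measurable_fun setT (fun z => u z i j).
Proof. exact: measurable_log_pullback. Qed.

Let u_le0 i j x : x <= 0 -> u x i j = 0.
Proof. by move=> x0; rewrite log_pullback_le0// mxE. Qed.

Let iku t i j : 1 < t <= T ->
  mu.-integrable setT (fun s => (k (ln t - s) * u s i j)%:E).
Proof.
move=> tT; apply: (proj1 (hadamard_integrableP T1 cy a0 a1 i j tT)).
by case: sol => _ /(_ t tT)[+ _] _ _ _; exact.
Qed.

(** Read off the Hadamard integrand at [t = T]: on []0, X[] the factor [(X - s)^(- a)] is bounded
    below by [X^(- a)], so removing the kernel preserves integrability. *)
Let iu i j : mu.-integrable setT (fun s => (u s i j)%:E).
Proof.
have TT : 1 < T <= T by rewrite T1 lexx.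
pose c := X `^ (- a) / Gamma (1 - a).
have c0 : 0 < c by rewrite divr_gt0 ?powR_gt0// Gamma_gt0.
have := integrable_normM c^-1 (iku i j TT).
apply: le_integrable => //; first by apply/measurable_EFinP; exact: mu_.
move=> s _ /=; rewrite lee_fin.
have [s0|s0] := leP s 0; first by rewrite u_le0// !mulr0.
have [sX|sX] := ltP s X; last first.
  by rewrite /log_pullback (ltNge s) sX andbF mxE !mulr0.
have Xs : 0 < X - s by rewrite subr_gt0.
have k0 : 0 <= k (X - s) by exact: frac_kernel_ge0.
rewrite mulrA [X in _ <= X]normrM ler_peMl// ger0_norm; last first.
  by rewrite mulr_ge0// invr_ge0 ltW.
rewrite ler_pdivlMl// mulr1 frac_kernelE//; have -> : 1 - a - 1 = - a by ring.
rewrite /c ler_wpM2r ?invr_ge0 ?(ltW (Gamma_gt0 b0))// !powRN lef_pV2 ?posrE ?powR_gt0//.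
by rewrite ge0_ler_powR ?nnegrE ?(ltW a0) ?(ltW X0) ?(ltW Xs)// gerBl ltW.
Qed.

Let P i j := conv k (fun z => u z i j).

Let phiE t i j : 1 < t <= T ->
  mx_integral `]1, t] (hadamard_integrand (- a) y t) i j =
  Gamma (1 - a) * P i j (ln t).
Proof. by move=> tT; exact: (hadamard_integral T1 cy a0 a1 tT (iku i j tT)). Qed.

Let ftX (x : R) : 'cV[R]_n := if x < X then ft x else 0.

Let gs (x : R) : 'cV[R]_n := A0 *m u x + A1 *m u (x - tau) + ftX x.

(** The equation solved for the derivative, at interior points, where the derivative relative to
    []1, T]] is an ordinary one. *)
Let phi_derive t i j : 1 < t < T ->
  is_derive t 1 (fun z => mx_integral `]1, z] (hadamard_integrand (- a) y z) i j)
    (Gamma (1 - a) / t * gs (ln t) i j).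
Proof.
move=> tT; have := tT => /andP[t1 tT']; have t0 : 0 < t by exact: lt_trans t1.
have tTl : 1 < t <= T by rewrite t1 ltW.
have ltX : ln t < X by rewrite ltr_ln ?posrE.
case: sol => _ /(_ t tTl)[_ dt] /(_ t tTl) eqt _ _.
have E : derive_within `]1, T]
     (fun z => mx_integral `]1, z] (hadamard_integrand (- a) y z)) t =
    (Gamma (1 - a) / t) *: gs (ln t).
  have -> : gs (ln t) = hadamardD a 1 T y t.
    rewrite eqt /gs log_pullbackE// /ftX ltX (forcingE _ T1) ?lnK ?posrE//.
    - congr (_ + _ *m _ + _); have [th|th] := ltP 1 (t / h).
        rewrite -ln_div ?posrE// log_pullbackE// th/=.
        by rewrite (le_lt_trans _ tT')// ler_pdivrMr// ler_peMr// ltW.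
      rewrite log_pullback_le0 -?ln_div ?posrE ?ln_le0// y0// th andbT.
      by rewrite ltr_pdivlMr// mulVf// gt_eqF.
    - by rewrite ln_gt0.
    - exact: ltW.
  rewrite /hadamardD !scalerA; set c := (X in X *: _).
  have -> : c = 1; last by rewrite scale1r.
  rewrite /c; move: g0; move: (Gamma _) => q q0; field.
  by rewrite q0 gt_eqF.
have H : ((z - t)^-1 *: (mx_integral `]1, z] (hadamard_integrand (- a) y z) -
     mx_integral `]1, t] (hadamard_integrand (- a) y t)))
    @[z --> within `]1, T] t^'] --> (Gamma (1 - a) / t) *: gs (ln t).
  by rewrite -E; exact: dt.
apply: (is_derive_within tT).
have {}H := cvg_mx_coord (i := i) (j := j) H.
rewrite [X in _ --> X]mxE in H.
pose M z := mx_integral `]1, z] (hadamard_integrand (- a) y z).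
have E2 : (fun z => ((z - t)^-1 *: (M z - M t)) i j) =
    (fun z => (z - t)^-1 * (M z i j - M t i j)).
  apply/funext => z; rewrite [LHS]mxE; congr (_ * _).
  by rewrite [LHS]mxE; congr (_ + _); rewrite [LHS]mxE.
by rewrite E2 in H; exact: H.
Qed.

Let P_derive i j x : 0 < x < X -> is_derive x 1 (P i j) (gs x i j).
Proof.
move=> /andP[x0 xX].
have ex : 1 < expR x < T.
  by rewrite -expR0 ltr_expR x0/= -[ltRHS]lnK ?posrE// ltr_expR.
have d1 := phi_derive i j ex.
have d2 := is_derive1_comp d1 (is_derive_expR x).
have d3 := is_deriveZ (Gamma (1 - a))^-1 d2.
rewrite expRK in d3.
have E : (Gamma (1 - a))^-1 *: (Gamma (1 - a) / expR x * gs x i j * expR x : R) = gs x i j.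
  rewrite /GRing.scale/=; have : expR x != 0 by rewrite gt_eqF// expR_gt0.
  move: g0; move: (Gamma _) (expR x) (gs x i j) => q e w q0 e0; field.
  by rewrite e0 q0.
rewrite E in d3; apply: near_eq_is_derive d3.
near=> z; have z1 : 0 < z by near: z; exact: lt_nbhsr.
have zX : z < X by near: z; exact: lt_nbhsl.
have ez : 1 < expR z <= T.
  by rewrite -expR0 ltr_expR z1/= -[leRHS]lnK ?posrE// ler_expR ltW.
rewrite /= phiE// expRK; exact: mulKf.
Unshelve. all: by end_near. Qed.

Let iftX i j : mu.-integrable setT (fun s => (ftX s i j)%:E).
Proof.
have := weakly_singular_integrable ltr01 (ltW X0) (mws1_forcing T1 hf X i j) (lexx X).
by apply: eq_integrable => // s _; rewrite /ftX; case: ifP; rewrite ?mxE.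
Qed.

Let igs i j : mu.-integrable setT (EFin \o (fun s => gs s i j)).
Proof.
have i1 := integrable_mulmx A0 i (fun l => iu l j).
have i2 := integrable_mulmx A1 i (w := fun s => u (s - tau))
  (fun l => integrable_shift tau (mu_ l j) (iu l j)).
have := integrableD measurableT (integrableD measurableT i1 i2) (iftX i j).
apply: eq_integrable => // s _.
by rewrite /= [in RHS]/gs [in RHS]mxE [X in (X + _)%:E]mxE.
Qed.

Let gs_le0 i j x : x <= 0 -> gs x i j = 0.
Proof.
move=> x0; rewrite /gs /ftX !log_pullback_le0 ?forcing_le0//.
  by rewrite !mulmx0 !add0r if_same mxE.
by rewrite subr_le0 (le_trans x0)// ltW.
Qed.

Let Q i j := conv (kk 1) (fun s => gs s i j).

Let gs_continuous i j x : 0 < x < X -> x != tau -> {for x, continuous (fun z => gs z i j)}.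
Proof.
move=> xX xt; have /andP[x0 xX'] := xX.
rewrite (_ : (fun z => gs z i j) =
  (fun z => (A0 *m u z) i j + (A1 *m u (z - tau)) i j + ftX z i j)); last first.
  by apply/funext => z; rewrite /gs !mxE.
have c1 := mulmx_entry_continuous (A := A0) (i := i)
  (fun l => @log_pullback_continuous _ _ _ _ T1 cy l j x xX).
have c2 : {for x, continuous (fun z => (A1 *m u (z - tau)) i j)}.
  apply: (mulmx_entry_continuous (F := fun z => u (z - tau))) => l.
  have [tx|tx] := ltP tau x.
    apply: (@continuous_comp _ _ _ (fun z => z - tau) (fun z => u z l j)).
      by apply: cvgB => //; exact: cvg_cst.
    apply: log_pullback_continuous => //.
    by rewrite subr_gt0 tx (le_lt_trans _ xX')// gerBl ltW.
  have xt' : x < tau by rewrite lt_neqAle xt.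
  rewrite /prop_for /continuous_at u_le0 ?subr_le0//.
  apply: cvg_near_cst; near=> z; rewrite u_le0// subr_le0 ltW//.
  by near: z; exact: lt_nbhsl.
have c3 : {for x, continuous (fun z => ftX z i j)}.
  have := forcing_continuous T1 hf (i := i) (j := j) x0.
  rewrite /prop_for /continuous_at {2}/ftX xX'; apply: cvg_trans.
  apply: near_eq_cvg; near=> z; rewrite /ftX.
  have -> // : z < X by near: z; exact: lt_nbhsl.
by apply: cvgD; [exact: (cvgD c1 c2)|exact: c3].
Unshelve. all: by end_near. Qed.

Let Q_derive i j x : 0 < x < X -> x != tau -> is_derive x 1 (Q i j) (gs x i j).
Proof.
move=> xX xt.
apply: (conv1_derive (igs i j)) => [s s0||]; first exact: gs_le0.
  by case/andP: xX.
exact: gs_continuous.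
Qed.

Let Q_continuous i j : continuous (Q i j).
Proof. by apply: (conv1_continuous (igs i j)) => s; exact: gs_le0. Qed.

(* The two sides have equal derivatives except at [tau], where the delayed term may jump. *)
Let PQ_cst i j p q : 0 < p -> p <= q -> q < X -> (q <= tau) || (tau <= p) ->
  P i j p - Q i j p = P i j q - Q i j q.
Proof.
move=> p0 pq qX pqt.
have dF x : 0 < x < X -> {for x, continuous (P i j)}.
  move=> xX; apply: differentiable_continuous; apply/derivable1_diffP.
  by have [] := P_derive i j xX.
apply: (@derive0_cst _ (fun z => P i j z - Q i j z)) => //.
  move=> x /andP[px xq].
  have xX : 0 < x < X by rewrite (lt_trans p0 px) (lt_trans xq).
  have xt : x != tau.
    case/orP: pqt => H; first by rewrite lt_eqF// (lt_le_trans xq).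
    by rewrite gt_eqF// (le_lt_trans H).
  rewrite -(subrr (gs x i j)).
  exact: (is_deriveB (P_derive i j xX) (Q_derive i j xX xt)).
apply: continuous_in_subspaceT => x; rewrite inE/= in_itv/= => /andP[px xq].
have xX : 0 < x < X by rewrite (lt_le_trans p0 px) (le_lt_trans xq).
by apply: cvgB; [exact: dF|exact: Q_continuous].
Qed.

(** The constant value of [P - Q] up to [tau] is its limit at 0, where [P] tends to 0 by the initial
    condition and [Q] by continuity. *)
Let PQ_first i j p : 0 < p -> p < X -> p <= tau -> P i j p = Q i j p.
Proof.
move=> p0 pX pt; apply/eqP; rewrite -subr_eq0; apply/eqP.
have H1 : P i j (ln t) @[t --> 1^'+] --> (0 : R).
  have [_ _ _ _ H] := sol.
  have H' : hadamardI (1 - a) 1 y t i j @[t --> 1^'+] --> (0 : R).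
    have H' := cvg_mx_coord (i := i) (j := j) H.
    by rewrite [X in _ --> X]mxE in H'; exact: H'.
  apply: cvg_trans H'; apply: near_eq_cvg.
  near=> t.
  have tT : 1 < t <= T.
    by apply/andP; split; near: t; [exact: nbhs_right_gt|exact: nbhs_right_le].
  have -> : hadamardI (1 - a) 1 y t i j =
     (Gamma (1 - a))^-1 * mx_integral `]1, t] (hadamard_integrand (- a) y t) i j.
    by rewrite /hadamardI mxE addrAC subrr add0r.
  by rewrite phiE// mulKf.
have H2 : Q i j (ln t) @[t --> 1^'+] --> (0 : R).
  apply: cvg_at_right_filter.
  have -> : (0 : R) = Q i j (ln 1).
    rewrite ln1 /Q conv_le0// => s; last exact: gs_le0.
    exact: frac_kernel_le0.
  apply: (@continuous_comp _ _ _ (@ln R) (Q i j)); first exact: continuous_ln.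
  exact: Q_continuous.
have H3 : (P i j (ln t) - Q i j (ln t)) @[t --> 1^'+] --> (0 : R).
  by rewrite -(subrr (0 : R)); apply: cvgB; [exact: H1|exact: H2].
rewrite -[RHS](cvg_lim _ H3)//; apply/esym/cvg_lim => //.
apply: cvg_near_cst; near=> t.
have t1 : 1 < t by near: t; exact: nbhs_right_gt.
have tp : t <= expR p by near: t; apply: nbhs_right_le; rewrite -expR0 ltr_expR.
have t0 : 0 < t by exact: lt_trans t1.
apply: PQ_cst => //.
- by rewrite ln_gt0.
- by rewrite -ler_expR lnK ?posrE.
- by rewrite pt.
Unshelve. all: by end_near. Qed.

(** Beyond [tau] the difference is constant again, starting at [tau] itself, where it is 0 by
    [PQ_first]. *)
Let PQ i j x : x < X -> P i j x = Q i j x.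
Proof.
move=> xX; have [x0|x0] := leP x 0.
  by rewrite /P /Q !conv_le0// => s; [exact: frac_kernel_le0|exact: gs_le0|exact: frac_kernel_le0|exact: u_le0].
have [xt|tx] := leP x tau; first exact: PQ_first.
have tX : tau < X by exact: lt_trans xX.
apply/eqP; rewrite -subr_eq0 -(@PQ_cst i j tau x) ?(ltW tx) ?lexx ?orbT// subr_eq0.
by apply/eqP; exact: PQ_first.
Qed.

Let W := mconv (frac_mx n 1) u.
Let V := mconv (frac_mx n 1) v.
Let F := mconv (frac_mx n 1) ftX.

Let WE x i j : W x i j = conv (kk 1) (fun z => u z i j) x.
Proof. exact: mconv_frac_mxl. Qed.

Let VE x i j : V x i j = conv (kk 1) (fun z => v z i j) x.
Proof. exact: mconv_frac_mxl. Qed.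

Let W_fix x : x <= X ->
  W x = mconv (frac_mx n a) (fun y => A0 *m W y + A1 *m W (y - tau) + F y) x.
Proof.
move=> xX; apply/matrixP => i j; rewrite WE mconv_frac_mxl.
rewrite -(conv_assoc_frac_kernel a0 b0 _ (iu i j)); last 2 first.
- by rewrite addrC subrK.
- move=> s sx; have [s0|s0] := leP s 0.
    apply: (eq_integrable measurableT (cst 0%E)); last exact: integrable0.
    move=> r _; congr EFin; apply/esym.
    have [r0|r0] := leP r 0; first by rewrite u_le0 ?mulr0.
    by rewrite frac_kernel_le0 ?mul0r// subr_le0 (le_trans s0)// ltW.
  (* For [s > 0] the integrability needed here is the one built into the Hadamard derivative at
     [expR s]. *)
  have es : 1 < expR s <= T.
    by rewrite -expR0 ltr_expR s0/= -[leRHS]lnK ?posrE// ler_expR (le_trans (ltW sx)).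
  by have := iku i j es; rewrite expRK.
apply: eq_Rintegral => s _.
have [sx|xs] := ltP s x; last by rewrite frac_kernel_le0 ?mul0r// subr_le0.
congr (_ * _); rewrite -/(P i j) PQ ?(lt_le_trans sx)// /Q conv1_linear => [//|l|l|l|].
- exact: mu_.
- exact: (integrable_frac_kernel1 _ (iu l j)).
- apply: (integrable_frac_kernel1 (w := fun z => u (z - tau) l j)).
  exact: (integrable_shift tau (mu_ l j) (iu l j)).
- exact: (integrable_frac_kernel1 _ (iftX i j)).
Qed.

Let wvX : mweakly_singular 1 X v.
Proof. by move=> i j; exact: (weakly_singularS (ltW XY) (wv i j)). Qed.

Let wgX : mweakly_singular 1 X g.
Proof. by move=> i j; exact: (weakly_singularS (ltW XY) (wg i j)). Qed.

Let w1 : weakly_singular 1 X (kk 1).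
Proof. exact: weakly_singular_frac_kernel. Qed.

(** Convolve [v = k_a * g] with [frac_kernel 1], which commutes with [frac_kernel a]. Here the bound
    on [v] permits associativity within the weakly singular class. *)
Let V_fix x : x <= X ->
  V x = mconv (frac_mx n a) (fun y => A0 *m V y + A1 *m V (y - tau) + F y) x.
Proof.
move=> xX; apply/matrixP => i j; rewrite VE mconv_frac_mxl.
have X0' := ltW X0.
have wa : weakly_singular a X (kk a) by exact: weakly_singular_frac_kernel.
have w1a := weakly_singular_le a0 (ltW a1) w1.
have wga := weakly_singular_le a0 (ltW a1) (wgX i j).
rewrite (eq_conv X0' w1 xX (fun p pX => vE i j (le_trans pX (ltW XY)))).
rewrite -(weakly_singular_conv_assoc a0 X0' w1a wa wga xX).
have -> : conv (kk 1) (kk a) = conv (kk a) (kk 1).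
  apply/funext => z; apply: convC; exact: measurable_frac_kernel.
rewrite (weakly_singular_conv_assoc a0 X0' wa w1a wga xX).
apply: (eq_conv X0' wa xX) => p pX.
have -> : F p = mconv (frac_mx n 1) ft p.
  apply/matrixP => i' j'; rewrite !mconv_frac_mxl; apply: eq_Rintegral => s _.
  have [sp|ps] := ltP s p; last by rewrite frac_kernel_le0 ?mul0r// subr_le0.
  by rewrite /ftX (lt_le_trans sp).
have int1 (w : R -> R) : weakly_singular 1 X w ->
    mu.-integrable setT (fun s => (kk 1 (p - s) * w s)%:E).
  by move=> ww; exact: (weakly_singular_conv_integrable ltr01 ltr01 X0' w1 ww pX).
apply: conv1_linear => [l|l|l|].
- by case: (wvX l j).
- exact: (int1 _ (wvX l j)).
- exact: (int1 _ (mws1_shift X0' (ltW tau0) wvX l j)).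
- exact: (int1 _ (mws1_forcing T1 hf X i j)).
Qed.

(* Unlike [u], its primitive [W] is bounded near 0, so uniqueness applies to it. *)
Let wW : mweakly_singular 1 X W.
Proof.
move=> i j; apply: (@weakly_singular_eq _ _ _ (conv (kk 1) (fun z => u z i j))).
  by move=> x; rewrite WE.
have cW : continuous (conv (kk 1) (fun z => u z i j)).
  by apply: (conv1_continuous (iu i j)) => s; exact: u_le0.
have W0 x : x <= 0 -> conv (kk 1) (fun z => u z i j) x = 0.
  by move=> x0; rewrite conv_le0// => s; [exact: frac_kernel_le0|exact: u_le0].
have [B HB] := within_itv_bounded (ltW X0)
  (continuous_subspaceT (A := `[0, X]%classic) cW).
apply: (@weakly_singular_bounded _ _ _ `|B|) => //.
  by apply: measurable_conv => //; exact: measurable_frac_kernel.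
move=> x xX; have [x0|x0] := leP x 0; first by rewrite W0// normr0.
by rewrite (le_trans _ (ler_norm B))// HB// xX ltW.
Qed.

Let wV : mweakly_singular 1 X V.
Proof.
apply: (mws1_mconv ltr01 (ltW X0)) => //.
exact: mws_frac_mx.
Qed.

Let WV x : x <= X -> W x = V x.
Proof.
move=> xX; apply/eqP; rewrite -subr_eq0; apply/eqP.
have X0' := ltW X0.
have wD : mweakly_singular 1 X (fun z => W z - V z).
  exact: (mwsD ltr01 wW (mwsN wV)).
apply: (delay_homogeneous0 (A0 := A0) (A1 := A1) a0 (ltW a1) tau0 X0' wD) => // {}x {}xX.
have wF : mweakly_singular a X F.
  apply: mws1W => //; first exact: ltW.
  apply: (mws1_mconv ltr01 X0'); first exact: mws_frac_mx.
  move=> i j; apply: (@weakly_singular_eq _ _ _ (fun s => if s < X then ft s i j else 0)).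
    by move=> s; rewrite /ftX; case: ifP; rewrite ?mxE.
  exact: weakly_singular_trunc (mws1_forcing T1 hf X i j).
have wG (Z : R -> 'cV[R]_n) : mweakly_singular 1 X Z ->
    mweakly_singular a X (fun y => A0 *m Z y + A1 *m Z (y - tau) + F y).
  move=> wZ.
  have wZt := mws1_shift X0' (ltW tau0) wZ.
  have wA0 := mwsMl a0 A0 (mws1W a0 (ltW a1) wZ).
  have wA1 := mwsMl a0 A1 (mws1W a0 (ltW a1) wZt).
  exact: (mwsD a0 (mwsD a0 wA0 wA1) wF).
have wK : mweakly_singular a X (frac_mx n a) by exact: mws_frac_mx.
rewrite W_fix// V_fix// -(mconvNr a0 X0' wK (wG _ wV) xX).
rewrite -(mconvDr a0 X0' wK (wG _ wW) (mwsN (wG _ wV)) xX).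
apply: (eq_mconv X0' wK xX) => p _.
by rewrite !mulmxBr !opprD addrACA subrr addr0 addrACA.
Qed.

Let uv x : 0 < x < X -> u x = v x.
Proof.
move=> xX; have /andP[x0 xX'] := xX; apply/matrixP => i j.
have cu := log_pullback_continuous T1 cy (i := i) (j := j) xX.
have du := conv1_derive (iu i j) (fun s => @u_le0 i j s) x0 cu.
pose vt s := if s < X then v s i j else 0.
have cvt : {for x, continuous vt}.
  have := @v_continuous i j x (lt_trans xX' XY).
  rewrite /prop_for /continuous_at {2}/vt xX'; apply: cvg_trans.
  apply: near_eq_cvg; near=> z; rewrite /vt.
  by have -> : z < X by near: z; exact: lt_nbhsl.
have ivt : mu.-integrable setT (EFin \o vt).
  exact: (weakly_singular_integrable ltr01 (ltW X0) (wvX i j) (lexx X)).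
have vt0 s : s <= 0 -> vt s = 0.
  by move=> s0; rewrite /vt (weakly_singular_le0 (ltW X0) (wvX i j) s0) if_same.
have dv := conv1_derive ivt vt0 x0 cvt.
(* Near [x] the primitives of [u] and of [vt] coincide, so one function has both [u x i j] and
   [vt x] as derivative. *)
have {}dv : is_derive x 1 (conv (kk 1) (fun z => u z i j)) (vt x).
  apply: near_eq_is_derive dv; near=> z.
  have zX : z < X by near: z; exact: lt_nbhsl.
  rewrite -WE WV ?(ltW zX)// VE; apply: eq_Rintegral => s _.
  have [sz|zs] := ltP s z; first by rewrite /vt (lt_trans sz).
  by rewrite frac_kernel_le0 ?mul0r// subr_le0.
have [_ <-] := du; have [_ ->] := dv.
by rewrite /vt xX'.
Unshelve. all: by end_near. Qed.

(** The comparison of [u] and [v] covers [1 < t < T]. At 1 both sides are 0, on the left by the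
    history condition; at [T] both are limits from the left of functions already known to agree. *)
Lemma solution_has_formula t : 1 <= t <= T -> y t = v (ln t).
Proof.
move=> /andP[]; rewrite le_eqVlt => /predU1P[<- _|t1].
  rewrite ln1 (mws_le0 Y0 wv)// y0// lexx andbT.
  by rewrite invf_lt1.
rewrite le_eqVlt => /predU1P[->|tT]; last first.
  have t0 : 0 < t by exact: lt_trans t1.
  by rewrite -(@log_pullbackE _ _ T y) ?t1// uv// ln_gt0//= ltr_ln ?posrE.
have TT : 1 < T <= T by rewrite T1/=.
have PF := proper_within_left TT.
apply/matrixP => i j.
have H1 : y s i j @[s --> within `]1, T] T^'] --> y T i j.
  have H : y s @[s --> within `]1, T] (nbhs T)] --> y T.
    by have /subspace_continuousP := cy; apply; rewrite /= in_itv/= T1 lexx.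
  apply: cvg_mx_coord; apply: cvg_trans H; apply: cvg_app.
  by move=> Z HZ; exact: nbhs_dnbhs HZ.
have H2 : v (ln s) i j @[s --> within `]1, T] T^'] --> v (ln T) i j.
  apply: cvg_within_filter; apply: cvg_trans (cvg_app _ (@nbhs_dnbhs _ T)) _.
  apply: (@continuous_comp _ _ _ (@ln R) (fun z => v z i j)).
    exact: continuous_ln.
  exact: v_continuous.
rewrite -[LHS](cvg_lim _ H1)//.
apply: cvg_lim => //; apply: cvg_trans H2; apply: near_eq_cvg.
have H : \forall s \near within `]1, T] T^', (`]1, T]%classic : set R) s by exact: withinT.
have H' : \forall s \near within `]1, T] T^', s != T.
  by rewrite /prop_near1 /within/=; apply: filterS (nbhs_dnbhs_neq T) => s sT' _.
apply: filterS2 H H' => s; rewrite /= in_itv/= => /andP[s1 sT] sT'.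
have sT2 : s < T by rewrite lt_neqAle sT'.
have s0 : 0 < s by exact: lt_trans s1.
by rewrite -(@log_pullbackE _ _ T y) ?s1// uv// ln_gt0//= ltr_ln ?posrE.
Qed.

End solution_has_formula.
End equivalence.

Theorem theorem11 (R : realType) (n l : nat) (h T alpha : R)
    (A0 A1 : 'M[R]_n) (f : R -> 'cV[R]_n)
    (hn : (0 < n)%N) (hl : (0 < l)%N) (hh : 1 < h) (hT : T = h ^+ l)
    (halpha : 0 < alpha < 1)
    (hf : {within `[1, T], continuous f}) :
  forall y : R -> 'cV[R]_n,
    is_solution h T alpha A0 A1 f y <->
    (forall t, h^-1 < t <= 1 -> y t = 0) /\
    (forall t, 1 <= t <= T ->
       y t = mx_integral `[1, t]
               (fun s => s^-1 *: (delayedML h alpha alpha A0 A1 t s *m f s))).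
Proof.
move=> y; have /andP[a0 a1] := halpha.
have leT : h <= T.
  by rewrite hT -(prednK hl) exprS ler_peMr ?exprn_ege1 ?(ltW hh)// (le_trans ler01 (ltW hh)).
have T1 : 1 < T by exact: lt_le_trans leT.
(* Enough layers to reach the horizon [ln T + 1]; those delayed by [ln T] or more contribute nothing
   on [[1, T]]. *)
pose N := (Num.truncn ((ln T + 1) / ln h)).+1.
have YN : ln T + 1 <= N%:R * ln h.
  by rewrite -ler_pdivrMr ?ln_gt0// ltW// truncnS_gt.
have lt1 : ln T < ln T + 1 by rewrite ltrDl.
have E := explicit_solutionE A0 A1 a0 (ltW a1) hh T1 hf lt1 YN.
split=> [sol|[y0 yE]].
  split=> [|t tT]; first by case: sol.
  by rewrite E// (solution_has_formula a0 a1 hh leT hf YN sol).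
apply: (formula_is_solution a0 a1 hh leT hf YN) => // t tT.
by rewrite yE// E.
Qed.
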